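(* Let $c\in\mathbb{C}$ and $\kappa\in\mathbb{C}\setminus\{1,0,-1,-2,\dots\}$. Let $\Omega\subset\mathbb{C}$, let $q\in\mathcal{Q}_1\cap\mathcal{H}_1$, and let $\phi\in\Phi_{H,2}[\Omega,q]$. If $f\in\mathcal{A}$ satisfies $$\left\{\phi\left(\frac{B_{\kappa+1}^{c}f(z)}{z},\frac{B_{\kappa}^{c}f(z)}{z},\frac{B_{\kappa-1}^{c}f(z)}{z};z\right):z\in\mathbb{D}\right\}\subset\Omega,$$ then $$\frac{B_{\kappa+1}^{c}f(z)}{z}\prec q(z)\quad(z\in\mathbb{D}).$$
   Context: $\mathbb{D}=\{z\in\mathbb{C}:|z|<1\}$. $\mathcal{A}$ is the class of functions $f(z)=z+\sum_{n\geq1}a_{n+1}z^{n+1}$ analytic in $\mathbb{D}$. For $c\in\mathbb{C}$, $\lambda\in\mathbb{C}\setminus\{0,-1,-2,\dots\}$ and $f\in\mathcal{A}$, put $$B_\lambda^c f(z)=z+\sum_{n\geq1}\frac{(-c)^n a_{n+1}}{4^n(\lambda)_n}\frac{z^{n+1}}{n!},\qquad (\lambda)_n=\lambda(\lambda+1)\cdots(\lambda+n-1).$$ The functions $B_\lambda^cf(z)/z$ are extended to $z=0$ by the value $1$ (removable singularity). For $f,F$ analytic in $\mathbb{D}$, $f\prec F$ means that there is $w$ analytic in $\mathbb{D}$ with $w(0)=0$, $|w(z)|<1$ and $f(z)=F(w(z))$ for all $z\in\mathbb{D}$. $\mathcal{H}_1$ is the class of analytic functions in $\mathbb{D}$ taking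 the value $1$ at $0$. $\mathcal{Q}$ is the class of functions $q$ that are analytic and injective on $\overline{\mathbb{D}}\setminus E(q)$, where $E(q)=\{\zeta\in\partial\mathbb{D}:\lim_{z\to\zeta}q(z)=\infty\}$, and such that $q'(\zeta)\neq0$ for $\zeta\in\partial\mathbb{D}\setminus E(q)$; $\mathcal{Q}_1=\{q\in\mathcal{Q}:q(0)=1\}$. For $\Omega\subset\mathbb{C}$ and $q\in\mathcal{Q}_1\cap\mathcal{H}_1$, the class of admissible functions $\Phi_{H,2}[\Omega,q]$ consists of all functions $\phi:\mathbb{C}^3\times\mathbb{D}\to\mathbb{C}$ such that $\phi(u,v,w;z)\notin\Omega$ whenever $$u=q(\zeta),\qquad v=\frac{k\zeta q'(\zeta)+\kappa q(\zeta)}{\kappa},$$ $$\operatorname{Re}\left(\frac{(\kappa-1)(w-u)}{v-u}+(1-2\kappa)\right)\geq k\operatorname{Re}\left(\frac{\zeta q''(\zeta)}{q'(\zeta)}+1\right),$$ with $z\in\mathbb{D}$, $\zeta\in\partial\mathbb{D}\setminus E(q)$ and real $k\geq1$. *)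

(* Defs.v *)
From Stdlib Require Import Reals Factorial.
From Coquelicot Require Import Coquelicot.

Local Open Scope C_scope.

Definition unit_disk (z : C) : Prop := (Cmod z < 1)%R.
Definition unit_circle (z : C) : Prop := Cmod z = 1%R.
Definition closed_unit_disk (z : C) : Prop := (Cmod z <= 1)%R.

(** [ex_derive] on functions [C -> C] is complex differentiability (the scalars
    are [C_AbsRing]), so this is holomorphy in a neighbourhood of [z].  On the
    open disk it amounts to differentiability at every point. *)
Definition analytic_at (f : C -> C) (z : C) : Prop :=
  locally z (fun y : C => ex_derive f y).

Definition analytic_in_disk (f : C -> C) : Prop :=
  forall z : C, unit_disk z -> ex_derive f z.

(** Componentwise sum; it is the sum of the complex series whenever that series
    converges ([is_series_CSeries]). *)
Definition CSeries (u : nat -> C) : C :=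
  (Series (fun n => Re (u n)), Series (fun n => Im (u n))).

Lemma is_series_CSeries (u : nat -> C) (l : C) :
  is_series u l -> CSeries u = l.
Proof.
  intros H; unfold CSeries; destruct l as [a b].
  assert (Hs : forall n : nat, sum_n u n =
      (sum_n (fun k => Re (u k)) n, sum_n (fun k => Im (u k)) n)).
  { induction n as [|n IH].
    - rewrite !sum_O; destruct (u O); reflexivity.
    - rewrite !sum_Sn, IH; reflexivity. }
  assert (Ha : is_series (fun n => Re (u n)) a).
  { intros P [eps HP].
    destruct (H (fun z => P (fst z))) as [N HN].
    - exists eps; intros y Hy; apply HP; exact (proj1 Hy).
    - exists N; intros n Hn; specialize (HN n Hn); rewrite Hs in HN; exact HN. }
  assert (Hb : is_series (fun n => Im (u n)) b).
  { intros P [eps HP].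
    destruct (H (fun z => P (snd z))) as [N HN].
    - exists eps; intros y Hy; apply HP; exact (proj2 Hy).
    - exists N; intros n Hn; specialize (HN n Hn); rewrite Hs in HN; exact HN. }
  now rewrite (is_series_unique _ _ Ha), (is_series_unique _ _ Hb).
Qed.

(** A function of the class [A] is bundled with its Taylor coefficients, which
    it determines; only [coefA n] with [n >= 2] is used.  The index [m] below is
    [n - 1] in the sum of the [a_(n+1) z^(n+1)] over [n >= 1]. *)
Record classA : Type := mkClassA {
  funA :> C -> C;
  coefA : nat -> C;
  analyticA : analytic_in_disk funA;
  seriesA : forall z : C, unit_disk z ->
    is_series (fun m : nat => coefA (m + 2)%nat * z ^ (m + 2)) (funA z - z)
}.

(** [(lam)_n = lam (lam + 1) ... (lam + n - 1)] *)
Fixpoint pochhammer (lam : C) (n : nat) : C :=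
  match n with
  | O => 1
  | S m => pochhammer lam m * (lam + INR m)
  end.

Definition B_term (c lam : C) (f : classA) (n : nat) (z : C) : C :=
  ((- c) ^ n * coefA f (n + 1)%nat) / (4 ^ n * pochhammer lam n)
  * (z ^ (n + 1) / INR (fact n)).

Definition B_op (c lam : C) (f : classA) (z : C) : C :=
  z + CSeries (fun m : nat => B_term c lam f (m + 1) z).

(** [g z / z] with the removable singularity at [0] filled by the value [1]. *)
Definition over_z (g : C -> C) (z : C) : C :=
  if Ceq_dec z 0 then 1 else g z / z.

Definition subordinate (f F : C -> C) : Prop :=
  exists w : C -> C,
    analytic_in_disk w /\ w 0 = 0 /\
    (forall z : C, unit_disk z -> unit_disk (w z)) /\
    (forall z : C, unit_disk z -> f z = F (w z)).

Definition class_H1 (p : C -> C) : Prop := analytic_in_disk p /\ p 0 = 1.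

(** [E(q)]: boundary points at which [q z] tends to infinity as [z] tends to
    them from within the disk. *)
Definition Eset (q : C -> C) (zeta : C) : Prop :=
  unit_circle zeta /\
  filterlim (fun z : C => Cmod (q z)) (within unit_disk (locally zeta))
    (Rbar_locally p_infty).

(** As usual, analyticity on the non-open set "closed disk minus [E(q)]" means
    analyticity in a neighbourhood of each of its points; the values of [q]
    elsewhere are irrelevant. *)
Definition class_Q (q : C -> C) : Prop :=
  (forall z : C, closed_unit_disk z -> ~ Eset q z -> analytic_at q z) /\
  (forall z1 z2 : C,
     closed_unit_disk z1 -> ~ Eset q z1 ->
     closed_unit_disk z2 -> ~ Eset q z2 ->
     q z1 = q z2 -> z1 = z2) /\
  (forall zeta : C, unit_circle zeta -> ~ Eset q zeta -> C_derive q zeta <> 0).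

Definition class_Q1 (q : C -> C) : Prop := class_Q q /\ q 0 = 1.

(** [phi u v w z] stands for [phi(u,v,w;z)]; only its values for [z] in the
    disk matter. *)
Definition admissible_H2 (kappa : C) (Omega : C -> Prop) (q : C -> C)
    (phi : C -> C -> C -> C -> C) : Prop :=
  forall (u v w z zeta : C) (k : R),
    unit_disk z -> unit_circle zeta -> ~ Eset q zeta -> (1 <= k)%R ->
    u = q zeta ->
    v = (k * zeta * C_derive q zeta + kappa * q zeta) / kappa ->
    (Re ((kappa - 1) * (w - u) / (v - u) + (1 - 2 * kappa)) >=
     k * Re (zeta * C_derive (C_derive q) zeta / C_derive q zeta + 1))%R ->
    ~ Omega (phi u v w z).

(* Main.v *)
Require Import Defs.
From Stdlib Require Import Reals Factorial Lra Lia Classical ClassicalEpsilon.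
From Coquelicot Require Import Coquelicot.

(** Write [p z = B_(kappa+1) f z / z].  The recurrence between consecutive operators gives
    [B_kappa f z / z = p + z p' / kappa], and likewise for [kappa - 1], so that the quotient
    in the admissibility condition becomes [1 + z p'' / p'].  The theorem is thus the
    Miller-Mocanu lemma: if [p] is not subordinate to [q], there are [z0] in the disk,
    [zeta] on the circle outside [E(q)] and [k >= 1] with [p z0 = q zeta],
    [z0 p' z0 = k zeta q' zeta] and [Re (1 + z0 p'' / p') >= k Re (1 + zeta q'' / q')].

    To obtain it, let [z0] be a point of least modulus with [p z0] outside [q (D)].  On
    [|z| < |z0|] the function [w = q^-1 o p] is holomorphic; it tends to a boundary point
    [zeta] as [z] tends to [z0], and extends holomorphically across [z0] because
    [q' zeta <> 0].  Schwarz's lemma [|w z| <= |z / z0|] and Jack's lemma at [z0] give [k] and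
    the inequality for [w''], and differentiating [p = q o w] twice transfers them to [p].

    The function theory rests on Goursat's theorem for boxes, applied in the logarithmic
    coordinate [s + it] of the punctured plane. *)

Local Open Scope R_scope.
Local Open Scope C_scope.

(** * Complex differentiability *)

(** The boundary behaviour of [q] shapes the argument: near the circle [q] is controlled only
    outside [E(q)], and [w] has no limit at [z0] a priori. A cluster value [zeta] of [w] at [z0] is
    kept off [E(q)] by the finiteness of [p z0] and off the open disk by the choice of [z0]; then
    [q zeta = p z0], and injectivity of [q] up to the boundary leaves a single value. Only then can
    the local inverse of [q] at [zeta] continue [w] past [z0].

    The logarithmic coordinate serves twice. With [z = exp (s + it)] a circle is a vertical segment
    and periodicity closes up the annulus, so the Cauchy formula follows from boxes alone. With
    [z = z0 exp s] the operator [z d/dz] becomes [d/ds]: the first two derivatives of [p (z0 exp s)]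
    are [z p'] and [z p' + z^2 p''], and Jack's lemma becomes a statement about a half-plane near
    [0]. Since [k >= 1] and [q' zeta <> 0], also [p' z0 <> 0], which gives the quotients their
    meaning. *)

Definition ccont (f : C -> C) (z : C) : Prop :=
  forall eps : R, 0 < eps -> exists d : R, 0 < d /\
    forall y, Cmod (y - z) < d -> Cmod (f y - f z) < eps.

(** An epsilon-delta form in [Cmod], free of filters; [is_derive_cder] ties it to [is_derive]. The
    bound is not strict so that it holds at [y = z]. *)
Definition cder (f : C -> C) (z l : C) : Prop :=
  forall eps : R, 0 < eps -> exists d : R, 0 < d /\
    forall y, Cmod (y - z) < d -> Cmod (f y - f z - l * (y - z)) <= eps * Cmod (y - z).

Lemma Cmod_sub_sym (x y : C) : Cmod (x - y) = Cmod (y - x).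
Proof. rewrite <- Cmod_opp; f_equal; ring. Qed.

Lemma Cmod_sub_triangle (x y z : C) : Cmod (x - z) <= Cmod (x - y) + Cmod (y - z).
Proof. replace (x - z) with ((x - y) + (y - z)) by ring; apply Cmod_triangle. Qed.

Lemma Cmod_rev_triangle (x y : C) : Cmod x - Cmod y <= Cmod (x - y).
Proof.
  generalize (Cmod_triangle (x - y) y); replace (x - y + y) with x by ring; lra.
Qed.

Lemma Cmod_sub_eq0 (x y : C) : Cmod (x - y) = 0%R -> x = y.
Proof.
  intros H; apply Cmod_eq_0 in H; replace x with (x - y + y) by ring; rewrite H; ring.
Qed.

Lemma Cmod_sub_gt_0 (x y : C) : x <> y -> 0 < Cmod (x - y).
Proof.
  intros H; destruct (Cmod_ge_0 (x - y)) as [|E]; auto.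
  exfalso; apply H, Cmod_sub_eq0; auto.
Qed.

Lemma Cmod_self (z : C) : Cmod (z - z) = 0%R.
Proof. replace (z - z) with (RtoC 0) by ring; apply Cmod_0. Qed.

Lemma Csub_neq0 (x y : C) : x <> y -> x - y <> 0.
Proof. intros H E; apply H; replace x with (x - y + y) by ring; rewrite E; ring. Qed.

Lemma ccont_ext_loc (f g : C -> C) (z : C) (r : R) :
  0 < r -> (forall y, Cmod (y - z) < r -> f y = g y) -> ccont f z -> ccont g z.
Proof.
  intros Hr E H eps He; destruct (H eps He) as [d [Hd Hy]].
  exists (Rmin d r); split; [apply Rmin_pos; auto|].
  intros y Hyd; rewrite <- !E; [apply Hy|rewrite Cmod_self; auto|];
    eapply Rlt_le_trans; try exact Hyd; [apply Rmin_l|apply Rmin_r].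
Qed.

Lemma ccont_const (c z : C) : ccont (fun _ => c) z.
Proof.
  intros eps He; exists 1%R; split; [lra|]; intros; rewrite Cmod_self; auto.
Qed.

Lemma ccont_id (z : C) : ccont (fun y => y) z.
Proof. intros eps He; exists eps; auto. Qed.

Lemma ccont_plus (f g : C -> C) (z : C) :
  ccont f z -> ccont g z -> ccont (fun y => f y + g y) z.
Proof.
  intros Hf Hg eps He.
  destruct (Hf (eps / 2)%R) as [d1 [H1 F1]]; [lra|].
  destruct (Hg (eps / 2)%R) as [d2 [H2 F2]]; [lra|].
  exists (Rmin d1 d2); split; [apply Rmin_pos; auto|].
  intros y Hy.
  assert (Cmod (y - z) < d1) by (eapply Rlt_le_trans; [exact Hy|apply Rmin_l]).
  assert (Cmod (y - z) < d2) by (eapply Rlt_le_trans; [exact Hy|apply Rmin_r]).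
  replace (f y + g y - (f z + g z)) with ((f y - f z) + (g y - g z)) by ring.
  eapply Rle_lt_trans; [apply Cmod_triangle|].
  specialize (F1 y H); specialize (F2 y H0); lra.
Qed.

Lemma ccont_mult (f g : C -> C) (z : C) :
  ccont f z -> ccont g z -> ccont (fun y => f y * g y) z.
Proof.
  intros Hf Hg eps He.
  set (A := (Cmod (f z) + Cmod (g z) + 1)%R).
  assert (HA : 0 < A) by (unfold A; generalize (Cmod_ge_0 (f z)) (Cmod_ge_0 (g z)); lra).
  (* The bound [e <= 1] turns the product of the two increments into a linear term, which is the [1]
     in [A]. *)
  set (e := Rmin 1 (eps / (2 * A))).
  assert (Hq : 0 < eps / (2 * A)) by (apply Rdiv_lt_0_compat; lra).
  assert (He0 : 0 < e) by (apply Rmin_pos; lra).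
  destruct (Hf e He0) as [d1 [H1 F1]].
  destruct (Hg e He0) as [d2 [H2 F2]].
  exists (Rmin d1 d2); split; [apply Rmin_pos; auto|].
  intros y Hy.
  assert (Y1 : Cmod (y - z) < d1) by (eapply Rlt_le_trans; [exact Hy|apply Rmin_l]).
  assert (Y2 : Cmod (y - z) < d2) by (eapply Rlt_le_trans; [exact Hy|apply Rmin_r]).
  specialize (F1 y Y1); specialize (F2 y Y2).
  replace (f y * g y - f z * g z)
    with ((f y - f z) * (g y - g z) + (f y - f z) * g z + f z * (g y - g z)) by ring.
  eapply Rle_lt_trans; [eapply Rle_trans; [apply Cmod_triangle|apply Rplus_le_compat_r, Cmod_triangle]|].
  rewrite !Cmod_mult.
  assert (E1 : e <= 1) by apply Rmin_l.
  assert (E2 : e <= eps / (2 * A)) by apply Rmin_r.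
  assert (E3 : e * A <= eps / 2).
  { apply Rle_trans with (eps / (2 * A) * A)%R; [apply Rmult_le_compat_r; lra|].
    right; field; lra. }
  generalize (Cmod_ge_0 (f y - f z)) (Cmod_ge_0 (g y - g z)) (Cmod_ge_0 (f z)) (Cmod_ge_0 (g z)).
  unfold A in *; intros; nra.
Qed.

Lemma ccont_comp (f g : C -> C) (z : C) :
  ccont g z -> ccont f (g z) -> ccont (fun y => f (g y)) z.
Proof.
  intros Hg Hf eps He; destruct (Hf eps He) as [d [Hd F]].
  destruct (Hg d Hd) as [d' [Hd' G]]; exists d'; split; auto.
Qed.

Lemma ccont_inv (z : C) : z <> 0 -> ccont Cinv z.
Proof.
  intros Hz eps He.
  assert (Hm : 0 < Cmod z) by (apply Cmod_gt_0; auto).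
  set (d := Rmin (Cmod z / 2) (eps * (Cmod z * Cmod z) / 4)).
  exists d; split.
  { apply Rmin_pos; [lra|]. apply Rdiv_lt_0_compat; [|lra]. 
    apply Rmult_lt_0_compat; [lra|]; apply Rmult_lt_0_compat; lra. }
  intros y Hy.
  assert (D1 : d <= Cmod z / 2) by apply Rmin_l.
  assert (D2 : d <= eps * (Cmod z * Cmod z) / 4) by apply Rmin_r.
  assert (Hyz : Cmod z / 2 < Cmod y).
  { generalize (Cmod_rev_triangle z y); rewrite Cmod_sub_sym; lra. }
  assert (Hy0 : y <> 0) by (apply Cmod_gt_0; lra).
  replace (/ y - / z) with ((z - y) / (y * z)) by (field; auto).
  rewrite Cmod_div by (apply Cmult_neq_0; auto).
  rewrite Cmod_mult, Cmod_sub_sym.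
  apply Rmult_lt_reg_r with (Cmod y * Cmod z)%R; [apply Rmult_lt_0_compat; lra|].
  unfold Rdiv; rewrite Rmult_assoc, Rinv_l, Rmult_1_r by (apply Rgt_not_eq, Rmult_lt_0_compat; lra).
  eapply Rlt_le_trans; [exact Hy|]. eapply Rle_trans; [exact D2|].
  assert (eps * (Cmod z * Cmod z) / 4 <= eps * (Cmod z * Cmod z) / 2).
  { assert (0 < eps * (Cmod z * Cmod z)) by (apply Rmult_lt_0_compat; [|apply Rmult_lt_0_compat]; lra). lra. }
  assert (eps * (Cmod z * Cmod z) / 2 = eps * (Cmod z / 2 * Cmod z))%R by field.
  assert (eps * (Cmod z / 2 * Cmod z) <= eps * (Cmod y * Cmod z)).
  { apply Rmult_le_compat_l; [lra|]. apply Rmult_le_compat_r; lra. }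
  lra.
Qed.

Lemma ccont_neq0 (f : C -> C) (z : C) : ccont f z -> f z <> 0 ->
  exists d, 0 < d /\ forall y, Cmod (y - z) < d -> f y <> 0.
Proof.
  intros H Hz; destruct (H (Cmod (f z))) as [d [Hd F]]; [apply Cmod_gt_0; auto|].
  exists d; split; auto; intros y Hy E; specialize (F y Hy).
  rewrite E in F; replace (0 - f z) with (- f z) in F by ring; rewrite Cmod_opp in F; lra.
Qed.

(** Caratheodory's form of differentiability reduces the differentiation rules to
    the algebra of continuous functions. *)
Lemma cder_slope (f : C -> C) (z l : C) :
  cder f z l <->
  exists s : C -> C, s z = l /\ ccont s z /\ forall y, f y = f z + (y - z) * s y.
Proof.
  split.
  - intros H; exists (fun y => if Ceq_dec y z then l else (f y - f z) / (y - z)).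
    split; [destruct (Ceq_dec z z); congruence|]; split.
    + intros eps He; destruct (H (eps / 2)%R) as [d [Hd F]]; [lra|].
      exists d; split; auto; intros y Hy.
      destruct (Ceq_dec z z) as [_|n]; [|congruence].
      destruct (Ceq_dec y z) as [->|n]; [rewrite Cmod_self; auto|].
      specialize (F y Hy); generalize (Cmod_sub_gt_0 _ _ n); intros Hp.
      replace ((f y - f z) / (y - z) - l) with ((f y - f z - l * (y - z)) / (y - z))
        by (field; apply Csub_neq0; auto).
      rewrite Cmod_div by (apply Csub_neq0; auto).
      apply Rle_lt_trans with (eps / 2)%R; [|lra].
      apply Rmult_le_reg_r with (Cmod (y - z)); auto.
      unfold Rdiv at 1; rewrite Rmult_assoc, Rinv_l, Rmult_1_r by lra; auto.
    + intros y; destruct (Ceq_dec y z) as [->|n]; [ring|].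
      field; apply Csub_neq0; auto.
  - intros (s & Hs & Hc & E) eps He; destruct (Hc eps He) as [d [Hd F]].
    exists d; split; auto; intros y Hy.
    rewrite (E y), <- Hs.
    replace (f z + (y - z) * s y - f z - s z * (y - z)) with ((s y - s z) * (y - z)) by ring.
    rewrite Cmod_mult; apply Rmult_le_compat_r; [apply Cmod_ge_0|left; auto].
Qed.

Lemma cder_ccont (f : C -> C) (z l : C) : cder f z l -> ccont f z.
Proof.
  intros H; apply cder_slope in H; destruct H as (s & _ & Hc & E).
  apply (ccont_ext_loc (fun y => f z + (y + - z) * s y) f z 1); [lra| |].
  - intros y _; rewrite (E y); ring.
  - apply ccont_plus; [apply ccont_const|]; apply ccont_mult; auto.
    apply ccont_plus; [apply ccont_id|apply ccont_const].
Qed.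

Lemma cder_ext_loc (f g : C -> C) (z l : C) (r : R) :
  0 < r -> (forall y, Cmod (y - z) < r -> f y = g y) -> cder f z l -> cder g z l.
Proof.
  intros Hr E H eps He; destruct (H eps He) as [d [Hd Hy]].
  exists (Rmin d r); split; [apply Rmin_pos; auto|].
  intros y Hyd; rewrite <- !E; [apply Hy|rewrite Cmod_self; auto|];
    eapply Rlt_le_trans; try exact Hyd; [apply Rmin_l|apply Rmin_r].
Qed.

Lemma cder_ext (f g : C -> C) (z l : C) : (forall y, f y = g y) -> cder f z l -> cder g z l.
Proof. intros E; apply (cder_ext_loc f g z l 1); [lra|auto]. Qed.

Lemma cder_eq (f : C -> C) (z l l' : C) : cder f z l -> l = l' -> cder f z l'.
Proof. intros H <-; exact H. Qed.

Lemma cder_unique (f : C -> C) (z l l' : C) : cder f z l -> cder f z l' -> l = l'.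
Proof.
  intros H H'; apply NNPP; intros n.
  pose proof (Cmod_sub_gt_0 _ _ n) as Hp; set (e := (Cmod (l - l') / 4)%R).
  assert (He : 0 < e) by (unfold e; lra).
  destruct (H e He) as [d [Hd F]]; destruct (H' e He) as [d' [Hd' F']].
  set (h := (Rmin d d' / 2)%R).
  assert (Hm : 0 < Rmin d d') by (apply Rmin_pos; auto).
  assert (Hh : Cmod (z + h - z) = h).
  { replace (z + h - z) with (RtoC h) by ring; rewrite Cmod_R; apply Rabs_pos_eq; unfold h; lra. }
  generalize (Rmin_l d d') (Rmin_r d d'); intros.
  assert (Hh0 : 0 < h) by (unfold h; lra).
  assert (Hhd : h < d /\ h < d') by (unfold h; lra).
  assert (Y := F (z + h)); assert (Y' := F' (z + h)); rewrite Hh in Y, Y'.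
  specialize (Y (proj1 Hhd)); specialize (Y' (proj2 Hhd)).
  assert (T := Cmod_sub_triangle (l * (z + h - z)) (f (z + h) - f z) (l' * (z + h - z))).
  rewrite (Cmod_sub_sym (l * (z + h - z)) (f (z + h) - f z)) in T.
  replace (l * (z + h - z) - l' * (z + h - z)) with ((l - l') * (z + h - z)) in T by ring.
  rewrite Cmod_mult, Hh in T.
  unfold e in *; nra.
Qed.

Lemma cder_const (c z : C) : cder (fun _ => c) z 0.
Proof.
  apply cder_slope; exists (fun _ => RtoC 0); split; [reflexivity|].
  split; [apply ccont_const|]; intros; ring.
Qed.

Lemma cder_id (z : C) : cder (fun y => y) z 1.
Proof.
  apply cder_slope; exists (fun _ => RtoC 1); split; [reflexivity|].
  split; [apply ccont_const|]; intros; ring.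
Qed.

Lemma cder_plus (f g : C -> C) (z l m : C) :
  cder f z l -> cder g z m -> cder (fun y => f y + g y) z (l + m).
Proof.
  rewrite !cder_slope; intros (s & <- & Hs & Es) (t & <- & Ht & Et).
  exists (fun y => s y + t y); split; [reflexivity|]; split; [apply ccont_plus; auto|].
  intros y; rewrite (Es y), (Et y); ring.
Qed.

Lemma cder_mult (f g : C -> C) (z l m : C) :
  cder f z l -> cder g z m -> cder (fun y => f y * g y) z (l * g z + f z * m).
Proof.
  intros Hf Hg; pose proof (cder_ccont _ _ _ Hg) as Cg; revert Hf Hg.
  rewrite !cder_slope; intros (s & <- & Hs & Es) (t & <- & Ht & Et).
  exists (fun y => s y * g y + f z * t y); split; [reflexivity|]; split.
  - apply ccont_plus; apply ccont_mult; auto; apply ccont_const.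
  - intros y; rewrite (Es y), (Et y); ring.
Qed.

Lemma cder_scal (c : C) (f : C -> C) (z l : C) : cder f z l -> cder (fun y => c * f y) z (c * l).
Proof.
  intros H; replace (c * l) with (0 * f z + c * l) by ring.
  apply cder_mult; auto; apply cder_const.
Qed.

Lemma cder_minus (f g : C -> C) (z l m : C) :
  cder f z l -> cder g z m -> cder (fun y => f y - g y) z (l - m).
Proof.
  intros Hf Hg; apply (cder_ext (fun y => f y + (- (1)) * g y)); [intros; ring|].
  replace (l - m) with (l + - (1) * m) by ring.
  apply cder_plus; auto; apply cder_scal; auto.
Qed.

Lemma cder_comp (f g : C -> C) (z l m : C) :
  cder g z m -> cder f (g z) l -> cder (fun y => f (g y)) z (l * m).
Proof.
  intros Hg Hf; pose proof (cder_ccont _ _ _ Hg) as Cg; revert Hf Hg.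
  rewrite !cder_slope; intros (s & <- & Hs & Es) (t & <- & Ht & Et).
  exists (fun y => s (g y) * t y); split; [reflexivity|]; split.
  - apply ccont_mult; auto; apply (ccont_comp s g); auto.
  - intros y; rewrite (Es (g y)), (Et y) at 1; ring.
Qed.

Lemma cder_inv (z : C) : z <> 0 -> cder Cinv z (- / (z * z)).
Proof.
  intros Hz; apply cder_slope.
  (* [cder_slope] asks for the slope identity at every [y], also at [y = 0], where [/ 0] evaluates
     to [0]; the first branch is the slope towards that default value. *)
  exists (fun y => if Ceq_dec y 0 then (0 - / z) / (0 - z) else - / (y * z)).
  destruct (Ceq_dec z 0) as [|n]; [congruence|]; split; [reflexivity|]; split.
  - apply (ccont_ext_loc (fun y => - / z * / y) _ z (Cmod z)); [apply Cmod_gt_0; auto| |].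
    + intros y Hy; destruct (Ceq_dec y 0) as [->|m]; [|field; auto].
      replace (0 - z) with (- z) in Hy by ring; rewrite Cmod_opp in Hy; lra.
    + apply ccont_mult; [apply ccont_const|apply ccont_inv; auto].
  - intros y; destruct (Ceq_dec y 0) as [->|m]; [|field; auto].
    assert (Cinv 0 = 0) as ->.
    { unfold Cinv; simpl; unfold Rdiv; rewrite Rmult_0_l, Ropp_0, Rmult_0_l; reflexivity. }
    field; auto.
Qed.

Lemma cder_div (f g : C -> C) (z l m : C) : cder f z l -> cder g z m -> g z <> 0 ->
  cder (fun y => f y / g y) z ((l * g z - f z * m) / (g z * g z)).
Proof.
  intros Hf Hg Hz; unfold Cdiv at 1.
  replace ((l * g z - f z * m) / (g z * g z)) with (l * / g z + f z * (- / (g z * g z) * m))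
    by (field; auto).
  apply (cder_mult f (fun y => / g y)); auto; apply (cder_comp Cinv g); auto; apply cder_inv; auto.
Qed.

Lemma cder_pow (f : C -> C) (z l : C) (n : nat) : cder f z l ->
  exists l', cder (fun y => f y ^ n) z l'.
Proof.
  intros H; induction n as [|n [l' IH]]; [exists 0; apply (cder_const 1 z)|].
  exists (l * f z ^ n + f z * l'); apply (cder_mult f (fun y => f y ^ n)); auto.
Qed.

(** The balls behind [locally] come from the product structure and are squares; the factor [sqrt 2]
    compares them with the disks of [Cmod]. *)
Lemma locally_Cmod (z : C) (P : C -> Prop) :
  locally z P <-> exists d : R, 0 < d /\ forall y, Cmod (y - z) < d -> P y.
Proof.
  split.
  - intros [eps H]; exists eps; split; [apply cond_pos|]; intros y Hy.
    apply H, C_NormedModule_mixin_compat1; exact Hy.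
  - intros (d & Hd & H).
    assert (Hs : 0 < d / sqrt 2) by (apply Rdiv_lt_0_compat; [auto|apply sqrt_lt_R0; lra]).
    exists (mkposreal _ Hs); intros y Hy; apply H.
    apply C_NormedModule_mixin_compat2 in Hy; simpl in Hy.
    replace (sqrt 2 * (d / sqrt 2))%R with d in Hy; [exact Hy|].
    field; apply Rgt_not_eq, sqrt_lt_R0; lra.
Qed.

Lemma is_derive_cder (f : C -> C) (z l : C) :
  is_derive (K := C_AbsRing) (V := C_NormedModule) f z l <-> cder f z l.
Proof.
  split.
  - intros [_ H] eps He.
    assert (L : is_filter_lim (locally (T := AbsRing_UniformSpace C_AbsRing) z) z)
      by (intros P HP; exact HP).
    specialize (H z L (mkposreal eps He)).
    (* The variable carries the uniform structure of the ring [C_AbsRing]; [locally_C] identifies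
       its neighbourhoods with those of the product. *)
    apply locally_C, locally_Cmod in H; destruct H as (d & Hd & F).
    exists d; split; auto; intros y Hy; specialize (F y Hy).
    unfold minus, plus, opp, scal, mult in F; simpl in F.
    replace (f y - f z - l * (y - z)) with (f y + - f z + - ((y + - z) * l)) by ring.
    exact F.
  - intros H; split; [apply is_linear_scal_l|].
    intros x Hx eps.
    assert (E : z = x).
    { apply (is_filter_lim_locally_unique (V := AbsRing_NormedModule C_AbsRing)).
      exact Hx. }
    subst x.
    destruct (H eps (cond_pos eps)) as (d & Hd & F).
    apply locally_C, locally_Cmod; exists d; split; auto; intros y Hy; specialize (F y Hy).
    unfold minus, plus, opp, scal, mult; simpl.
    replace (f y - f z - l * (y - z)) with (f y + - f z + - ((y + - z) * l)) in F by ring.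
    exact F.
Qed.

Lemma C_derive_cder (f : C -> C) (z l : C) : cder f z l -> C_derive f z = l.
Proof. intros H; apply is_C_derive_unique, is_derive_cder; auto. Qed.

Lemma ex_derive_cder (f : C -> C) (z : C) :
  ex_derive (K := C_AbsRing) (V := C_NormedModule) f z <-> exists l, cder f z l.
Proof.
  split; intros [l H]; exists l; apply is_derive_cder; auto.
Qed.

Lemma cder_C_derive (f : C -> C) (z : C) : (exists l, cder f z l) -> cder f z (C_derive f z).
Proof. intros [l H]; rewrite (C_derive_cder _ _ _ H); auto. Qed.

(** * Bisection and compactness *)

(** By nestedness every left endpoint is at most every right endpoint, so the supremum of the left
    endpoints lies in all the intervals. *)
Lemma nested_dyadic (u : nat -> R) (a : R) :
  0 <= a -> (forall n, u n <= u (S n)) ->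
  (forall n, u (S n) + a / 2 ^ S n <= u n + a / 2 ^ n) ->
  exists x, forall n, u n <= x <= u n + a / 2 ^ n.
Proof.
  intros Ha Hi Hd.
  assert (Hp : forall n, 0 <= a / 2 ^ n).
  { intros n; apply Rdiv_le_0_compat; [auto|apply pow_lt; lra]. }
  assert (Mi : forall n m, (n <= m)%nat -> u n <= u m).
  { intros n m H; induction H; [lra|]. specialize (Hi m); lra. }
  assert (Md : forall n m, (n <= m)%nat -> u m + a / 2 ^ m <= u n + a / 2 ^ n).
  { intros n m H; induction H; [lra|]. specialize (Hd m); lra. }
  assert (Mx : forall n m, u n <= u m + a / 2 ^ m).
  { intros n m; destruct (Nat.le_ge_cases n m) as [H|H].
    - specialize (Mi n m H); specialize (Hp m); lra.
    - specialize (Md m n H); specialize (Hp n); lra. }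
  destruct (completeness (fun r => exists n, r = u n)) as [x [Hx1 Hx2]].
  - exists (u 0%nat + a / 2 ^ 0)%R; intros r [n ->]; apply Mx.
  - exists (u 0%nat), 0%nat; auto.
  - exists x; intros n; split; [apply Hx1; exists n; auto|].
    apply Hx2; intros r [m ->]; apply Mx.
Qed.

Lemma div_pow2_lt (a d : R) : 0 <= a -> 0 < d -> exists N, forall n, (N <= n)%nat -> a / 2 ^ n < d.
Proof.
  intros Ha Hd.
  destruct (pow_lt_1_zero (/ 2) ltac:(rewrite Rabs_pos_eq; lra) (d / (a + 1)))
    as [N HN]; [apply Rdiv_lt_0_compat; lra|].
  exists N; intros n Hn; specialize (HN n Hn).
  rewrite Rabs_pos_eq, pow_inv in HN by (apply pow_le; lra).
  apply Rmult_lt_compat_r with (r := (a + 1)%R) in HN; [|lra].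
  unfold Rdiv in HN; rewrite Rmult_assoc, Rinv_l, Rmult_1_r in HN by lra.
  assert (0 < / 2 ^ n) by (apply Rinv_0_lt_compat, pow_lt; lra).
  unfold Rdiv; nra.
Qed.

Lemma half_pow2 (a : R) (n : nat) : (a / 2 ^ n = a / 2 ^ S n + a / 2 ^ S n)%R.
Proof. simpl; field; apply pow_nonzero; lra. Qed.

(** A failing box has a failing quarter; the failing boxes shrink to a point, against the local
    hypothesis there. A box is encoded by its lower left corner and its level [n], the sides being
    [a / 2 ^ n] and [b / 2 ^ n]. Both the cluster point lemma and Goursat's theorem are
    instances. *)
Lemma bisection_2d (x0 y0 a b : R) (P : R -> R -> nat -> Prop) :
  0 <= a -> 0 <= b ->
  (forall x y n, let h := (a / 2 ^ S n)%R in let k := (b / 2 ^ S n)%R in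
     x0 <= x -> x + a / 2 ^ n <= x0 + a -> y0 <= y -> y + b / 2 ^ n <= y0 + b ->
     P x y (S n) -> P (x + h)%R y (S n) -> P x (y + k)%R (S n) -> P (x + h)%R (y + k)%R (S n) ->
     P x y n) ->
  (forall x y, x0 <= x <= x0 + a -> y0 <= y <= y0 + b ->
     exists d, 0 < d /\ forall u v n,
       x0 <= u -> u + a / 2 ^ n <= x0 + a -> y0 <= v -> v + b / 2 ^ n <= y0 + b ->
       u <= x <= u + a / 2 ^ n -> v <= y <= v + b / 2 ^ n ->
       a / 2 ^ n < d -> b / 2 ^ n < d -> P u v n) ->
  P x0 y0 0%nat.
Proof.
  intros Ha Hb Hstep Hloc; apply NNPP; intros H0.
  set (ok := fun x y n => x0 <= x /\ x + a / 2 ^ n <= x0 + a /\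
                          y0 <= y /\ y + b / 2 ^ n <= y0 + b).
  assert (Hpa : forall n, 0 <= a / 2 ^ n)
    by (intros n; apply Rdiv_le_0_compat; [auto|apply pow_lt; lra]).
  assert (Hpb : forall n, 0 <= b / 2 ^ n)
    by (intros n; apply Rdiv_le_0_compat; [auto|apply pow_lt; lra]).
  (* The conditions stand under the existential, so that choice yields a total function [next]. *)
  assert (Hnext : forall (n : nat) (p : R * R), exists p' : R * R,
    ok (fst p) (snd p) n -> ~ P (fst p) (snd p) n ->
    ~ P (fst p') (snd p') (S n) /\ ok (fst p') (snd p') (S n) /\
    (fst p' = fst p \/ fst p' = fst p + a / 2 ^ S n)%R /\
    (snd p' = snd p \/ snd p' = snd p + b / 2 ^ S n)%R).
  { intros n [x y]; cbn [fst snd].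
    destruct (classic (ok x y n)) as [Hok|]; [|exists (x, y); tauto].
    destruct Hok as (K1 & K2 & K3 & K4).
    specialize (Hstep x y n K1 K2 K3 K4); cbv zeta in Hstep.
    rewrite half_pow2 in K2, K4; specialize (Hpa (S n)); specialize (Hpb (S n)).
    destruct (classic (P x y (S n))) as [P1|P1];
      [|exists (x, y); intros; unfold ok; cbn [fst snd]; repeat split; auto; lra].
    destruct (classic (P (x + a / 2 ^ S n)%R y (S n))) as [P2|P2];
      [|exists ((x + a / 2 ^ S n)%R, y); intros; unfold ok; cbn [fst snd]; repeat split; auto; lra].
    destruct (classic (P x (y + b / 2 ^ S n)%R (S n))) as [P3|P3];
      [|exists (x, (y + b / 2 ^ S n)%R); intros; unfold ok; cbn [fst snd]; repeat split; auto; lra].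
    destruct (classic (P (x + a / 2 ^ S n)%R (y + b / 2 ^ S n)%R (S n))) as [P4|P4];
      [|exists ((x + a / 2 ^ S n)%R, (y + b / 2 ^ S n)%R); intros; unfold ok; cbn [fst snd];
        repeat split; auto; lra].
    exists (x, y); intros; exfalso; auto. }
  set (next := fun n p => proj1_sig (constructive_indefinite_description _ (Hnext n p))).
  assert (Hn : forall n p, ok (fst p) (snd p) n -> ~ P (fst p) (snd p) n ->
    ~ P (fst (next n p)) (snd (next n p)) (S n) /\ ok (fst (next n p)) (snd (next n p)) (S n) /\
    (fst (next n p) = fst p \/ fst (next n p) = fst p + a / 2 ^ S n)%R /\
    (snd (next n p) = snd p \/ snd (next n p) = snd p + b / 2 ^ S n)%R)
    by (intros n p; unfold next; apply proj2_sig).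
  clearbody next.
  set (s := fix s n := match n with O => (x0, y0) | S m => next m (s m) end).
  assert (Hs : forall n, ~ P (fst (s n)) (snd (s n)) n /\ ok (fst (s n)) (snd (s n)) n).
  { induction n as [|n [I1 I2]].
    - simpl; split; auto; unfold ok; simpl; lra.
    - destruct (Hn n (s n) I2 I1) as (Q1 & Q2 & _); simpl s; auto. }
  destruct (nested_dyadic (fun n => fst (s n)) a Ha) as [x Hx].
  { intros n; destruct (Hs n) as [I1 I2]; destruct (Hn n (s n) I2 I1) as (_ & _ & Q & _).
    simpl s; specialize (Hpa (S n)); destruct Q as [->| ->]; lra. }
  { intros n; destruct (Hs n) as [I1 I2]; destruct (Hn n (s n) I2 I1) as (_ & _ & Q & _).
    rewrite (half_pow2 a n); simpl s; specialize (Hpa (S n)); destruct Q as [->| ->]; lra. }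
  destruct (nested_dyadic (fun n => snd (s n)) b Hb) as [y Hy].
  { intros n; destruct (Hs n) as [I1 I2]; destruct (Hn n (s n) I2 I1) as (_ & _ & _ & Q).
    simpl s; specialize (Hpb (S n)); destruct Q as [->| ->]; lra. }
  { intros n; destruct (Hs n) as [I1 I2]; destruct (Hn n (s n) I2 I1) as (_ & _ & _ & Q).
    rewrite (half_pow2 b n); simpl s; specialize (Hpb (S n)); destruct Q as [->| ->]; lra. }
  assert (Hx0 := Hx 0%nat); assert (Hy0 := Hy 0%nat); simpl in Hx0, Hy0.
  destruct (Hloc x y) as (d & Hd & Hl); [lra|lra|].
  destruct (div_pow2_lt a d Ha Hd) as [N1 HN1]; destruct (div_pow2_lt b d Hb Hd) as [N2 HN2].
  set (n := (N1 + N2)%nat); destruct (Hs n) as [I1 (K1 & K2 & K3 & K4)]; apply I1.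
  apply Hl; auto; [apply HN1|apply HN2]; unfold n; lia.
Qed.

(** Without a cluster point, every point has a neighbourhood that the sequence eventually avoids.
    Being eventually avoided passes from the quarters to a box, hence to the square of side [2 M],
    which contains all terms. *)
Lemma bounded_seq_cluster (u : nat -> C) (M : R) : (forall n, Cmod (u n) <= M) ->
  exists z, forall (eps : R) (N : nat), 0 < eps -> exists n, (N <= n)%nat /\ Cmod (u n - z) < eps.
Proof.
  intros HM; apply NNPP; intros H.
  assert (HM0 : 0 <= M) by (eapply Rle_trans; [apply Cmod_ge_0|apply (HM 0%nat)]).
  assert (Hz : forall z, exists eps N, 0 < eps /\ forall n, (N <= n)%nat -> eps <= Cmod (u n - z)).
  { intros z; apply NNPP; intros H1; apply H; exists z; intros eps N He.
    apply NNPP; intros H2; apply H1; exists eps, N; split; auto; intros n Hn.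
    apply Rnot_lt_le; intros H3; apply H2; exists n; auto. }
  set (P := fun (x y : R) (n : nat) => exists N, forall k, (N <= k)%nat ->
     ~ (x <= Re (u k) <= x + 2 * M / 2 ^ n /\ y <= Im (u k) <= y + 2 * M / 2 ^ n)).
  assert (HP : P (- M)%R (- M)%R 0%nat).
  { apply (bisection_2d (- M) (- M) (2 * M) (2 * M)); [lra|lra| |].
    - intros x y n h k _ _ _ _; change k with h; clear k.
      intros [N1 H1] [N2 H2] [N3 H3] [N4 H4].
      exists (N1 + N2 + N3 + N4)%nat; intros j Hj [Q1 Q2].
      rewrite half_pow2 in Q1, Q2; fold h in Q1, Q2.
      specialize (H1 j ltac:(lia)); specialize (H2 j ltac:(lia));
      specialize (H3 j ltac:(lia)); specialize (H4 j ltac:(lia)).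
      fold h in H1, H2, H3, H4; clearbody h.
      destruct (Rle_dec (Re (u j)) (x + h)); destruct (Rle_dec (Im (u j)) (y + h));
        [apply H1|apply H3|apply H2|apply H4]; split; lra.
    - intros x y _ _; destruct (Hz (x, y)) as (eps & N & He & HN).
      exists (eps / 2)%R; split; [lra|].
      intros v w n _ _ _ _ Qx Qy Qn _; exists N; intros k Hk [Q1 Q2].
      specialize (HN k Hk).
      assert (T := Cmod_triangle (Re (u k - (x, y))) (Ci * Im (u k - (x, y)))).
      rewrite Cmod_mult, Cmod_Ci, !Cmod_R in T.
      replace (RtoC (Re (u k - (x, y))) + Ci * Im (u k - (x, y))) with (u k - (x, y)) in T.
      + destruct (u k) as [p q]; simpl in *.
        assert (Rabs (p + - x) < eps / 2) by (apply Rabs_def1; lra).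
        assert (Rabs (q + - y) < eps / 2) by (apply Rabs_def1; lra).
        lra.
      + destruct (u k - (x, y)) as [p q]; unfold Ci, RtoC, Cplus, Cmult; simpl; f_equal; ring. }
  destruct HP as [N HN]; apply (HN N (le_n N)).
  assert (HNM := HM N); assert (Hr := re_le_Cmod (u N)).
  assert (Hi := Rmax_Cmod (u N)); assert (Hi' := Rmax_r (Rabs (fst (u N))) (Rabs (snd (u N)))).
  assert (Rabs (Re (u N)) <= M) by lra; assert (Rabs (Im (u N)) <= M) by (unfold Im; lra).
  apply Rabs_le_between in H0; apply Rabs_le_between in H1; simpl; split; lra.
Qed.

(** * Goursat's theorem *)

Definition CInt (g : R -> C) (a b : R) : C :=
  (RInt (fun t => Re (g t)) a b, RInt (fun t => Im (g t)) a b).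

Definition rcont (g : R -> C) (t : R) : Prop :=
  forall eps : R, 0 < eps -> exists d : R, 0 < d /\
    forall u, Rabs (u - t) < d -> Cmod (g u - g t) < eps.

Lemma rcont_plus (g h : R -> C) (t : R) :
  rcont g t -> rcont h t -> rcont (fun u => g u + h u) t.
Proof.
  intros Hg Hh eps He.
  destruct (Hg (eps / 2)%R) as (a & Ha & Fa); [lra|].
  destruct (Hh (eps / 2)%R) as (b & Hb & Fb); [lra|].
  exists (Rmin a b); split; [apply Rmin_pos; auto|]; intros u Hu.
  specialize (Fa u ltac:(eapply Rlt_le_trans; [exact Hu|apply Rmin_l])).
  specialize (Fb u ltac:(eapply Rlt_le_trans; [exact Hu|apply Rmin_r])).
  replace (g u + h u - (g t + h t)) with ((g u - g t) + (h u - h t)) by ring.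
  eapply Rle_lt_trans; [apply Cmod_triangle|lra].
Qed.

Definition ex_CInt (g : R -> C) (a b : R) : Prop :=
  ex_RInt (fun t => Re (g t)) a b /\ ex_RInt (fun t => Im (g t)) a b.

Lemma Rabs_Im_le_Cmod (z : C) : Rabs (Im z) <= Cmod z.
Proof. eapply Rle_trans; [apply Rmax_r|apply (Rmax_Cmod z)]. Qed.

Lemma Cmod_le_Re_Im (z : C) : Cmod z <= Rabs (Re z) + Rabs (Im z).
Proof.
  assert (T := Cmod_triangle (Re z) (Ci * Im z)); rewrite Cmod_mult, Cmod_Ci, !Cmod_R in T.
  replace (RtoC (Re z) + Ci * Im z) with z in T; [lra|].
  destruct z as [p q]; unfold Ci, RtoC, Cplus, Cmult; simpl; f_equal; ring.
Qed.

Lemma rcont_Re (g : R -> C) (t : R) : rcont g t -> continuous (fun u => Re (g u)) t.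
Proof.
  intros H P [eps HP]; destruct (H eps (cond_pos eps)) as (d & Hd & F).
  exists (mkposreal d Hd); intros u Hu; apply HP.
  unfold ball; simpl; unfold AbsRing_ball, abs, minus, plus, opp; simpl.
  eapply Rle_lt_trans; [|apply (F u Hu)]; apply (re_le_Cmod (g u - g t)).
Qed.

Lemma rcont_Im (g : R -> C) (t : R) : rcont g t -> continuous (fun u => Im (g u)) t.
Proof.
  intros H P [eps HP]; destruct (H eps (cond_pos eps)) as (d & Hd & F).
  exists (mkposreal d Hd); intros u Hu; apply HP.
  unfold ball; simpl; unfold AbsRing_ball, abs, minus, plus, opp; simpl.
  eapply Rle_lt_trans; [|apply (F u Hu)]; apply (Rabs_Im_le_Cmod (g u - g t)).
Qed.

Lemma ex_CInt_rcont (g : R -> C) (a b : R) :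
  a <= b -> (forall t, a <= t <= b -> rcont g t) -> ex_CInt g a b.
Proof.
  intros Hab H; split; apply (ex_RInt_continuous (V := R_CompleteNormedModule)); intros t Ht;
    rewrite Rmin_left, Rmax_right in Ht by auto; [apply rcont_Re|apply rcont_Im]; auto.
Qed.

Lemma CInt_Chasles (g : R -> C) (a b c : R) :
  ex_CInt g a b -> ex_CInt g b c -> CInt g a c = CInt g a b + CInt g b c.
Proof.
  intros [H1 H2] [H3 H4]; unfold CInt, Cplus; simpl.
  f_equal; symmetry; apply (RInt_Chasles (V := R_CompleteNormedModule)); auto.
Qed.

Lemma CInt_ext (g h : R -> C) (a b : R) :
  a <= b -> (forall t, a <= t <= b -> g t = h t) -> CInt g a b = CInt h a b.
Proof.
  intros Hab H; unfold CInt; f_equal; apply RInt_ext; intros t Ht;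
    rewrite Rmin_left, Rmax_right in Ht by auto; rewrite H; auto; lra.
Qed.

Lemma CInt_plus (g h : R -> C) (a b : R) : ex_CInt g a b -> ex_CInt h a b ->
  CInt (fun t => g t + h t) a b = CInt g a b + CInt h a b.
Proof.
  intros [H1 H2] [H3 H4]; unfold CInt, Cplus; simpl.
  f_equal; apply (RInt_plus (V := R_CompleteNormedModule)); auto.
Qed.

Lemma CInt_scal (c : C) (g : R -> C) (a b : R) : ex_CInt g a b ->
  CInt (fun t => c * g t) a b = c * CInt g a b.
Proof.
  intros [H1 H2]; destruct c as [p q]; unfold CInt, Cmult; simpl.
  assert (S : forall k (f : R -> R), ex_RInt f a b -> is_RInt (fun t => (k * f t)%R) a b (k * RInt f a b)%R).
  { intros k f Hf; apply (is_RInt_scal (V := R_NormedModule) f a b k).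
    apply (RInt_correct (V := R_CompleteNormedModule)); auto. }
  f_equal; apply is_RInt_unique.
  - apply (is_RInt_minus (V := R_NormedModule)); apply S; auto.
  - apply (is_RInt_plus (V := R_NormedModule)); apply S; auto.
Qed.

Lemma CInt_const (c : C) (a b : R) : CInt (fun _ => c) a b = (b - a)%R * c.
Proof.
  unfold CInt; rewrite !(RInt_const (V := R_CompleteNormedModule)).
  unfold scal; simpl; unfold mult; simpl.
  destruct c; unfold RtoC, Cmult; simpl; f_equal; ring.
Qed.

(** The factor [2] comes from estimating the two components separately. It does no harm later: the
    bounds are used with an arbitrarily small [M] or, in [max_modulus], with arbitrarily high
    powers. *)
Lemma CInt_bound (g : R -> C) (a b M : R) : a <= b -> ex_CInt g a b ->
  (forall t, a <= t <= b -> Cmod (g t) <= M) -> Cmod (CInt g a b) <= 2 * ((b - a) * M).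
Proof.
  intros Hab [H1 H2] HM.
  assert (B : forall f : R -> R, ex_RInt f a b -> (forall t, a <= t <= b -> Rabs (f t) <= M) ->
    Rabs (RInt f a b) <= (b - a) * M).
  { intros f Hf Hb; apply (norm_RInt_le_const (V := R_NormedModule) f a b); auto.
    apply (RInt_correct (V := R_CompleteNormedModule)); auto. }
  eapply Rle_trans; [apply Cmod_le_Re_Im|]; unfold CInt; simpl.
  assert (B1 := B _ H1 ltac:(intros t Ht; eapply Rle_trans; [apply re_le_Cmod|auto])).
  assert (B2 := B _ H2 ltac:(intros t Ht; eapply Rle_trans; [apply Rabs_Im_le_Cmod|auto])).
  lra.
Qed.

Lemma ccont_rcont (f : C -> C) (g : R -> C) (t : R) :
  rcont g t -> ccont f (g t) -> rcont (fun u => f (g u)) t.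
Proof.
  intros Hg Hf eps He; destruct (Hf eps He) as (d & Hd & F).
  destruct (Hg d Hd) as (d' & Hd' & G); exists d'; auto.
Qed.

Lemma rcont_horizontal (y t : R) : rcont (fun x => (x, y)) t.
Proof.
  intros eps He; exists eps; split; auto; intros u Hu.
  replace ((u, y) - (t, y)) with (RtoC (u - t)); [rewrite Cmod_R; auto|].
  unfold RtoC, Cminus, Cplus, Copp; simpl; f_equal; ring.
Qed.

Lemma rcont_vertical (x t : R) : rcont (fun y => (x, y)) t.
Proof.
  intros eps He; exists eps; split; auto; intros u Hu.
  replace ((x, u) - (x, t)) with (Ci * RtoC (u - t)).
  - rewrite Cmod_mult, Cmod_Ci, Cmod_R; lra.
  - unfold RtoC, Ci, Cmult, Cminus, Cplus, Copp; simpl; f_equal; ring.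
Qed.

Definition in_box (x y a b : R) (z : C) : Prop :=
  x <= Re z <= x + a /\ y <= Im z <= y + b.

(** The contour integral of [G dz] along the boundary, counterclockwise; [Ci] is the factor in
    [dz = i dt] on the vertical sides. *)
Definition box_int (G : C -> C) (x y a b : R) : C :=
  CInt (fun t => G (t, y)) x (x + a) + Ci * CInt (fun t => G ((x + a)%R, t)) y (y + b)
  - CInt (fun t => G (t, (y + b)%R)) x (x + a) - Ci * CInt (fun t => G (x, t)) y (y + b).

(** Subsegments are included because [box_int_split] cuts the sides in half. *)
Lemma ex_CInt_box (G : C -> C) (x y a b : R) : 0 <= a -> 0 <= b ->
  (forall z, in_box x y a b z -> ccont G z) ->
  (forall v, y <= v <= y + b -> forall p q, x <= p <= q -> q <= x + a ->
     ex_CInt (fun t => G (t, v)) p q) /\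
  (forall u, x <= u <= x + a -> forall p q, y <= p <= q -> q <= y + b ->
     ex_CInt (fun t => G (u, t)) p q).
Proof.
  intros Ha Hb H; split; intros v Hv p q Hpq Hq; apply ex_CInt_rcont; try lra; intros t Ht.
  - apply (ccont_rcont G (fun s => (s, v))); [apply rcont_horizontal|].
    apply H; split; simpl; lra.
  - apply (ccont_rcont G (fun s => (v, s))); [apply rcont_vertical|].
    apply H; split; simpl; lra.
Qed.

Ltac box_h H := apply (proj1 H); lra.
Ltac box_v H := apply (proj2 H); lra.

Lemma box_int_plus (F G : C -> C) (x y a b : R) : 0 <= a -> 0 <= b ->
  (forall z, in_box x y a b z -> ccont F z) -> (forall z, in_box x y a b z -> ccont G z) ->
  box_int (fun z => F z + G z) x y a b = box_int F x y a b + box_int G x y a b.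
Proof.
  intros Ha Hb HF HG; apply ex_CInt_box in HF; apply ex_CInt_box in HG; auto.
  unfold box_int.
  assert (E1 := CInt_plus (fun t => F (t, y)) (fun t => G (t, y)) x (x + a)
    ltac:(box_h HF) ltac:(box_h HG)).
  assert (E2 := CInt_plus (fun t => F (t, (y + b)%R)) (fun t => G (t, (y + b)%R)) x (x + a)
    ltac:(box_h HF) ltac:(box_h HG)).
  assert (E3 := CInt_plus (fun t => F (x, t)) (fun t => G (x, t)) y (y + b)
    ltac:(box_v HF) ltac:(box_v HG)).
  assert (E4 := CInt_plus (fun t => F ((x + a)%R, t)) (fun t => G ((x + a)%R, t)) y (y + b)
    ltac:(box_v HF) ltac:(box_v HG)).
  rewrite E1, E2, E3, E4; ring.
Qed.

Lemma box_int_bound (G : C -> C) (x y a b M : R) : 0 <= a -> 0 <= b ->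
  (forall z, in_box x y a b z -> ccont G z) ->
  (forall z, in_box x y a b z -> Cmod (G z) <= M) ->
  Cmod (box_int G x y a b) <= 4 * ((a + b) * M).
Proof.
  intros Ha Hb HG HM; apply ex_CInt_box in HG; auto; unfold box_int.
  assert (B1 := CInt_bound (fun t => G (t, y)) x (x + a) M ltac:(lra) ltac:(box_h HG)
    ltac:(intros; apply HM; split; simpl; lra)).
  assert (B2 := CInt_bound (fun t => G (t, (y + b)%R)) x (x + a) M ltac:(lra) ltac:(box_h HG)
    ltac:(intros; apply HM; split; simpl; lra)).
  assert (B3 := CInt_bound (fun t => G (x, t)) y (y + b) M ltac:(lra) ltac:(box_v HG)
    ltac:(intros; apply HM; split; simpl; lra)).
  assert (B4 := CInt_bound (fun t => G ((x + a)%R, t)) y (y + b) M ltac:(lra) ltac:(box_v HG)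
    ltac:(intros; apply HM; split; simpl; lra)).
  set (I1 := CInt (fun t => G (t, y)) x (x + a)) in *.
  set (I3 := CInt (fun t => G (t, (y + b)%R)) x (x + a)) in *.
  set (I4 := CInt (fun t => G (x, t)) y (y + b)) in *.
  set (I2 := CInt (fun t => G ((x + a)%R, t)) y (y + b)) in *.
  replace (I1 + Ci * I2 - I3 - Ci * I4) with ((I1 + Ci * I2) + ((- I3) + Ci * - I4)) by ring.
  assert (T1 := Cmod_triangle (I1 + Ci * I2) (- I3 + Ci * - I4)).
  assert (T2 := Cmod_triangle I1 (Ci * I2)); assert (T3 := Cmod_triangle (- I3) (Ci * - I4)).
  rewrite Cmod_mult, Cmod_Ci in T2; rewrite Cmod_mult, Cmod_Ci, !Cmod_opp in T3.
  ring_simplify (x + a - x)%R in B1; ring_simplify (x + a - x)%R in B2.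
  ring_simplify (y + b - y)%R in B3; ring_simplify (y + b - y)%R in B4.
  lra.
Qed.

Lemma RInt_id (a b : R) : RInt (fun t => t) a b = ((b * b - a * a) / 2)%R.
Proof.
  apply is_RInt_unique.
  replace ((b * b - a * a) / 2)%R with (minus (b * b / 2) (a * a / 2))%R
    by (unfold minus, plus, opp; simpl; field).
  apply (is_RInt_derive (V := R_CompleteNormedModule) (fun t => t * t / 2)%R (fun t => t)).
  - intros t _; auto_derive; [auto|field].
  - intros t _; apply continuous_id.
Qed.

(** The sides are integrated explicitly and cancel. This is the part of [G] that linearization
    removes in [Goursat]. *)
Lemma box_int_affine (A B : C) (x y a b : R) :
  box_int (fun z => A + B * z) x y a b = 0.
Proof.
  assert (E : forall c d, ex_RInt (fun t : R => t) c d).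
  { intros; apply (ex_RInt_continuous (V := R_CompleteNormedModule)); intros; apply continuous_id. }
  assert (I : forall k m c d, RInt (fun t : R => k + m * t)%R c d
    = (k * (d - c) + m * ((d * d - c * c) / 2))%R).
  { intros k m c d; rewrite <- RInt_id; apply is_RInt_unique.
    apply (is_RInt_plus (V := R_NormedModule) (fun _ => k) (fun t => m * t)%R).
    - replace (k * (d - c))%R with (scal (d - c)%R k) by (unfold scal; simpl; unfold mult; simpl; ring).
      apply (is_RInt_const (V := R_NormedModule)).
    - apply (is_RInt_scal (V := R_NormedModule) (fun t => t)).
      apply (RInt_correct (V := R_CompleteNormedModule)); auto. }
  destruct A as [A1 A2], B as [B1 B2].
  assert (H : forall v c d, CInt (fun t => (A1, A2) + (B1, B2) * (t, v)) c d
    = ((A1 - B2 * v) * (d - c) + B1 * ((d * d - c * c) / 2),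
       (A2 + B1 * v) * (d - c) + B2 * ((d * d - c * c) / 2))%R).
  { intros; unfold CInt; rewrite <- !I; f_equal; apply RInt_ext; intros; simpl; ring. }
  assert (V : forall u c d, CInt (fun t => (A1, A2) + (B1, B2) * (u, t)) c d
    = ((A1 + B1 * u) * (d - c) + - B2 * ((d * d - c * c) / 2),
       (A2 + B2 * u) * (d - c) + B1 * ((d * d - c * c) / 2))%R).
  { intros; unfold CInt; rewrite <- !I; f_equal; apply RInt_ext; intros; simpl; ring. }
  unfold box_int; rewrite !H, !V.
  unfold Ci, RtoC, Cminus, Cplus, Copp, Cmult; simpl; f_equal; field.
Qed.

(** Each inner side is traversed twice, in opposite directions. *)
Lemma box_int_split (G : C -> C) (x y h k : R) : 0 <= h -> 0 <= k ->
  (forall z, in_box x y (h + h) (k + k) z -> ccont G z) ->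
  box_int G x y (h + h) (k + k) =
  box_int G x y h k + box_int G (x + h) y h k
  + box_int G x (y + k) h k + box_int G (x + h) (y + k) h k.
Proof.
  intros Hh Hk H; apply ex_CInt_box in H; try lra.
  unfold box_int.
  replace (x + (h + h))%R with (x + h + h)%R by ring; replace (y + (k + k))%R with (y + k + k)%R by ring.
  rewrite (CInt_Chasles (fun t => G (t, y)) x (x + h) (x + h + h)) by box_h H.
  rewrite (CInt_Chasles (fun t => G (t, (y + k + k)%R)) x (x + h) (x + h + h)) by box_h H.
  rewrite (CInt_Chasles (fun t => G (x, t)) y (y + k) (y + k + k)) by box_v H.
  rewrite (CInt_Chasles (fun t => G ((x + h + h)%R, t)) y (y + k) (y + k + k)) by box_v H.
  ring.
Qed.

(** The bound [eps / 4 ^ n] at level [n] passes from the quarters to the box, since four of them add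
    up. On a small box around a point [G] is affine up to a small multiple of the diameter, and the
    perimeter supplies a second factor of the size of the box. *)
Lemma Goursat (G : C -> C) (x0 y0 a b : R) : 0 <= a -> 0 <= b ->
  (forall z, in_box x0 y0 a b z -> exists l, cder G z l) -> box_int G x0 y0 a b = 0.
Proof.
  intros Ha Hb HG.
  assert (HC : forall z, in_box x0 y0 a b z -> ccont G z).
  { intros z Hz; destruct (HG z Hz) as [l Hl]; apply cder_ccont in Hl; auto. }
  assert (HE : forall eps, 0 < eps -> Cmod (box_int G x0 y0 a b) <= eps).
  { intros eps He.
    assert (Hp : forall n, 0 < 2 ^ n) by (intros; apply pow_lt; lra).
    assert (HP : Cmod (box_int G x0 y0 (a / 2 ^ 0) (b / 2 ^ 0)) <= eps / (2 ^ 0 * 2 ^ 0)).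
    2:{ simpl in HP; unfold Rdiv in HP; rewrite Rmult_1_l, Rinv_1, !Rmult_1_r in HP; exact HP. }
    apply (bisection_2d x0 y0 a b
      (fun x y n => Cmod (box_int G x y (a / 2 ^ n) (b / 2 ^ n)) <= eps / (2 ^ n * 2 ^ n))); auto.
    - intros x y n h k Q1 Q2 Q3 Q4 P1 P2 P3 P4; fold h k in P1, P2, P3, P4.
      assert (Hh : 0 <= h) by (apply Rdiv_le_0_compat; auto).
      assert (Hk : 0 <= k) by (apply Rdiv_le_0_compat; auto).
      rewrite half_pow2 in Q2; rewrite (half_pow2 b) in Q4.
      rewrite (half_pow2 a), (half_pow2 b); fold h in Q2 |- *; fold k in Q4 |- *.
      rewrite box_int_split; auto; [|intros z [Z1 Z2]; apply HC; split; lra].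
      assert (Ee : (eps / (2 ^ n * 2 ^ n) = 4 * (eps / (2 ^ S n * 2 ^ S n)))%R).
      { simpl; field; apply pow_nonzero; lra. }
      rewrite Ee.
      eapply Rle_trans; [apply Cmod_triangle|].
      eapply Rle_trans; [apply Rplus_le_compat_r, Cmod_triangle|].
      eapply Rle_trans; [apply Rplus_le_compat_r, Rplus_le_compat_r, Cmod_triangle|].
      lra.
    - intros x y Hx Hy.
      destruct (HG (x, y)) as [l Hl]; [split; auto|].
      (* Chosen so that [4 (a + b)^2 e <= eps]; the [1] keeps the denominator positive for a
         degenerate box. *)
      set (e := (eps / (4 * ((a + b) * (a + b)) + 1))%R).
      assert (Hab : 0 <= (a + b) * (a + b)) by nra.
      assert (He' : 0 < e) by (apply Rdiv_lt_0_compat; lra).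
      destruct (Hl e He') as (d & Hd & F).
      exists (d / 2)%R; split; [lra|].
      intros u v n U1 U2 V1 V2 U V D1 D2.
      set (h := (a / 2 ^ n)%R) in *; set (k := (b / 2 ^ n)%R) in *.
      assert (Hh : 0 <= h) by (apply Rdiv_le_0_compat; auto).
      assert (Hk : 0 <= k) by (apply Rdiv_le_0_compat; auto).
      set (A := G (x, y) - l * (x, y)).
      (* The remainder of the linearization at [(x, y)]: it has the same box integral as [G], but is
         bounded by [e * (h + k)]. *)
      set (E := fun z => G z + (- A + (- l) * z)).
      assert (CE : forall z, in_box u v h k z -> ccont E z).
      { intros z [Z1 Z2]; apply ccont_plus; [apply HC; split; lra|].
        apply ccont_plus; [apply ccont_const|apply ccont_mult; [apply ccont_const|apply ccont_id]]. }
      assert (EG : box_int G u v h k = box_int E u v h k).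
      { unfold E; rewrite (box_int_plus G (fun z => - A + - l * z)); auto.
        - rewrite box_int_affine; ring.
        - intros z [Z1 Z2]; apply HC; split; lra.
        - intros z _; apply ccont_plus; [apply ccont_const|].
          apply ccont_mult; [apply ccont_const|apply ccont_id]. }
      rewrite EG; eapply Rle_trans; [apply (box_int_bound E u v h k (e * (h + k))); auto|].
      + intros z [Z1 Z2].
        assert (Hzz : Cmod (z - (x, y)) <= h + k).
        { eapply Rle_trans; [apply Cmod_le_Re_Im|]; destruct z as [p q]; simpl in *.
          apply Rplus_le_compat; apply Rabs_le; lra. }
        replace (E z) with (G z - G (x, y) - l * (z - (x, y))) by (unfold E, A; ring).
        eapply Rle_trans; [apply F; lra|]. apply Rmult_le_compat_l; lra.
      + assert (Ehk : (h + k = (a + b) / 2 ^ n)%R) by (unfold h, k; field; apply pow_nonzero; lra).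
        rewrite Ehk.
        replace (4 * ((a + b) / 2 ^ n * (e * ((a + b) / 2 ^ n))))%R
          with ((4 * ((a + b) * (a + b)) * e) / (2 ^ n * 2 ^ n))%R by (field; apply pow_nonzero; lra).
        apply Rmult_le_compat_r; [left; apply Rinv_0_lt_compat, Rmult_lt_0_compat; auto|].
        apply Rle_trans with ((4 * ((a + b) * (a + b)) + 1) * e)%R; [nra|].
        right; unfold e; field; lra. }
  apply Cmod_eq_0; apply Rle_antisym; [|apply Cmod_ge_0].
  apply le_epsilon; intros eps He; rewrite Rplus_0_l; auto.
Qed.

(** * The Cauchy formula on circles *)

Definition cexp (z : C) : C := ((exp (Re z) * cos (Im z))%R, (exp (Re z) * sin (Im z))%R).

Lemma cexp_plus (u v : C) : cexp (u + v) = cexp u * cexp v.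
Proof.
  destruct u as [a b], v as [c d]; unfold cexp, Cplus, Cmult; simpl.
  rewrite exp_plus, cos_plus, sin_plus; f_equal; ring.
Qed.

Lemma cexp_0 : cexp 0 = 1.
Proof. unfold cexp; simpl; rewrite exp_0, cos_0, sin_0, Rmult_1_l, Rmult_0_r; reflexivity. Qed.

Lemma Cmod_cexp (z : C) : Cmod (cexp z) = exp (Re z).
Proof.
  unfold Cmod, cexp; simpl.
  replace ((exp (Re z) * cos (Im z)) * ((exp (Re z) * cos (Im z)) * 1) +
    (exp (Re z) * sin (Im z)) * ((exp (Re z) * sin (Im z)) * 1))%R with (exp (Re z) * exp (Re z))%R.
  - apply sqrt_square; left; apply exp_pos.
  - generalize (sin2_cos2 (Im z)); unfold Rsqr; intros H.
    transitivity (exp (Re z) * exp (Re z) * (sin (Im z) * sin (Im z) + cos (Im z) * cos (Im z)))%R;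
      [rewrite H; ring|ring].
Qed.

Lemma cexp_2PI (x : R) : cexp (x, (2 * PI)%R) = cexp (x, 0%R).
Proof. unfold cexp; simpl; rewrite cos_2PI, sin_2PI, cos_0, sin_0; reflexivity. Qed.

Lemma derivable_at_0_eps (f : R -> R) (l : R) : derivable_pt_lim f 0 l -> forall eps, 0 < eps ->
  exists d, 0 < d /\ forall t, Rabs t < d -> Rabs (f t - f 0%R - l * t) <= eps * Rabs t.
Proof.
  intros H eps He; destruct (H eps He) as [d F]; exists d; split; [apply cond_pos|].
  intros t Ht; destruct (Req_dec t 0) as [->|n].
  - replace (f 0%R - f 0%R - l * 0)%R with 0%R by ring; rewrite Rabs_R0; lra.
  - specialize (F t n Ht); rewrite Rplus_0_l in F.
    replace (f t - f 0%R - l * t)%R with (((f t - f 0%R) / t - l) * t)%R by (field; auto).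
    rewrite Rabs_mult; apply Rmult_le_compat_r; [apply Rabs_pos|lra].
Qed.

Lemma cder_cexp_0 : cder cexp 0 1.
Proof.
  intros eps He.
  (* The real part of the remainder contributes [3 e] and [e], the imaginary part [3 e] and [2 e],
     hence the [9]; [e <= 1] gives [exp s <= 3]. *)
  set (e := Rmin (eps / 9) 1).
  assert (He0 : 0 < e) by (apply Rmin_pos; lra).
  assert (He1 : e <= eps / 9) by apply Rmin_l; assert (He2 : e <= 1) by apply Rmin_r.
  assert (Dc := derivable_pt_lim_cos 0); rewrite sin_0, Ropp_0 in Dc.
  assert (Ds := derivable_pt_lim_sin 0); rewrite cos_0 in Ds.
  assert (De := derivable_pt_lim_exp 0); rewrite exp_0 in De.
  destruct (derivable_at_0_eps _ _ Dc e He0) as (d1 & H1 & F1).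
  destruct (derivable_at_0_eps _ _ Ds e He0) as (d2 & H2 & F2).
  destruct (derivable_at_0_eps _ _ De e He0) as (d3 & H3 & F3).
  rewrite cos_0 in F1; rewrite sin_0 in F2; rewrite exp_0 in F3.
  exists (Rmin (Rmin d1 d2) (Rmin d3 e)); split; [apply Rmin_pos; apply Rmin_pos; auto|].
  intros [s t] Hy; rewrite cexp_0.
  assert (Hs := re_le_Cmod ((s, t) - 0)); assert (Ht := Rabs_Im_le_Cmod ((s, t) - 0)).
  simpl in Hs, Ht; rewrite Ropp_0, Rplus_0_r in Hs, Ht.
  set (m := Cmod ((s, t) - 0)) in *.
  assert (Hm : m < d1 /\ m < d2 /\ m < d3 /\ m < e).
  { repeat split; (eapply Rlt_le_trans; [exact Hy|]).
    - eapply Rle_trans; apply Rmin_l.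
    - eapply Rle_trans; [apply Rmin_l|apply Rmin_r].
    - eapply Rle_trans; [apply Rmin_r|apply Rmin_l].
    - eapply Rle_trans; apply Rmin_r. }
  specialize (F1 t ltac:(lra)); specialize (F2 t ltac:(lra)); specialize (F3 s ltac:(lra)).
  rewrite Rmult_0_l, Rminus_0_r in F1; rewrite Rmult_1_l, Rminus_0_r in F2; rewrite Rmult_1_l in F3.
  assert (Hexp : 0 <= exp s <= 3).
  { split; [left; apply exp_pos|]; eapply Rle_trans; [|apply exp_le_3].
    left; apply exp_increasing; eapply Rle_lt_trans; [apply Rle_abs|lra]. }
  assert (Hexp1 : Rabs (exp s - 1) <= 2 * Rabs s).
  { replace (exp s - 1)%R with ((exp s - 1 - s) + s)%R by ring.
    eapply Rle_trans; [apply Rabs_triang|].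
    assert (e * Rabs s <= Rabs s) by (generalize (Rabs_pos s); nra). lra. }
  eapply Rle_trans; [apply Cmod_le_Re_Im|].
  replace (Re (cexp (s, t) - 1 - 1 * ((s, t) - 0))) with (exp s * (cos t - 1) + (exp s - 1 - s))%R
    by (unfold cexp; simpl; ring).
  replace (Im (cexp (s, t) - 1 - 1 * ((s, t) - 0))) with (exp s * (sin t - t) + (exp s - 1) * t)%R
    by (unfold cexp; simpl; ring).
  assert (A1 := Rabs_triang (exp s * (cos t - 1)) (exp s - 1 - s)).
  assert (A2 := Rabs_triang (exp s * (sin t - t)) ((exp s - 1) * t)).
  rewrite Rabs_mult, (Rabs_pos_eq (exp s)) in A1 by lra.
  rewrite !Rabs_mult, (Rabs_pos_eq (exp s)) in A2 by lra.
  generalize (Rabs_pos s) (Rabs_pos t); intros P1 P2.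
  assert (B1 : exp s * Rabs (cos t - 1) <= 3 * (e * Rabs t)).
  { apply Rmult_le_compat; try lra; apply Rabs_pos. }
  assert (B2 : exp s * Rabs (sin t - t) <= 3 * (e * Rabs t)).
  { apply Rmult_le_compat; try lra; apply Rabs_pos. }
  assert (B3 : Rabs (exp s - 1) * Rabs t <= (2 * e) * Rabs t).
  { apply Rmult_le_compat_r; lra. }
  assert (B4 : e * Rabs t <= e * m) by (apply Rmult_le_compat_l; lra).
  assert (B5 : e * Rabs s <= e * m) by (apply Rmult_le_compat_l; lra).
  assert (B6 : 9 * (e * m) <= eps * m) by nra.
  lra.
Qed.

Lemma cder_cexp (z : C) : cder cexp z (cexp z).
Proof.
  apply (cder_ext (fun y => cexp z * cexp (y - z))).
  - intros y; rewrite <- cexp_plus; f_equal; ring.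
  - apply (cder_eq _ z (cexp z * (1 * (1 - 0)))); [|ring].
    apply cder_scal, (cder_comp cexp (fun y => y - z)).
    + apply cder_minus; [apply cder_id|apply cder_const].
    + replace (z - z) with (RtoC 0) by ring; apply cder_cexp_0.
Qed.

(** * Integrals over circles *)

Lemma Ceq_of_approx (a b : C) : (forall eps, 0 < eps -> Cmod (a - b) <= eps) -> a = b.
Proof.
  intros H; apply Cmod_sub_eq0, Rle_antisym; [|apply Cmod_ge_0].
  apply le_epsilon; intros eps He; rewrite Rplus_0_l; auto.
Qed.

(** With [s = ln rho], the integral of [f (rho e^(it)) dt] over [[0, 2 pi]].  In the
    logarithmic coordinate [s + it] a circle is a segment and an annulus a box. *)
Definition circ (f : C -> C) (s : R) : C := CInt (fun t => f (cexp (s, t))) 0 (2 * PI).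

Lemma two_PI_pos : 0 < 2 * PI.
Proof. generalize PI_RGT_0; lra. Qed.

Lemma Cmod_circle (s t : R) : Cmod (cexp (s, t)) = exp s.
Proof. apply Cmod_cexp. Qed.

Lemma rcont_circle (f : C -> C) (s t : R) :
  ccont f (cexp (s, t)) -> rcont (fun u => f (cexp (s, u))) t.
Proof.
  intros H; apply (ccont_rcont f (fun u => cexp (s, u))); auto.
  apply (ccont_rcont cexp (fun u => (s, u))); [apply rcont_vertical|].
  eapply cder_ccont, cder_cexp.
Qed.

Lemma ex_circ (f : C -> C) (s : R) : (forall z, Cmod z = exp s -> ccont f z) ->
  ex_CInt (fun t => f (cexp (s, t))) 0 (2 * PI).
Proof.
  intros H; apply ex_CInt_rcont; [generalize two_PI_pos; lra|].
  intros t _; apply rcont_circle, H, Cmod_circle.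
Qed.

Lemma circ_ext (f g : C -> C) (s : R) :
  (forall z, Cmod z = exp s -> f z = g z) -> circ f s = circ g s.
Proof.
  intros H; apply CInt_ext; [generalize two_PI_pos; lra|].
  intros t _; apply H, Cmod_circle.
Qed.

Lemma circ_plus (f g : C -> C) (s : R) : (forall z, Cmod z = exp s -> ccont f z) ->
  (forall z, Cmod z = exp s -> ccont g z) -> circ (fun z => f z + g z) s = circ f s + circ g s.
Proof.
  intros Hf Hg; apply (CInt_plus (fun t => f (cexp (s, t))) (fun t => g (cexp (s, t))));
    apply ex_circ; auto.
Qed.

Lemma circ_scal (c : C) (f : C -> C) (s : R) : (forall z, Cmod z = exp s -> ccont f z) ->
  circ (fun z => c * f z) s = c * circ f s.
Proof. intros Hf; apply (CInt_scal c (fun t => f (cexp (s, t)))), ex_circ; auto. Qed.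

Lemma circ_bound (f : C -> C) (s M : R) : (forall z, Cmod z = exp s -> ccont f z) ->
  (forall t, 0 <= t <= 2 * PI -> Cmod (f (cexp (s, t))) <= M) ->
  Cmod (circ f s) <= 2 * (2 * PI * M).
Proof.
  intros Hf HM; replace (2 * PI * M)%R with ((2 * PI - 0) * M)%R by ring.
  apply CInt_bound; [generalize two_PI_pos; lra|apply ex_circ; auto|exact HM].
Qed.

Lemma circ_const (c : C) (s : R) : circ (fun _ => c) s = (2 * PI)%R * c.
Proof. unfold circ; rewrite CInt_const, Rminus_0_r; reflexivity. Qed.

Lemma circ_dist_const (f : C -> C) (c : C) (s e : R) : (forall z, Cmod z = exp s -> ccont f z) ->
  (forall z, Cmod z = exp s -> Cmod (f z - c) <= e) ->
  Cmod (circ f s - (2 * PI)%R * c) <= 2 * (2 * PI * e).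
Proof.
  intros Hf He.
  replace (circ f s - (2 * PI)%R * c) with (circ (fun z => f z + (- c)) s).
  - apply circ_bound; [|intros t _; apply He, Cmod_circle].
    intros z Hz; apply ccont_plus; [auto|apply ccont_const].
  - rewrite circ_plus, circ_const; auto; [ring|intros; apply ccont_const].
Qed.

(** Goursat's theorem for [f (cexp z)] on the box [[s, s'] x [0, 2 pi]]: the horizontal sides cancel
    by periodicity, and the vertical ones are the two circle integrals. *)
Lemma circ_annulus (f : C -> C) (s s' : R) : s <= s' ->
  (forall z, exp s <= Cmod z <= exp s' -> exists l, cder f z l) -> circ f s = circ f s'.
Proof.
  intros Hss H.
  assert (Hexp : forall a b, a <= b -> exp a <= exp b).
  { intros a b [L| ->]; [left; apply exp_increasing; auto|lra]. }
  assert (G := Goursat (fun z => f (cexp z)) s 0 (s' - s) (2 * PI) ltac:(lra)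
    ltac:(generalize two_PI_pos; lra)).
  unfold box_int in G; rewrite Rplus_0_l in G.
  replace (s + (s' - s))%R with s' in G by ring.
  replace (CInt (fun t => f (cexp (t, (2 * PI)%R))) s s')
    with (CInt (fun t => f (cexp (t, 0%R))) s s') in G
    by (apply CInt_ext; auto; intros; rewrite cexp_2PI; auto).
  fold (circ f s) (circ f s') in G.
  assert (E : Ci * (circ f s' - circ f s) = 0).
  { rewrite <- G; [ring|].
    intros z [Hz _]; replace (s + (s' - s))%R with s' in Hz by ring.
    destruct (H (cexp z)) as [l Hl].
    - rewrite Cmod_cexp; split; apply Hexp; lra.
    - exists (l * cexp z); apply (cder_comp f cexp); auto; apply cder_cexp. }
  apply Cmod_sub_eq0; rewrite Cmod_sub_sym.
  apply (f_equal Cmod) in E; rewrite Cmod_mult, Cmod_Ci, Cmod_0 in E; lra.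
Qed.

Lemma continuity_2d_pt_ccont (G : C -> C) (x y : R) : ccont G (x, y) ->
  continuity_2d_pt (fun u v => Re (G (u, v))) x y /\
  continuity_2d_pt (fun u v => Im (G (u, v))) x y.
Proof.
  intros H; split; intros eps; destruct (H eps (cond_pos eps)) as (d & Hd & F);
    (assert (Hd2 : 0 < d / 2) by lra); exists (mkposreal _ Hd2); simpl; intros u v Hu Hv;
    (eapply Rle_lt_trans; [|apply (F (u, v))]).
  - apply (re_le_Cmod (G (u, v) - G (x, y))).
  - eapply Rle_lt_trans; [apply Cmod_le_Re_Im|]; simpl; unfold Rminus in *; lra.
  - apply (Rabs_Im_le_Cmod (G (u, v) - G (x, y))).
  - eapply Rle_lt_trans; [apply Cmod_le_Re_Im|]; simpl; unfold Rminus in *; lra.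
Qed.

Lemma exp_lt_ln (s r : R) : 0 < r -> s < ln r -> exp s < r.
Proof. intros Hr H; rewrite <- (exp_ln r) by auto; apply exp_increasing; auto. Qed.

Lemma ln_gt_exp (s r : R) : exp s < r -> s < ln r.
Proof. intros H; rewrite <- (ln_exp s); apply ln_increasing; auto; apply exp_pos. Qed.

(** Uniform continuity of [f (cexp z)] on a compact box around the segment of abscissa [s0]; its
    half-width [h] is half the room left below [ln r]. *)
Lemma circ_continuous (f : C -> C) (r s0 : R) : exp s0 < r ->
  (forall z, Cmod z < r -> ccont f z) ->
  forall eps, 0 < eps -> exists d, 0 < d /\
    forall s, Rabs (s - s0) < d -> Cmod (circ f s - circ f s0) <= eps.
Proof.
  intros Hs0 Hf eps He.
  assert (Hr : 0 < r) by (generalize (exp_pos s0); lra).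
  set (h := ((ln r - s0) / 2)%R).
  assert (Hs0' := ln_gt_exp _ _ Hs0).
  assert (Hh : 0 < h) by (unfold h; lra).
  assert (HC : forall x y, s0 - h <= x <= s0 + h -> ccont (fun z => f (cexp z)) (x, y)).
  { intros x y Hx; apply (ccont_comp f cexp); [eapply cder_ccont, cder_cexp|].
    apply Hf; rewrite Cmod_cexp; apply exp_lt_ln; auto; unfold h in Hx; simpl in *; lra. }
  set (e := (eps / (8 * PI))%R).
  assert (PIp := PI_RGT_0).
  assert (He0 : 0 < e) by (apply Rdiv_lt_0_compat; lra).
  destruct (uniform_continuity_2d (fun u v => Re (f (cexp (u, v)))) (s0 - h) (s0 + h) 0 (2 * PI)
    ltac:(intros x y Hx Hy; apply (continuity_2d_pt_ccont (fun z => f (cexp z))); auto)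
    (mkposreal e He0)) as [d1 F1].
  destruct (uniform_continuity_2d (fun u v => Im (f (cexp (u, v)))) (s0 - h) (s0 + h) 0 (2 * PI)
    ltac:(intros x y Hx Hy; apply (continuity_2d_pt_ccont (fun z => f (cexp z))); auto)
    (mkposreal e He0)) as [d2 F2].
  simpl in F1, F2.
  exists (Rmin h (Rmin d1 d2)); split; [repeat apply Rmin_pos; auto; apply cond_pos|].
  intros s Hs.
  assert (Hsh : Rabs (s - s0) < h) by (eapply Rlt_le_trans; [exact Hs|apply Rmin_l]).
  assert (Hs1 : Rabs (s - s0) < d1)
    by (eapply Rlt_le_trans; [exact Hs|eapply Rle_trans; [apply Rmin_r|apply Rmin_l]]).
  assert (Hs2 : Rabs (s - s0) < d2)
    by (eapply Rlt_le_trans; [exact Hs|eapply Rle_trans; [apply Rmin_r|apply Rmin_r]]).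
  apply Rabs_def2 in Hsh.
  assert (Ex : forall x, s0 - h <= x <= s0 + h -> ex_CInt (fun t => f (cexp (x, t))) 0 (2 * PI)).
  { intros x Hx; apply ex_circ; intros z Hz; apply Hf; rewrite Hz; apply exp_lt_ln; auto.
    unfold h in Hx; lra. }
  assert (Ed : circ f s - circ f s0
    = CInt (fun t => f (cexp (s, t)) + - (1) * f (cexp (s0, t))) 0 (2 * PI)).
  { rewrite (CInt_plus (fun t => f (cexp (s, t))) (fun t => - (1) * f (cexp (s0, t)))).
    - rewrite (CInt_scal (- (1)) (fun t => f (cexp (s0, t)))) by (apply Ex; lra).
      unfold circ; ring.
    - apply Ex; lra.
    - apply ex_CInt_rcont; [lra|]; intros t _.
      apply (rcont_circle (fun z => - (1) * f z)).
      apply ccont_mult; [apply ccont_const|apply Hf; rewrite Cmod_circle; auto]. }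
  rewrite Ed; eapply Rle_trans; [apply (CInt_bound _ 0 (2 * PI) (2 * e)); [lra| |]|].
  - apply ex_CInt_rcont; [lra|]; intros t _.
    apply (rcont_plus (fun t => f (cexp (s, t))) (fun t => - (1) * f (cexp (s0, t)))).
    + apply rcont_circle, Hf; rewrite Cmod_circle; apply exp_lt_ln; auto; unfold h in *; lra.
    + apply (rcont_circle (fun z => - (1) * f z)).
      apply ccont_mult; [apply ccont_const|apply Hf; rewrite Cmod_circle; auto].
  - intros t Ht; eapply Rle_trans; [apply Cmod_le_Re_Im|].
    specialize (F1 s0 t s t ltac:(lra) ltac:(lra) ltac:(lra) ltac:(lra) Hs1
      ltac:(rewrite Rminus_diag, Rabs_R0; apply cond_pos)).
    specialize (F2 s0 t s t ltac:(lra) ltac:(lra) ltac:(lra) ltac:(lra) Hs2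
      ltac:(rewrite Rminus_diag, Rabs_R0; apply cond_pos)).
    replace (f (cexp (s, t)) + - (1) * f (cexp (s0, t))) with (f (cexp (s, t)) - f (cexp (s0, t))) by ring.
    set (A := f (cexp (s, t))) in *; set (B := f (cexp (s0, t))) in *; clearbody A B.
    simpl; unfold Re, Im, Rminus in *; lra.
  - right; unfold e; field; lra.
Qed.

(** Neither the centre nor the point [z1] needs differentiability: the circle
    integral is constant on either side of [|z1|] and continuous across it. *)
Lemma circ_value (f : C -> C) (r s : R) (z1 : C) : exp s < r ->
  (forall z, Cmod z < r -> ccont f z) ->
  (forall z, Cmod z < r -> z <> 0 -> z <> z1 -> exists l, cder f z l) ->
  circ f s = (2 * PI)%R * f 0.
Proof.
  intros Hs Hf Hd.
  assert (Hr : 0 < r) by (generalize (exp_pos s); lra).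
  assert (PIp := PI_RGT_0).
  (* The logarithm of [|z1|] is needed below. An exceptional point at the centre is excluded anyway,
     so it is replaced by [r], which lies outside the open disk. *)
  assert (Hz1 : exists z2 : C, z2 <> 0 /\ forall z, Cmod z < r -> z <> 0 -> z <> z2 -> exists l, cder f z l).
  { destruct (Ceq_dec z1 0) as [->|n]; [|exists z1; auto].
    exists (RtoC r); split; [intros E; apply RtoC_inj in E; lra|auto]. }
  clear z1 Hd; destruct Hz1 as (z1 & Hz1 & Hd).
  assert (Hm : 0 < Cmod z1) by (apply Cmod_gt_0; auto).
  set (s1 := ln (Cmod z1)).
  assert (Es1 : exp s1 = Cmod z1) by (apply exp_ln; auto).
  assert (Hexp : forall a b, a < b -> exp a < exp b) by (intros; apply exp_increasing; auto).
  assert (Hann : forall a b, a <= b -> exp b < r -> (b < s1 \/ s1 < a) -> circ f a = circ f b).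
  { intros a b Hab Hb Hside; apply circ_annulus; auto; intros z Hz; apply Hd.
    - lra.
    - apply Cmod_gt_0; generalize (exp_pos a); lra.
    - intros ->; destruct Hside as [L|L]; apply Hexp in L; lra. }
  (* The circle is shrunk towards the centre, where the mean value tends to [f 0] by continuity. *)
  assert (Hbelow : forall a, a < s1 -> exp a < r -> circ f a = (2 * PI)%R * f 0).
  { intros a Ha Har; apply Ceq_of_approx; intros eps He.
    destruct (Hf 0 ltac:(rewrite Cmod_0; auto) (eps / (4 * PI))%R) as (d & Hd0 & F);
      [apply Rdiv_lt_0_compat; lra|].
    set (b := Rmin a (ln d - 1)).
    assert (Hb1 : b <= a) by apply Rmin_l.
    assert (Hb2 : exp b < d).
    { apply exp_lt_ln; auto; eapply Rle_lt_trans; [apply Rmin_r|lra]. }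
    rewrite <- (Hann b a) by auto.
    assert (Hbr : exp b < r).
    { destruct Hb1 as [L|E]; [apply Hexp in L; lra|rewrite E; auto]. }
    eapply Rle_trans; [apply (circ_dist_const f (f 0) b (eps / (4 * PI)))|].
    - intros z Hz; apply Hf; lra.
    - intros z Hz; left; apply F; replace (z - 0) with z by ring; lra.
    - right; field; lra. }
  assert (Hat : exp s1 < r -> circ f s1 = (2 * PI)%R * f 0).
  { intros Hs1; apply Ceq_of_approx; intros eps He.
    destruct (circ_continuous f r s1 Hs1 Hf eps He) as (d & Hd0 & F).
    rewrite <- (Hbelow (s1 - d / 2)%R); [|lra|eapply Rlt_trans; [apply Hexp|exact Hs1]; lra].
    rewrite Cmod_sub_sym; apply F.
    replace (s1 - d / 2 - s1)%R with (- (d / 2))%R by ring; rewrite Rabs_Ropp, Rabs_pos_eq; lra. }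
  destruct (Rtotal_order s s1) as [L|[->|L]]; auto.
  assert (Hs1 : exp s1 < r) by (apply Hexp in L; lra).
  rewrite <- Hat by auto; apply Ceq_of_approx; intros eps He.
  destruct (circ_continuous f r s1 Hs1 Hf eps He) as (d & Hd0 & F).
  set (b := Rmin s (s1 + d / 2)).
  assert (Hb : s1 < b) by (apply Rmin_glb_lt; lra).
  rewrite <- (Hann b s); auto; [|apply Rmin_l].
  apply F; rewrite Rabs_pos_eq by lra.
  generalize (Rmin_r s (s1 + d / 2)); fold b; lra.
Qed.

(** As [circ] integrates against [dt = dz / (i z)], the Cauchy kernel [1 / (z - w)] appears as
    [z / (z - w)]. *)
Lemma ccont_kernel (w z : C) : z <> w -> ccont (fun y => y / (y - w)) z.
Proof.
  intros H; apply ccont_mult; [apply ccont_id|].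
  apply (ccont_comp Cinv (fun y => y - w)).
  - apply ccont_plus; [apply ccont_id|apply ccont_const].
  - apply ccont_inv, Csub_neq0; auto.
Qed.

Lemma cder_kernel (w z : C) : z <> w -> exists l, cder (fun y => y / (y - w)) z l.
Proof.
  intros H; eexists; apply (cder_div (fun y => y) (fun y => y - w)); [apply cder_id| |].
  - apply cder_minus; [apply cder_id|apply cder_const].
  - apply Csub_neq0; auto.
Qed.

Lemma Cmod_kernel (w z : C) (s : R) : Cmod w < exp s -> Cmod z = exp s ->
  z <> w /\ Cmod (z / (z - w)) <= exp s / (exp s - Cmod w).
Proof.
  intros Hw Hz.
  assert (Hn : z <> w) by (intros ->; lra).
  split; auto; rewrite Cmod_div, Hz by (apply Csub_neq0; auto).
  apply Rmult_le_compat_l; [left; apply exp_pos|].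
  apply Rinv_le_contravar; [lra|]; generalize (Cmod_rev_triangle z w); lra.
Qed.

(** The circle can be enlarged at will, and the kernel tends to [1] at infinity. *)
Lemma circ_kernel (w : C) (s : R) : Cmod w < exp s ->
  circ (fun z => z / (z - w)) s = RtoC (2 * PI).
Proof.
  intros Hw; assert (PIp := PI_RGT_0).
  apply Ceq_of_approx; intros eps He.
  (* On a circle of radius at least [K + |w| + 1], [|w / (z - w)|] is at most [|w| / K], hence at
     most [eps / (4 PI)]. *)
  set (K := (4 * PI * (Cmod w + 1) / eps)%R).
  assert (Hw0 := Cmod_ge_0 w).
  assert (HK : 0 < K) by (apply Rdiv_lt_0_compat; [apply Rmult_lt_0_compat|]; lra).
  set (s' := Rmax s (ln (K + Cmod w + 1))).
  assert (Hs' : s <= s') by apply Rmax_l.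
  assert (HsK : K + Cmod w + 1 <= exp s').
  { rewrite <- (exp_ln (K + Cmod w + 1)) at 1 by lra.
    destruct (Rmax_r s (ln (K + Cmod w + 1))) as [L|E];
      [left; apply exp_increasing; exact L|right; unfold s'; f_equal; exact E]. }
  rewrite (circ_annulus _ s s' Hs').
  2:{ intros z Hz; apply cder_kernel; intros ->; lra. }
  replace (RtoC (2 * PI)) with ((2 * PI)%R * RtoC 1) by ring.
  eapply Rle_trans; [apply (circ_dist_const _ 1 s' (eps / (4 * PI)))|right; field; lra].
  - intros z Hz; apply ccont_kernel; intros ->; lra.
  - intros z Hz; assert (Hn : z <> w) by (intros ->; lra).
    replace (z / (z - w) - 1) with (w / (z - w)) by (field; apply Csub_neq0; auto).
    rewrite Cmod_div by (apply Csub_neq0; auto).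
    assert (Hzw := Cmod_rev_triangle z w).
    apply Rle_div_l; [lra|].
    apply Rle_trans with (eps / (4 * PI) * K)%R.
    + apply Rle_trans with (Cmod w + 1)%R; [lra|right; unfold K; field; lra].
    + apply Rmult_le_compat_l; [left; apply Rdiv_lt_0_compat|]; lra.
Qed.

(** [F = z (f z - f w) / (z - w)] is continuous, differentiable off [0] and [w], and vanishes at
    [0], so [circ_value] makes its circle integral zero; [circ_kernel] evaluates the term with
    [f w]. *)
Lemma Cauchy_formula (f : C -> C) (r s : R) (w : C) : Cmod w < exp s -> exp s < r ->
  (forall z, Cmod z < r -> ccont f z) ->
  (forall z, Cmod z < r -> z <> 0 -> exists l, cder f z l) ->
  circ (fun z => f z * (z / (z - w))) s = (2 * PI)%R * f w.
Proof.
  intros Hw Hs Hf Hd.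
  set (F := fun z => if Ceq_dec z w then w * C_derive f w else (f z - f w) * (z / (z - w))).
  assert (FE : forall z, z <> w -> F z = (f z - f w) * (z / (z - w))).
  { intros z Hz; unfold F; destruct (Ceq_dec z w); [contradiction|reflexivity]. }
  assert (Fd : forall z, Cmod z < r -> z <> 0 -> z <> w -> exists l, cder F z l).
  { intros z Hz H0 Hzw; destruct (Hd z Hz H0) as [l Hl]; destruct (cder_kernel w z Hzw) as [m Hm].
    eexists; apply (cder_ext_loc (fun y => (f y - f w) * (y / (y - w))) F z _ (Cmod (z - w))).
    - apply Cmod_sub_gt_0; auto.
    - intros y Hy; symmetry; apply FE; intros ->; rewrite Cmod_sub_sym in Hy; lra.
    - apply (cder_mult (fun y => f y - f w) (fun y => y / (y - w))); [|exact Hm].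
      apply (cder_minus f (fun _ => f w)); [exact Hl|apply cder_const]. }
  assert (Fc : forall z, Cmod z < r -> ccont F z).
  { intros z Hz; destruct (Ceq_dec z w) as [->|Hzw].
    (* For [w = 0] no derivative of [f] is given at [w], but then [F y = f y - f 0] and continuity
       is enough. *)
    - destruct (Ceq_dec w 0) as [->|Hw0].
      + apply (ccont_ext_loc (fun y => f y + (- f 0)) F 0 1); [lra| |].
        * intros y _; unfold F; destruct (Ceq_dec y 0) as [->|n]; [ring|field].
          replace (y - 0) with y by ring; auto.
        * apply ccont_plus; [auto|apply ccont_const].
      + assert (Dw := cder_C_derive f w (Hd w Hz Hw0)).
        apply cder_slope in Dw; destruct Dw as (t & Et & Ct & Ft).
        apply (ccont_ext_loc (fun y => y * t y) F w 1); [lra| |].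
        * intros y _; unfold F; destruct (Ceq_dec y w) as [->|n]; [rewrite Et; reflexivity|].
          rewrite (Ft y); field; apply Csub_neq0; auto.
        * apply ccont_mult; [apply ccont_id|auto].
    - apply (ccont_ext_loc (fun y => (f y + (- f w)) * (y / (y - w))) F z (Cmod (z - w))).
      + apply Cmod_sub_gt_0; auto.
      + intros y Hy; symmetry; apply FE; intros ->; rewrite Cmod_sub_sym in Hy; lra.
      + apply (ccont_mult (fun y => f y + (- f w)) (fun y => y / (y - w)));
          [apply ccont_plus; [auto|apply ccont_const]|apply ccont_kernel; auto]. }
  assert (V := circ_value F r s w Hs Fc Fd).
  assert (F0 : F 0 = 0).
  { unfold F; destruct (Ceq_dec 0 w) as [<-|n]; [ring|].
    field; replace (0 - w) with (- w) by ring; intros E; apply n.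
    replace w with (- - w) by ring; rewrite E; ring. }
  rewrite F0, Cmult_0_r in V.
  assert (Hzw : forall z, Cmod z = exp s -> z <> w) by (intros z Hz ->; lra).
  rewrite (circ_ext F (fun z => f z * (z / (z - w)) + (- f w) * (z / (z - w)))) in V
    by (intros z Hz; rewrite FE by auto; ring).
  rewrite circ_plus in V.
  - rewrite (circ_scal (- f w) (fun z => z / (z - w))), circ_kernel in V; auto;
      [|intros; apply ccont_kernel; auto].
    replace ((2 * PI)%R * f w) with (- (- f w * (2 * PI)%R)) by ring.
    apply Cmod_sub_eq0; rewrite <- Cmod_0, <- V; f_equal; ring.
  - intros z Hz; apply (ccont_mult f (fun z => z / (z - w))); [apply Hf; lra|apply ccont_kernel; auto].
  - intros z Hz; apply (ccont_mult (fun _ => - f w) (fun z => z / (z - w)));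
      [apply ccont_const|apply ccont_kernel; auto].
Qed.

(** * Maximum modulus and power series *)

Lemma ccont_pow (f : C -> C) (z : C) (n : nat) : ccont f z -> ccont (fun y => f y ^ n) z.
Proof.
  intros H; induction n as [|n IH]; [apply (ccont_const 1)|].
  apply (ccont_mult f (fun y => f y ^ n)); auto.
Qed.

(** The Cauchy formula applied to [f ^ N] gives [|f w| ^ N <= 2 K M ^ N] for all [N]. *)
Lemma max_modulus (f : C -> C) (r s M : R) (w : C) : Cmod w < exp s -> exp s < r ->
  (forall z, Cmod z < r -> ccont f z) ->
  (forall z, Cmod z < r -> z <> 0 -> exists l, cder f z l) ->
  (forall t, 0 <= t <= 2 * PI -> Cmod (f (cexp (s, t))) <= M) -> Cmod (f w) <= M.
Proof.
  intros Hw Hs Hf Hd HM.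
  assert (PIp := PI_RGT_0).
  assert (HM0 : 0 <= M) by (eapply Rle_trans; [apply Cmod_ge_0|apply (HM 0%R); lra]).
  set (K := (exp s / (exp s - Cmod w))%R).
  assert (HK : 0 < K) by (apply Rdiv_lt_0_compat; [apply exp_pos|lra]).
  assert (HN : forall N, Cmod (f w) ^ N <= 2 * K * M ^ N).
  { intros N.
    assert (F := Cauchy_formula (fun z => f z ^ N) r s w Hw Hs
      ltac:(intros; apply ccont_pow; auto)
      ltac:(intros z Hz H0; destruct (Hd z Hz H0) as [l Hl]; eapply cder_pow; eauto)).
    apply (f_equal Cmod) in F; rewrite Cmod_mult, Cmod_pow, Cmod_R, Rabs_pos_eq in F by lra.
    assert (B : Cmod (circ (fun z => f z ^ N * (z / (z - w))) s) <= 2 * (2 * PI * (M ^ N * K))).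
    { apply circ_bound.
      - intros z Hz; destruct (Cmod_kernel w z s Hw Hz) as [Hn _].
        apply (ccont_mult (fun z => f z ^ N)); [apply ccont_pow, Hf; lra|apply ccont_kernel; auto].
      - intros t Ht; destruct (Cmod_kernel w _ s Hw (Cmod_circle s t)) as [_ Hk].
        rewrite Cmod_mult, Cmod_pow; apply Rmult_le_compat; auto; try apply Cmod_ge_0.
        + apply pow_le, Cmod_ge_0.
        + apply pow_incr; split; [apply Cmod_ge_0|auto]. }
    rewrite F in B; apply Rmult_le_reg_l with (2 * PI)%R; lra. }
  (* If [M < |f w|], then [(M / |f w|) ^ N] falls below [/ (2 K)] for large [N], against [HN]. *)
  apply Rnot_lt_le; intros Hlt.
  set (x := (M / Cmod (f w))%R).
  assert (Hx : 0 <= x < 1).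
  { split; [apply Rdiv_le_0_compat; lra|].
    apply Rmult_lt_reg_r with (Cmod (f w)); [lra|]. unfold x, Rdiv.
    rewrite Rmult_assoc, Rinv_l by lra; lra. }
  destruct (pow_lt_1_zero x ltac:(rewrite Rabs_pos_eq; lra) (/ (2 * K))) as [N HN1];
    [apply Rinv_0_lt_compat; lra|].
  specialize (HN1 N (le_n N)); rewrite Rabs_pos_eq in HN1 by (apply pow_le; lra).
  assert (Hp : 0 < Cmod (f w) ^ N) by (apply pow_lt; lra).
  assert (E : (M ^ N = x ^ N * Cmod (f w) ^ N)%R).
  { rewrite <- Rpow_mult_distr; f_equal; unfold x; field; lra. }
  specialize (HN N); rewrite E in HN.
  assert (2 * K * x ^ N < 1).
  { apply Rmult_lt_reg_l with (/ (2 * K))%R; [apply Rinv_0_lt_compat; lra|].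
    rewrite <- Rmult_assoc, Rinv_l, Rmult_1_l, Rmult_1_r by lra; auto. }
  nra.
Qed.

(** * Complex series and termwise differentiation *)

Notation Cis_series := (@is_series C_AbsRing C_NormedModule).

Lemma Cis_series_eps (u : nat -> C) (l : C) : Cis_series u l <->
  forall eps, 0 < eps -> exists N, forall n, (N <= n)%nat -> Cmod (sum_n u n - l) < eps.
Proof.
  split.
  - intros H eps He; apply (H (fun y => Cmod (y - l) < eps)).
    apply locally_Cmod; exists eps; auto.
  - intros H P HP; apply locally_Cmod in HP; destruct HP as (d & Hd & F).
    destruct (H d Hd) as [N HN]; exists N; auto.
Qed.

Lemma Cis_series_unique (u : nat -> C) (l m : C) : Cis_series u l -> Cis_series u m -> l = m.
Proof. apply (filterlim_locally_unique (V := C_NormedModule)). Qed.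

Lemma Cis_series_bound (u : nat -> C) (l : C) (B : R) :
  Cis_series u l -> (forall n, Cmod (sum_n u n) <= B) -> Cmod l <= B.
Proof.
  intros H HB; apply le_epsilon; intros eps He.
  apply Cis_series_eps with (eps := eps) in H; auto; destruct H as [N HN].
  specialize (HN N (le_n N)); specialize (HB N).
  rewrite Cmod_sub_sym in HN; generalize (Cmod_rev_triangle l (sum_n u N)); lra.
Qed.

Lemma Cmod_sum_n_le (u : nat -> C) (v : nat -> R) (n : nat) :
  (forall n, Cmod (u n) <= v n) -> Cmod (sum_n u n) <= sum_n v n.
Proof.
  intros H; induction n as [|n IH]; [rewrite !sum_O; auto|].
  rewrite !sum_Sn; eapply Rle_trans; [apply (Cmod_triangle (sum_n u n) (u (S n)))|].
  apply Rplus_le_compat; auto.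
Qed.

Lemma sum_n_geom_le (K x : R) (n : nat) : 0 <= K -> 0 <= x < 1 ->
  sum_n (fun k => K * x ^ k)%R n <= K / (1 - x).
Proof.
  intros HK Hx.
  assert (H : (sum_n (fun k => K * x ^ k)%R n = K * (1 - x ^ S n) / (1 - x))%R).
  { induction n as [|n IH]; [rewrite sum_O; simpl; field; lra|].
    rewrite sum_Sn, IH; unfold plus; simpl; field; lra. }
  rewrite H; apply Rmult_le_compat_r; [left; apply Rinv_0_lt_compat; lra|].
  assert (0 <= x ^ S n) by (apply pow_le; lra); nra.
Qed.

Lemma Cis_series_geom_bound (u : nat -> C) (l : C) (K x : R) : 0 <= K -> 0 <= x < 1 ->
  Cis_series u l -> (forall n, Cmod (u n) <= K * x ^ n) -> Cmod l <= K / (1 - x).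
Proof.
  intros HK Hx H Hu; apply (Cis_series_bound u); auto; intros n.
  eapply Rle_trans; [apply Cmod_sum_n_le; exact Hu|apply sum_n_geom_le; auto].
Qed.

Lemma ex_Cis_series_geom (u : nat -> C) (K x : R) : 0 <= x < 1 ->
  (forall n, Cmod (u n) <= K * x ^ n) -> exists l : C, Cis_series u l.
Proof.
  intros Hx Hu.
  apply (ex_series_le (V := C_CompleteNormedModule) u (fun n => K * x ^ n)%R Hu).
  apply (ex_series_scal_l (V := R_NormedModule) K (fun n => x ^ n)%R).
  apply ex_series_geom; rewrite Rabs_pos_eq; lra.
Qed.

Lemma eventually_bounded (u : nat -> R) (N : nat) (B : R) :
  (forall n, (N <= n)%nat -> u n <= B) -> exists M, forall n, u n <= M.
Proof.
  intros H.
  assert (F : forall m, exists M, forall n, (n < m)%nat -> u n <= M).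
  { induction m as [|m [M HM]]; [exists 0%R; intros; lia|].
    exists (Rmax M (u m)); intros n Hn.
    destruct (Nat.eq_dec n m) as [->|]; [apply Rmax_r|].
    eapply Rle_trans; [apply HM; lia|apply Rmax_l]. }
  destruct (F N) as [M HM]; exists (Rmax M B); intros n.
  destruct (Nat.le_gt_cases N n).
  - eapply Rle_trans; [apply H; auto|apply Rmax_r].
  - eapply Rle_trans; [apply HM; auto|apply Rmax_l].
Qed.

Lemma Cis_series_bounded (u : nat -> C) (l : C) :
  Cis_series u l -> exists M, forall n, Cmod (u n) <= M.
Proof.
  intros H; apply Cis_series_eps with (eps := 1%R) in H; [|lra]; destruct H as [N HN].
  apply (eventually_bounded _ (S N) 2); intros [|n] Hn; [lia|].
  assert (A := HN (S n) ltac:(lia)); assert (B := HN n ltac:(lia)).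
  rewrite sum_Sn in A; change plus with Cplus in A.
  rewrite Cmod_sub_sym in B.
  assert (T := Cmod_triangle (sum_n u n + u (S n) - l) (l - sum_n u n)).
  replace (sum_n u n + u (S n) - l + (l - sum_n u n)) with (u (S n)) in T by ring; lra.
Qed.

Definition ps (a : nat -> C) (f : C -> C) (r : R) : Prop :=
  forall z, Cmod z < r -> Cis_series (fun n => a n * z ^ n) (f z).

Lemma ps_bounded (a : nat -> C) (f : C -> C) (r x : R) : ps a f r -> 0 <= x < r ->
  exists M, forall n, Cmod (a n) * x ^ n <= M.
Proof.
  intros H Hx.
  assert (Hm : Cmod x = x) by (rewrite Cmod_R, Rabs_pos_eq; lra).
  destruct (Cis_series_bounded _ _ (H x ltac:(rewrite Hm; lra))) as [M HM].
  exists M; intros n; specialize (HM n); rewrite Cmod_mult, Cmod_pow, Hm in HM; exact HM.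
Qed.

(** Let [t] be the fourth root of [(x + 1) / 2], so that [x ^ n] is at most the fourth power of
    [t ^ n]. Bernoulli's inequality ([poly]) lets one [t ^ n] absorb each factor [n + 1], and a
    geometric factor of ratio [t * t] remains. *)
Lemma poly_geom_dom (x : R) : 0 <= x < 1 ->
  exists K y, 0 <= K /\ 0 <= y < 1 /\ forall n, (INR n + 1) * (INR n + 1) * x ^ n <= K * y ^ n.
Proof.
  intros Hx; set (t := sqrt (sqrt ((x + 1) / 2))).
  set (q := ((x + 1) / 2)%R); assert (Hq : 0 < q < 1) by (unfold q; lra).
  assert (Hs : 0 < sqrt q < 1).
  { split; [apply sqrt_lt_R0; lra|]; rewrite <- sqrt_1; apply sqrt_lt_1; lra. }
  assert (Ht : 0 < t < 1).
  { split; [apply sqrt_lt_R0; exact (proj1 Hs)|]; rewrite <- sqrt_1; apply sqrt_lt_1; fold q; lra. }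
  assert (Et : (t * t = sqrt q)%R) by (apply sqrt_sqrt; fold q; lra).
  assert (Eq : (sqrt q * sqrt q = q)%R) by (apply sqrt_sqrt; lra).
  set (d := (/ t - 1)%R).
  assert (Hd : 0 < d).
  { unfold d; apply Rlt_0_minus; rewrite <- Rinv_1; apply Rinv_lt_contravar; lra. }
  assert (Hn : forall n, (INR n + 1) * t ^ n <= / d + 1).
  { intros n; assert (P := poly n d Hd); replace (1 + d)%R with (/ t)%R in P by (unfold d; ring).
    rewrite pow_inv in P.
    assert (Hp : 0 < t ^ n) by (apply pow_lt; lra).
    assert (Hp1 : t ^ n <= 1) by (rewrite <- (pow1 n); apply pow_incr; lra).
    apply Rmult_le_compat_r with (r := (t ^ n)%R) in P; [|lra].
    rewrite Rinv_l in P by lra.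
    assert (INR n * t ^ n <= / d).
    { apply Rmult_le_reg_l with d; auto; rewrite Rinv_r by lra; nra. }
    lra. }
  exists ((/ d + 1) * (/ d + 1))%R, (t * t)%R.
  assert (Hid : 0 < / d) by (apply Rinv_0_lt_compat; auto).
  split; [nra|]; split; [nra|]; intros n.
  assert (Hn' := Hn n); assert (Hp : 0 < t ^ n) by (apply pow_lt; lra).
  assert (Hnn : 0 <= INR n) by apply pos_INR.
  apply Rle_trans with ((INR n + 1) * (INR n + 1) * (t ^ n * t ^ n * (t ^ n * t ^ n)))%R.
  - apply Rmult_le_compat_l; [nra|].
    rewrite <- !Rpow_mult_distr; apply pow_incr; split; [lra|]. rewrite Et, Eq; unfold q; lra.
  - replace ((INR n + 1) * (INR n + 1) * (t ^ n * t ^ n * (t ^ n * t ^ n)))%R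
      with (((INR n + 1) * t ^ n) * ((INR n + 1) * t ^ n) * (t ^ n * t ^ n))%R by ring.
    rewrite Rpow_mult_distr; apply Rmult_le_compat_r; [nra|].
    apply Rmult_le_compat; nra.
Qed.

(** The terms are bounded at a radius [x1] between [x] and [r], and the powers of [x / x1] beat the
    polynomial. The square of [n + 1] is the growth met in [mono_taylor]. *)
Lemma ps_geom_dom (a : nat -> C) (f : C -> C) (r x : R) : ps a f r -> 0 <= x < r ->
  exists K y, 0 <= K /\ 0 <= y < 1 /\
    forall n, Cmod (a n) * ((INR n + 1) * (INR n + 1) * x ^ n) <= K * y ^ n.
Proof.
  intros H Hx; set (x1 := ((x + r) / 2)%R).
  destruct (ps_bounded a f r x1 H) as [M HM]; [unfold x1; lra|].
  assert (Hx1 : 0 < x1) by (unfold x1; lra).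
  destruct (poly_geom_dom (x / x1)) as (K & y & HK & Hy & D).
  { split; [apply Rdiv_le_0_compat; lra|]. 
    apply Rmult_lt_reg_r with x1; auto; unfold Rdiv; rewrite Rmult_assoc, Rinv_l; unfold x1 in *; lra. }
  assert (HM0 : 0 <= M).
  { eapply Rle_trans; [|apply (HM 0%nat)]; simpl; rewrite Rmult_1_r; apply Cmod_ge_0. }
  exists (M * K)%R, y; split; [apply Rmult_le_pos; auto|]; split; auto; intros n.
  replace (x ^ n)%R with (x1 ^ n * (x / x1) ^ n)%R
    by (rewrite <- Rpow_mult_distr; f_equal; field; lra).
  replace (Cmod (a n) * ((INR n + 1) * (INR n + 1) * (x1 ^ n * (x / x1) ^ n)))%R
    with ((Cmod (a n) * x1 ^ n) * ((INR n + 1) * (INR n + 1) * (x / x1) ^ n))%R by ring.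
  rewrite (Rmult_assoc M); apply Rmult_le_compat; auto.
  - apply Rmult_le_pos; [apply Cmod_ge_0|apply pow_le; lra].
  - assert (0 <= INR n) by apply pos_INR.
    apply Rmult_le_pos; [nra|apply pow_le, Rdiv_le_0_compat; lra].
Qed.

(** The derivative of [z ^ n], by cases because the exponent [n - 1] would be truncated at [0]. *)
Definition dmono (n : nat) (z : C) : C :=
  match n with O => 0 | S m => RtoC (INR (S m)) * z ^ m end.

Lemma dmono_S (n : nat) (z : C) : dmono (S n) z = z * dmono n z + z ^ n.
Proof.
  destruct n as [|n]; [simpl; ring|].
  unfold dmono; rewrite !S_INR, !RtoC_plus; simpl; ring.
Qed.

Lemma dmono_bound (n : nat) (z : C) (x : R) : 0 <= x -> Cmod z <= x ->
  Cmod (dmono n z) * x <= INR n * x ^ n.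
Proof.
  intros Hx Hz; destruct n as [|n]; [simpl; rewrite Cmod_0; lra|].
  unfold dmono; rewrite Cmod_mult, Cmod_R, (Rabs_pos_eq (INR (S n))), Cmod_pow by apply pos_INR.
  rewrite Rmult_assoc; apply Rmult_le_compat_l; [apply pos_INR|].
  simpl; rewrite Rmult_comm; apply Rmult_le_compat_l; auto; apply pow_incr; split; auto; apply Cmod_ge_0.
Qed.

(** The second-order remainder [E n] of [z ^ n] satisfies [E (S n) = y * E n + dmono n z * (y -
    z)^2]. The factor [x * x] on the left avoids the exponent [n - 2]. *)
Lemma mono_taylor (n : nat) (z y : C) (x : R) : 0 <= x -> Cmod z <= x -> Cmod y <= x ->
  Cmod (y ^ n - z ^ n - dmono n z * (y - z)) * (x * x)
    <= INR n * INR n * x ^ n * (Cmod (y - z) * Cmod (y - z)).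
Proof.
  intros Hx Hz Hy; induction n as [|n IH].
  - simpl; replace (1 - 1 - 0 * (y - z)) with (RtoC 0) by ring; rewrite Cmod_0; lra.
  - replace (y ^ S n - z ^ S n - dmono (S n) z * (y - z))
      with (y * (y ^ n - z ^ n - dmono n z * (y - z)) + dmono n z * ((y - z) * (y - z)))
      by (rewrite dmono_S; simpl; ring).
    set (E := y ^ n - z ^ n - dmono n z * (y - z)) in *.
    set (h := Cmod (y - z)) in *.
    assert (T := Cmod_triangle (y * E) (dmono n z * ((y - z) * (y - z)))).
    rewrite !Cmod_mult in T; fold h in T.
    assert (D := dmono_bound n z x Hx Hz).
    assert (P1 := Cmod_ge_0 E); assert (P2 := Cmod_ge_0 (dmono n z)).
    assert (Ph : 0 <= h) by apply Cmod_ge_0; assert (Py := Cmod_ge_0 y).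
    assert (Pn := pos_INR n); assert (Px : 0 <= x ^ n) by (apply pow_le; auto).
    assert (Hxx : 0 <= x * x) by nra; assert (Hhh : 0 <= h * h) by nra.
    apply Rle_trans with ((Cmod y * Cmod E + Cmod (dmono n z) * (h * h)) * (x * x))%R;
      [apply Rmult_le_compat_r; auto|].
    assert (Q1 : Cmod y * (Cmod E * (x * x)) <= x * (INR n * INR n * x ^ n * (h * h))).
    { apply Rmult_le_compat; auto; nra. }
    assert (Q2 : Cmod (dmono n z) * x * (x * (h * h)) <= INR n * x ^ n * (x * (h * h))).
    { apply Rmult_le_compat_r; auto; nra. }
    rewrite S_INR; simpl.
    assert (0 <= x * x ^ n * (h * h)) by (apply Rmult_le_pos; auto; apply Rmult_le_pos; auto).
    nra.
Qed.

Lemma Cis_series_plus (u v : nat -> C) (l m : C) :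
  Cis_series u l -> Cis_series v m -> Cis_series (fun n => u n + v n) (l + m).
Proof. apply (is_series_plus (V := C_NormedModule)). Qed.

Lemma Cis_series_scal (c : C) (u : nat -> C) (l : C) :
  Cis_series u l -> Cis_series (fun n => c * u n) (c * l).
Proof. apply (is_series_scal (V := C_NormedModule) c u l). Qed.

Lemma Cis_series_ext (u v : nat -> C) (l : C) :
  (forall n, u n = v n) -> Cis_series u l -> Cis_series v l.
Proof. apply (is_series_ext (V := C_NormedModule)). Qed.

Lemma Cis_series_shift (u : nat -> C) (l : C) :
  Cis_series u l <-> Cis_series (fun n => u (S n)) (l - u 0%nat).
Proof.
  split; intros H.
  - apply (is_series_incr_1 (V := C_NormedModule)).
    change (Cis_series u (l - u 0%nat + u 0%nat)).
    replace (l - u 0%nat + u 0%nat) with l by ring; exact H.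
  - apply (is_series_decr_1 (V := C_NormedModule)); exact H.
Qed.

Lemma Cis_series_first (u : nat -> C) : (forall n, u (S n) = 0) -> Cis_series u (u 0%nat).
Proof.
  intros Hu; apply Cis_series_eps; intros eps He; exists 0%nat; intros n _.
  replace (sum_n u n) with (u 0%nat); [rewrite Cmod_self; auto|].
  induction n as [|n IH]; [rewrite sum_O; reflexivity|].
  rewrite sum_Sn, <- IH, Hu; change plus with Cplus; ring.
Qed.

Lemma Cis_series_at_0 (a : nat -> C) : Cis_series (fun n => a n * 0 ^ n) (a 0%nat).
Proof.
  replace (a 0%nat) with (a 0%nat * 0 ^ 0) by (simpl; ring).
  apply (Cis_series_first (fun n => a n * 0 ^ n)); intros n; simpl; ring.
Qed.

Definition ps_deriv (a : nat -> C) (n : nat) : C := RtoC (INR (S n)) * a (S n).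

(** The remainder of [f] is the sum of those of the monomials; at a radius [x] between [|z|] and [r]
    they are dominated by a geometric series times [|w - z|^2]. *)
Lemma ps_cder (a : nat -> C) (f : C -> C) (r : R) (z : C) : ps a f r -> Cmod z < r ->
  exists l : C, Cis_series (fun n => ps_deriv a n * z ^ n) l /\ cder f z l.
Proof.
  intros H Hz; assert (Hz0 := Cmod_ge_0 z).
  set (x := ((Cmod z + r) / 2)%R).
  assert (Hx : Cmod z < x < r) by (unfold x; lra).
  destruct (ps_geom_dom a f r x H) as (K & y & HK & Hy & D); [lra|].
  assert (Ex : exists l : C, Cis_series (fun n => a n * dmono n z) l).
  { apply (ex_Cis_series_geom _ (K / x) y Hy); intros n.
    rewrite Cmod_mult.
    assert (B := dmono_bound n z x ltac:(lra) ltac:(lra)).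
    apply Rmult_le_reg_r with x; [lra|].
    replace (K / x * y ^ n * x)%R with (K * y ^ n)%R by (field; lra).
    eapply Rle_trans; [|apply D]; rewrite Rmult_assoc.
    apply Rmult_le_compat_l; [apply Cmod_ge_0|].
    eapply Rle_trans; [exact B|]; apply Rmult_le_compat_r; [apply pow_le; lra|].
    generalize (pos_INR n); nra. }
  destruct Ex as [l Hl]; exists l; split.
  - apply (proj1 (Cis_series_shift _ l)) in Hl; cbv beta in Hl.
    replace (l - a 0%nat * dmono 0 z) with l in Hl by (simpl; ring).
    eapply Cis_series_ext; [|exact Hl]; intros n.
    change (a (S n) * (INR (S n) * z ^ n) = ps_deriv a n * z ^ n); unfold ps_deriv; ring.
  - intros eps He.
    set (B := (K / (x * x) / (1 - y) + 1)%R).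
    assert (Hxx : 0 < x * x) by nra.
    assert (HB : 0 < B).
    { unfold B; assert (0 <= K / (x * x) / (1 - y)); [|lra].
      apply Rdiv_le_0_compat; [apply Rdiv_le_0_compat|]; lra. }
    exists (Rmin (x - Cmod z) (eps / B)); split.
    { apply Rmin_pos; [lra|apply Rdiv_lt_0_compat; auto]. }
    intros w Hw.
    assert (Hw1 : Cmod (w - z) < x - Cmod z) by (eapply Rlt_le_trans; [exact Hw|apply Rmin_l]).
    assert (Hw2 : Cmod (w - z) < eps / B) by (eapply Rlt_le_trans; [exact Hw|apply Rmin_r]).
    assert (Hwx : Cmod w <= x) by (generalize (Cmod_rev_triangle w z); lra).
    set (h := Cmod (w - z)) in *; assert (Hh : 0 <= h) by apply Cmod_ge_0.
    assert (S : Cis_series (fun n => a n * (w ^ n - z ^ n - dmono n z * (w - z)))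
                           (f w - f z - l * (w - z))).
    { replace (f w - f z - l * (w - z)) with (f w + - (1) * f z + - (w - z) * l) by ring.
      apply (Cis_series_ext (fun n => (a n * w ^ n + - (1) * (a n * z ^ n)) + - (w - z) * (a n * dmono n z)));
        [intros; ring|].
      apply Cis_series_plus; [apply Cis_series_plus|apply Cis_series_scal; exact Hl].
      - apply H; lra.
      - apply Cis_series_scal, H; lra. }
    assert (S' := Cis_series_geom_bound _ _ (K / (x * x) * (h * h)) y
      ltac:(apply Rmult_le_pos; [apply Rdiv_le_0_compat; lra|nra]) Hy S).
    apply Rle_trans with (B * (h * h))%R.
    + eapply Rle_trans; [apply S'|].
      * intros n; rewrite Cmod_mult.
        assert (T := mono_taylor n z w x ltac:(lra) ltac:(lra) Hwx); fold h in T.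
        apply Rmult_le_reg_r with (x * x)%R; auto.
        replace (K / (x * x) * (h * h) * y ^ n * (x * x))%R with (K * y ^ n * (h * h))%R by (field; lra).
        eapply Rle_trans; [|apply Rmult_le_compat_r; [nra|apply D]].
        rewrite !Rmult_assoc; apply Rmult_le_compat_l; [apply Cmod_ge_0|].
        eapply Rle_trans; [exact T|].
        assert (Pn := pos_INR n); assert (Px : 0 <= x ^ n) by (apply pow_le; lra).
        rewrite <- !Rmult_assoc; apply Rmult_le_compat_r; auto; apply Rmult_le_compat_r; auto.
        apply Rmult_le_compat_r; auto; nra.
      * unfold B; replace (K / (x * x) * (h * h) / (1 - y))%R
          with (K / (x * x) / (1 - y) * (h * h))%R by (field; lra).
        nra.
    + assert (B * h <= eps).
      { apply Rmult_lt_compat_l with (r := B) in Hw2; auto.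
        replace (B * (eps / B))%R with eps in Hw2 by (field; lra); lra. }
      nra.
Qed.

Lemma ps_derive (a : nat -> C) (f : C -> C) (r : R) : ps a f r ->
  ps (ps_deriv a) (C_derive f) r /\ forall z, Cmod z < r -> cder f z (C_derive f z).
Proof.
  intros H; split; intros z Hz; destruct (ps_cder a f r z H Hz) as (l & Hs & Hl).
  - rewrite (C_derive_cder _ _ _ Hl); exact Hs.
  - apply cder_C_derive; eauto.
Qed.

Lemma ps_0 (a : nat -> C) (f : C -> C) (r : R) : 0 < r -> ps a f r -> f 0 = a 0%nat.
Proof.
  intros Hr H; apply (Cis_series_unique (fun n => a n * 0 ^ n)); [|apply Cis_series_at_0].
  apply H; rewrite Cmod_0; auto.
Qed.

(** If [a 0] is nonzero, continuity suffices; otherwise dividing by [z] shifts the coefficients and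
    lowers [m], any index with a nonzero coefficient. *)
Lemma ps_isolated_zero (m : nat) : forall (a : nat -> C) (f : C -> C) (r : R), 0 < r ->
  ps a f r -> a m <> 0 -> exists d, 0 < d /\ forall z, Cmod z < d -> z <> 0 -> f z <> 0.
Proof.
  assert (C0 : forall (a : nat -> C) (f : C -> C) (r : R), 0 < r ->
    ps a f r -> a 0%nat <> 0 -> exists d, 0 < d /\ forall z, Cmod z < d -> z <> 0 -> f z <> 0).
  { intros a f r Hr H Ha.
    destruct (ps_derive a f r H) as [_ Hd].
    destruct (ccont_neq0 f 0) as (d & Hd0 & F).
    - eapply cder_ccont, Hd; rewrite Cmod_0; auto.
    - rewrite (ps_0 a f r); auto.
    - exists d; split; auto; intros z Hz _; apply F; replace (z - 0) with z by ring; auto. }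
  induction m as [|m IH]; intros a f r Hr H Ha; [apply (C0 a f r); auto|].
  destruct (Ceq_dec (a 0%nat) 0) as [E0|n]; [|apply (C0 a f r); auto].
  set (f1 := fun z => if Ceq_dec z 0 then a 1%nat else f z / z).
  destruct (IH (fun n => a (S n)) f1 r Hr) as (d & Hd & F); auto.
  - intros z Hz; unfold f1; destruct (Ceq_dec z 0) as [->|Hz0].
    + apply (Cis_series_at_0 (fun n => a (S n))).
    + specialize (H z Hz); apply (proj1 (Cis_series_shift _ _)) in H; cbv beta in H; rewrite E0 in H.
      replace (f z - 0 * z ^ 0) with (f z) in H by ring.
      replace (f z / z) with (/ z * f z) by (field; auto).
      eapply Cis_series_ext; [|apply Cis_series_scal; exact H].
      intros n; simpl; field; auto.
  - exists d; split; auto; intros z Hz Hz0 E; apply (F z Hz Hz0).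
    unfold f1; destruct (Ceq_dec z 0); [contradiction|]; rewrite E; field; auto.
Qed.

(** Continuity is enough at the centre of the disk, so this contains the removable
    singularity theorem. *)
Lemma Taylor_series (f : C -> C) (r s : R) : exp s < r ->
  (forall z, Cmod z < r -> ccont f z) ->
  (forall z, Cmod z < r -> z <> 0 -> exists l, cder f z l) ->
  exists a, ps a f (exp s).
Proof.
  intros Hs Hf Hd; assert (PIp := PI_RGT_0).
  set (A := fun n => circ (fun z => f z * / z ^ n) s).
  exists (fun n => / (2 * PI)%R * A n); intros w Hw.
  assert (Hz0 : forall z, Cmod z = exp s -> z <> 0).
  { intros z Hz E; rewrite E, Cmod_0 in Hz; generalize (exp_pos s); lra. }
  assert (Hzw : forall z, Cmod z = exp s -> z <> w) by (intros z Hz ->; lra).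
  assert (Hpn : forall n (z : C), z <> 0 -> z ^ n <> 0).
  { intros n z Hz; apply Cmod_gt_0; rewrite Cmod_pow; apply pow_lt, Cmod_gt_0; auto. }
  assert (Hc : forall n z, Cmod z = exp s -> ccont (fun z => f z * / z ^ n) z).
  { intros n z Hz; apply ccont_mult; [apply Hf; lra|].
    apply (ccont_comp Cinv (fun z => z ^ n)); [apply ccont_pow, ccont_id|].
    apply ccont_inv, Hpn, Hz0; auto. }
  assert (Hck : forall n z, Cmod z = exp s -> ccont (fun z => (f z * / z ^ n) * (z / (z - w))) z).
  { intros n z Hz; apply (ccont_mult (fun z => f z * / z ^ n)); [auto|apply ccont_kernel; auto]. }
  (* The kernel satisfies [z / (z - w) = 1 + (w / z) * (z / (z - w))]. Iterating gives the partial
     sums with the exact remainder [w ^ n * Rm n], so no sum is exchanged with an integral. *)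
  set (Rm := fun n => circ (fun z => (f z * / z ^ n) * (z / (z - w))) s).
  assert (HR : forall n, Rm n = A n + w * Rm (S n)).
  { intros n; unfold Rm at 2; rewrite <- circ_scal by auto.
    unfold A; rewrite <- circ_plus; auto.
    - unfold Rm; apply circ_ext; intros z Hz; change (z ^ S n) with (z * z ^ n).
      assert (Q1 := Hz0 z Hz); assert (Q2 := Hpn n z Q1); assert (Q3 := Csub_neq0 _ _ (Hzw z Hz)).
      generalize (z ^ n) Q2; intros p Qp; field; auto.
    - intros z Hz; apply (ccont_mult (fun _ => w)); [apply ccont_const|auto]. }
  assert (HF : Rm 0%nat = (2 * PI)%R * f w).
  { rewrite <- (Cauchy_formula f r s w) by auto.
    unfold Rm; apply circ_ext; intros z Hz; assert (Q3 := Csub_neq0 _ _ (Hzw z Hz)).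
    change (z ^ 0) with (RtoC 1); field; auto. }
  assert (P2 : RtoC (2 * PI) <> 0) by (intros E; apply RtoC_inj in E; lra).
  assert (HS : forall n, f w - sum_n (fun k => / (2 * PI)%R * A k * w ^ k) n
    = / (2 * PI)%R * (w ^ S n * Rm (S n))).
  { induction n as [|n IH].
    - rewrite sum_O; replace (f w) with (/ (2 * PI)%R * Rm 0%nat) by (rewrite HF; field; auto).
      rewrite HR; simpl; ring.
    - rewrite sum_Sn; change plus with Cplus.
      replace (f w - (sum_n (fun k => / (2 * PI)%R * A k * w ^ k) n + / (2 * PI)%R * A (S n) * w ^ S n))
        with (f w - sum_n (fun k => / (2 * PI)%R * A k * w ^ k) n - / (2 * PI)%R * A (S n) * w ^ S n) by ring.
      rewrite IH, (HR (S n)); simpl; ring. }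
  (* Compactness of the circle: points where [|f|] exceeds [n] would cluster at a point of the disk
     of radius [r], where [f] is continuous. *)
  assert (HM : exists M, 0 <= M /\ forall z, Cmod z = exp s -> Cmod (f z) <= M).
  { destruct (classic (exists M, forall z, Cmod z = exp s -> Cmod (f z) <= M)) as [[M H]|H].
    - exists M; split; auto; eapply Rle_trans; [apply Cmod_ge_0|apply (H _ (Cmod_circle s 0))].
    - exfalso.
      assert (Hn : forall n : nat, exists z, Cmod z = exp s /\ INR n < Cmod (f z)).
      { intros n; apply NNPP; intros H1; apply H; exists (INR n); intros z Hz.
        apply Rnot_lt_le; intros H2; apply H1; eauto. }
      set (u := fun n => proj1_sig (constructive_indefinite_description _ (Hn n))).
      assert (Hu : forall n, Cmod (u n) = exp s /\ INR n < Cmod (f (u n)))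
        by (intros n; unfold u; apply (proj2_sig (constructive_indefinite_description _ (Hn n)))).
      destruct (bounded_seq_cluster u (exp s)) as [z Hz]; [intros n; right; apply Hu|].
      assert (Hzr : Cmod z < r).
      { destruct (Hz (r - exp s)%R 0%nat) as (n & _ & Hzn); [lra|].
        rewrite Cmod_sub_sym in Hzn; generalize (Cmod_rev_triangle z (u n)); rewrite (proj1 (Hu n)); lra. }
      destruct (Hf z Hzr 1%R Rlt_0_1) as (d & Hd0 & F).
      destruct (INR_unbounded (Cmod (f z) + 1)) as [N HN].
      destruct (Hz d N Hd0) as (n & Hn1 & Hn2).
      specialize (F (u n) Hn2); destruct (Hu n) as [_ U].
      apply le_INR in Hn1; generalize (Cmod_rev_triangle (f (u n)) (f z)); lra. }
  destruct HM as (M & HM0 & HM).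
  set (K := (exp s / (exp s - Cmod w))%R).
  assert (HK : 0 < K) by (apply Rdiv_lt_0_compat; [apply exp_pos|lra]).
  assert (Hes := exp_pos s).
  assert (HRb : forall n, Cmod (w ^ n * Rm n) <= 4 * PI * (M * K) * (Cmod w / exp s) ^ n).
  { intros n; rewrite Cmod_mult, Cmod_pow.
    assert (B : Cmod (Rm n) <= 2 * (2 * PI * (M * / exp s ^ n * K))).
    { unfold Rm; apply circ_bound; [exact (Hck n)|]; intros t _.
      set (z := cexp (s, t)); assert (Hz : Cmod z = exp s) by apply Cmod_circle.
      destruct (Cmod_kernel w z s Hw Hz) as [_ Hk].
      rewrite !Cmod_mult, Cmod_inv, Cmod_pow, Hz by (apply Hpn; auto).
      assert (0 < / exp s ^ n) by (apply Rinv_0_lt_compat, pow_lt; auto).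
      assert (Hm := HM z Hz); assert (Hm0 := Cmod_ge_0 (f z)).
      apply Rmult_le_compat; auto; [nra|apply Cmod_ge_0|nra]. }
    unfold Rdiv; rewrite Rpow_mult_distr, pow_inv.
    replace (4 * PI * (M * K) * (Cmod w ^ n * / exp s ^ n))%R
      with (Cmod w ^ n * (2 * (2 * PI * (M * / exp s ^ n * K))))%R by ring.
    apply Rmult_le_compat_l; auto; apply pow_le, Cmod_ge_0. }
  assert (Hq : 0 <= Cmod w / exp s < 1).
  { split; [apply Rdiv_le_0_compat; auto; apply Cmod_ge_0|].
    apply Rmult_lt_reg_r with (exp s); auto; unfold Rdiv; rewrite Rmult_assoc, Rinv_l; lra. }
  apply Cis_series_eps; intros eps He.
  set (Q := (2 * (M * K) + 1)%R).
  assert (HQ : 0 < Q) by (unfold Q; generalize (Rmult_le_pos M K HM0 (Rlt_le _ _ HK)); lra).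
  destruct (pow_lt_1_zero (Cmod w / exp s) ltac:(rewrite Rabs_pos_eq; lra) (eps / Q)) as [N HN];
    [apply Rdiv_lt_0_compat; auto|].
  exists N; intros n Hn; rewrite Cmod_sub_sym, HS, Cmod_mult, Cmod_inv, Cmod_R by auto.
  rewrite Rabs_pos_eq by lra.
  specialize (HN (S n) ltac:(lia)); rewrite Rabs_pos_eq in HN by (apply pow_le; lra).
  assert (B := HRb (S n)).
  set (q := ((Cmod w / exp s) ^ S n)%R) in *.
  assert (Hq0 : 0 <= q) by (apply pow_le; lra).
  apply Rmult_lt_reg_l with (2 * PI)%R; [lra|].
  rewrite <- Rmult_assoc, Rinv_r, Rmult_1_l by lra.
  eapply Rle_lt_trans; [exact B|].
  apply Rle_lt_trans with (2 * PI * (Q * q))%R; [unfold Q; nra|].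
  apply Rmult_lt_compat_l; [lra|].
  apply Rmult_lt_compat_l with (r := Q) in HN; auto.
  replace (Q * (eps / Q))%R with eps in HN by (field; lra); exact HN.
Qed.

(** * Local theory of holomorphic and injective functions *)

Definition holo (f : C -> C) (a : C) (r : R) : Prop :=
  forall z, Cmod (z - a) < r -> exists l, cder f z l.

Definition inj_on (f : C -> C) (a : C) (r : R) : Prop :=
  forall x y, Cmod (x - a) < r -> Cmod (y - a) < r -> f x = f y -> x = y.

Lemma holo_subdisk (f : C -> C) (a b : C) (r s : R) :
  holo f a r -> Cmod (b - a) + s <= r -> holo f b s.
Proof.
  intros H Hs z Hz; apply H; generalize (Cmod_sub_triangle z b a); lra.
Qed.

Lemma inj_on_subdisk (f : C -> C) (a b : C) (r s : R) :
  inj_on f a r -> Cmod (b - a) + s <= r -> inj_on f b s.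
Proof.
  intros H Hs x y Hx Hy; apply H;
    [generalize (Cmod_sub_triangle x b a)|generalize (Cmod_sub_triangle y b a)]; lra.
Qed.

Lemma holo_ccont (f : C -> C) (a z : C) (r : R) : holo f a r -> Cmod (z - a) < r -> ccont f z.
Proof. intros H Hz; destruct (H z Hz) as [l Hl]; eapply cder_ccont; eauto. Qed.

Lemma holo_cder (f : C -> C) (a z : C) (r : R) :
  holo f a r -> Cmod (z - a) < r -> cder f z (C_derive f z).
Proof. intros H Hz; apply cder_C_derive, H, Hz. Qed.

Lemma ccont_translate (f : C -> C) (a z : C) : ccont f (a + z) -> ccont (fun y => f (a + y)) z.
Proof.
  intros H; apply (ccont_comp f (fun y => a + y)); auto.
  apply ccont_plus; [apply ccont_const|apply ccont_id].
Qed.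

Lemma cder_translate (f : C -> C) (a z l : C) :
  cder f (a + z) l -> cder (fun y => f (a + y)) z l.
Proof.
  intros H; apply (cder_eq _ z (l * (0 + 1))); [|ring].
  apply (cder_comp f (fun y => a + y)); auto.
  apply cder_plus; [apply cder_const|apply cder_id].
Qed.

Lemma cder_untranslate (f : C -> C) (a z l : C) :
  cder (fun y => f (a + y)) z l -> cder f (a + z) l.
Proof.
  intros H; apply (cder_ext (fun y => (fun x => f (a + x)) (- a + y))).
  - intros y; f_equal; ring.
  - apply (cder_translate (fun x => f (a + x)) (- a)).
    replace (- a + (a + z)) with z by ring; exact H.
Qed.

Lemma Cmod_translate (a z : C) : Cmod (a + z - a) = Cmod z.
Proof. f_equal; ring. Qed.

Lemma Taylor_at (f : C -> C) (a : C) (r s : R) : 0 < s -> s < r ->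
  (forall z, Cmod (z - a) < r -> ccont f z) ->
  (forall z, Cmod (z - a) < r -> z <> a -> exists l, cder f z l) ->
  exists c, ps c (fun z => f (a + z)) s.
Proof.
  intros Hs Hsr Hc Hd; rewrite <- (exp_ln s Hs) in Hsr |- *.
  apply (Taylor_series _ r _ Hsr).
  - intros z Hz; apply ccont_translate, Hc; rewrite Cmod_translate; auto.
  - intros z Hz Hz0; destruct (Hd (a + z)) as [l Hl].
    + rewrite Cmod_translate; auto.
    + intros E; apply Hz0; replace z with (a + z - a) by ring; rewrite E; ring.
    + exists l; apply cder_translate; auto.
Qed.

Lemma removable (f : C -> C) (a : C) (r : R) : 0 < r ->
  (forall z, Cmod (z - a) < r -> ccont f z) ->
  (forall z, Cmod (z - a) < r -> z <> a -> exists l, cder f z l) -> holo f a r.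
Proof.
  intros Hr Hc Hd z Hz; destruct (Ceq_dec z a) as [->|n]; auto.
  destruct (Taylor_at f a r (r / 2) ltac:(lra) ltac:(lra) Hc Hd) as [c Hps].
  destruct (ps_cder c _ _ 0 Hps) as (l & _ & Hl); [rewrite Cmod_0; lra|].
  exists l; replace a with (a + 0) by ring; apply cder_untranslate; auto.
Qed.

Lemma C_derive_translate (f : C -> C) (a z : C) : (exists l, cder f (a + z) l) ->
  C_derive (fun y => f (a + y)) z = C_derive f (a + z).
Proof. intros H; apply C_derive_cder, cder_translate, cder_C_derive; auto. Qed.

Lemma holo_Taylor (f : C -> C) (a : C) (r s : R) : 0 < s -> s < r -> holo f a r ->
  exists c, ps c (fun z => f (a + z)) s.
Proof.
  intros Hs Hsr H; apply (Taylor_at f a r s); auto; intros z Hz; eapply holo_ccont; eauto.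
Qed.

Lemma holo_C_derive (f : C -> C) (a : C) (r : R) : holo f a r -> holo (C_derive f) a r.
Proof.
  intros H z Hz; set (s := (r - Cmod (z - a))%R).
  assert (Hs : 0 < s) by (unfold s; lra).
  assert (H' : holo f z s) by (apply (holo_subdisk f a z r s H); unfold s; lra).
  destruct (holo_Taylor f z s (s / 2) ltac:(lra) ltac:(lra) H') as [c Hps].
  destruct (ps_derive _ _ _ Hps) as [Hps' _].
  destruct (ps_cder _ _ _ 0 Hps') as (l & _ & Hl); [rewrite Cmod_0; lra|].
  exists l; replace z with (z + 0) by ring; apply cder_untranslate.
  eapply (cder_ext_loc _ _ 0 l s); [auto| |exact Hl].
  intros y Hy; apply C_derive_translate, H'; rewrite Cmod_translate.
  replace (y - 0) with y in Hy by ring; auto.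
Qed.

(** Let [mu t0] be the minimum of [|f - f a|] on the circle of radius [r / 2], positive by
    injectivity. If [y] within [mu t0 / 2] of [f a] were omitted, [1 / (f - y)] would be holomorphic
    and larger at the centre than on the circle, against [max_modulus]. *)
Lemma inj_open (f : C -> C) (a : C) (r : R) : 0 < r -> holo f a r -> inj_on f a r ->
  exists d, 0 < d /\ forall y, Cmod (y - f a) < d -> exists x, Cmod (x - a) < r /\ f x = y.
Proof.
  intros Hr Hf Hi; set (s := ln (r / 2)).
  assert (Es : exp s = (r / 2)%R) by (apply exp_ln; lra).
  assert (Hon : forall t, Cmod (a + cexp (s, t) - a) = (r / 2)%R)
    by (intros t; rewrite Cmod_translate, Cmod_circle; auto).
  set (mu := fun t => Cmod (f (a + cexp (s, t)) - f a)).
  assert (Hlip : forall u t : R, Rabs (mu u - mu t) <= Cmod (f (a + cexp (s, u)) - f (a + cexp (s, t)))).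
  { intros u t; unfold mu; apply Rabs_le.
    assert (T1 := Cmod_rev_triangle (f (a + cexp (s, u)) - f a) (f (a + cexp (s, t)) - f a)).
    assert (T2 := Cmod_rev_triangle (f (a + cexp (s, t)) - f a) (f (a + cexp (s, u)) - f a)).
    rewrite (Cmod_sub_sym (f (a + cexp (s, t)) - f a)) in T2.
    replace (f (a + cexp (s, u)) - f a - (f (a + cexp (s, t)) - f a))
      with (f (a + cexp (s, u)) - f (a + cexp (s, t))) in T1, T2 by ring.
    lra. }
  assert (Hmu : forall t, continuity_pt mu t).
  { intros t; apply continuity_pt_locally; intros eps.
    destruct (rcont_circle (fun z => f (a + z)) s t) with (eps := pos eps) as (d & Hd & F).
    - apply ccont_translate; eapply holo_ccont; eauto; rewrite Hon; lra.
    - apply cond_pos.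
    - exists (mkposreal d Hd); intros u Hu; eapply Rle_lt_trans; [apply Hlip|apply (F u Hu)]. }
  assert (TP := two_PI_pos).
  destruct (continuity_ab_min mu 0 (2 * PI) ltac:(lra) ltac:(intros; apply Hmu)) as (t0 & Hmin & _).
  assert (Hpos : 0 < mu t0).
  { apply Cmod_sub_gt_0; intros E; apply Hi in E.
    - assert (A := Hon t0); rewrite E, Cmod_self in A; lra.
    - rewrite Hon; lra.
    - rewrite Cmod_self; lra. }
  exists (mu t0 / 2)%R; split; [lra|]; intros y Hy.
  apply NNPP; intros Hno.
  assert (Hne : forall z, Cmod z < r -> f (a + z) - y <> 0).
  { intros z Hz E; apply Hno; exists (a + z); rewrite Cmod_translate; split; auto.
    apply Cmod_sub_eq0; rewrite E; apply Cmod_0. }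
  assert (Hfy : 0 < Cmod (f a - y)).
  { apply Cmod_gt_0; replace a with (a + 0) by ring; apply Hne; rewrite Cmod_0; auto. }
  assert (M : Cmod (/ (f (a + 0) - y)) <= / (mu t0 / 2)).
  { assert (Hdf : forall z, Cmod z < r -> exists l, cder (fun z => / (f (a + z) - y)) z l).
    { intros z Hz; destruct (Hf (a + z)) as [l Hl]; [rewrite Cmod_translate; auto|].
      eexists; apply (cder_comp Cinv (fun z => f (a + z) - y)).
      - apply (cder_minus (fun z => f (a + z)) (fun _ => y));
          [apply cder_translate; exact Hl|apply cder_const].
      - apply cder_inv, Hne; auto. }
    set (h := fun z => / (f (a + z) - y)).
    assert (Hcirc : forall t, 0 <= t <= 2 * PI -> Cmod (h (cexp (s, t))) <= / (mu t0 / 2)).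
    { intros t Ht; unfold h; rewrite Cmod_inv by (apply Hne; rewrite Cmod_circle; lra).
      apply Rinv_le_contravar; [lra|].
      assert (T := Cmod_sub_triangle (f (a + cexp (s, t))) y (f a)).
      specialize (Hmin t Ht); unfold mu in Hmin at 2; lra. }
    apply (max_modulus h r s); [rewrite Cmod_0; apply exp_pos|lra| | |exact Hcirc].
    - intros z Hz; destruct (Hdf z Hz) as [l Hl]; exact (cder_ccont _ _ _ Hl).
    - intros z Hz _; exact (Hdf z Hz). }
  replace (a + 0) with a in M by ring.
  rewrite Cmod_inv in M by (apply Cmod_gt_0; auto).
  rewrite Cmod_sub_sym in Hy.
  assert (/ (mu t0 / 2) < / Cmod (f a - y)) by (apply Rinv_lt_contravar; [apply Rmult_lt_0_compat|]; lra).
  lra.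
Qed.

(** Continuity of the inverse at [y] is [inj_open] on small disks around [g y]; injectivity
    identifies the preimage found there with the chosen one. *)
Lemma inj_inverse_ccont (f : C -> C) (a : C) (r : R) : 0 < r -> holo f a r -> inj_on f a r ->
  exists (d : R) (g : C -> C), 0 < d /\ forall y, Cmod (y - f a) < d ->
    Cmod (g y - a) < r /\ f (g y) = y /\ ccont g y.
Proof.
  intros Hr Hf Hi; destruct (inj_open f a r Hr Hf Hi) as (d & Hd & Ho).
  assert (Hg : forall y, exists x, Cmod (y - f a) < d -> Cmod (x - a) < r /\ f x = y).
  { intros y; destruct (classic (Cmod (y - f a) < d)) as [Hy|Hy]; [|exists 0; tauto].
    destruct (Ho y Hy) as [x Hx]; exists x; auto. }
  set (g := fun y => proj1_sig (constructive_indefinite_description _ (Hg y))).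
  assert (Gy : forall y, Cmod (y - f a) < d -> Cmod (g y - a) < r /\ f (g y) = y)
    by (intros y; unfold g; apply proj2_sig).
  clearbody g; exists d, g; split; auto; intros y Hy.
  destruct (Gy y Hy) as [G1 G2]; split; auto; split; auto.
  intros eps He.
  set (e := Rmin eps (r - Cmod (g y - a))).
  assert (He0 : 0 < e) by (apply Rmin_pos; lra).
  assert (Hle : Cmod (g y - a) + e <= r) by (generalize (Rmin_r eps (r - Cmod (g y - a))); fold e; lra).
  destruct (inj_open f (g y) e He0 (holo_subdisk f a (g y) r e Hf Hle)
    (inj_on_subdisk f a (g y) r e Hi Hle)) as (d' & Hd' & Ho').
  exists (Rmin d' (d - Cmod (y - f a))); split; [apply Rmin_pos; lra|]; intros y' Hy'.
  assert (Y1 : Cmod (y' - y) < d') by (eapply Rlt_le_trans; [exact Hy'|apply Rmin_l]).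
  assert (Y2 : Cmod (y' - y) < d - Cmod (y - f a)) by (eapply Rlt_le_trans; [exact Hy'|apply Rmin_r]).
  rewrite <- G2 in Y1; destruct (Ho' y' Y1) as (x & Hx & Ex).
  destruct (Gy y') as [G3 G4]; [generalize (Cmod_sub_triangle y' y (f a)); lra|].
  assert (E : g y' = x).
  { apply Hi; auto; [generalize (Cmod_sub_triangle x (g y) a); lra|congruence]. }
  rewrite E; eapply Rlt_le_trans; [exact Hx|apply Rmin_l].
Qed.

(** The slope form of [f] reads [y - y0 = (g y - g y0) * s (g y)], so [/ s (g y)] is a continuous
    slope of [g]. *)
Lemma inverse_cder (f g : C -> C) (y0 l : C) (d : R) : 0 < d ->
  (forall y, Cmod (y - y0) < d -> f (g y) = y) -> ccont g y0 -> cder f (g y0) l -> l <> 0 ->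
  cder g y0 (/ l).
Proof.
  intros Hd Hfg Hg Hf Hl; apply cder_slope in Hf; destruct Hf as (s & Es & Cs & Fs).
  assert (Csg : ccont (fun y => s (g y)) y0) by (apply (ccont_comp s g); auto).
  destruct (ccont_neq0 _ y0 Csg) as (d' & Hd' & Hn); [rewrite Es; auto|].
  apply (cder_ext_loc (fun y => g y0 + (y - y0) * / s (g y)) g y0 (/ l) (Rmin d d')).
  - apply Rmin_pos; auto.
  - intros y Hy.
    assert (Y1 : Cmod (y - y0) < d) by (eapply Rlt_le_trans; [exact Hy|apply Rmin_l]).
    assert (Y2 : Cmod (y - y0) < d') by (eapply Rlt_le_trans; [exact Hy|apply Rmin_r]).
    assert (E := Fs (g y)); rewrite (Hfg y Y1), (Hfg y0) in E by (rewrite Cmod_self; auto).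
    assert (Hny := Hn y Y2); cbv beta in Hny; rewrite E at 1; field; auto.
  - apply cder_slope; exists (fun y => / s (g y)); split; [rewrite Es; reflexivity|]; split.
    + apply (ccont_comp Cinv (fun y => s (g y))); auto; apply ccont_inv; rewrite Es; auto.
    + intros y; replace (y0 - y0) with (RtoC 0) by ring; ring.
Qed.

(** If [f' a = 0], the inverse of [f] is differentiable off the isolated point [f a]
    and continuous there, hence differentiable, against the chain rule. *)
Lemma inj_C_derive_neq0 (f : C -> C) (a : C) (r : R) : 0 < r -> holo f a r -> inj_on f a r ->
  C_derive f a <> 0.
Proof.
  intros Hr Hf Hi Hz.
  destruct (holo_Taylor f a r (r / 2) ltac:(lra) ltac:(lra) Hf) as [c Hc].
  destruct (ps_derive _ _ _ Hc) as [Hc' _].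
  (* Otherwise [f] is constant near [a], and the points [a] and [a + r / 4] contradict
     injectivity. *)
  assert (Hm : exists m, ps_deriv c m <> 0).
  { apply NNPP; intros Hno.
    assert (Hcz : forall m, c (S m) = 0).
    { intros m; apply NNPP; intros n; apply Hno; exists m; unfold ps_deriv.
      apply Cmult_neq_0; auto; intros E; apply RtoC_inj in E; revert E; apply not_0_INR; lia. }
    assert (Hconst : forall z, Cmod z < r / 2 -> f (a + z) = c 0%nat).
    { intros z Hzr; apply (Cis_series_unique (fun n => c n * z ^ n)); [apply Hc; auto|].
      replace (c 0%nat) with (c 0%nat * z ^ 0) by (simpl; ring).
      apply (Cis_series_first (fun n => c n * z ^ n)); intros n; rewrite Hcz; ring. }
    assert (Hr4 : Cmod (r / 4)%R = (r / 4)%R) by (rewrite Cmod_R, Rabs_pos_eq; lra).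
    assert (E : a + (r / 4)%R = a + 0).
    { apply Hi; rewrite ?Cmod_translate, ?Cmod_0; try lra.
      rewrite !Hconst; auto; rewrite ?Cmod_0; lra. }
    assert (E' : RtoC (r / 4) = 0)
      by (replace (RtoC (r / 4)) with (a + (r / 4)%R - a) by ring; rewrite E; ring).
    apply RtoC_inj in E'; lra. }
  destruct Hm as [m Hm].
  destruct (ps_isolated_zero m _ _ (r / 2) ltac:(lra) Hc' Hm) as (d & Hd & Hiso).
  assert (Hnz : forall x, Cmod (x - a) < Rmin d r -> x <> a -> C_derive f x <> 0).
  { intros x Hx Hxa.
    assert (X1 : Cmod (x - a) < d) by (eapply Rlt_le_trans; [exact Hx|apply Rmin_l]).
    assert (X2 : Cmod (x - a) < r) by (eapply Rlt_le_trans; [exact Hx|apply Rmin_r]).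
    replace x with (a + (x - a)) by ring.
    rewrite <- C_derive_translate by (replace (a + (x - a)) with x by ring; auto).
    apply Hiso; auto; apply Csub_neq0; auto. }
  assert (Hle : Cmod (a - a) + Rmin d r <= r) by (rewrite Cmod_self; generalize (Rmin_r d r); lra).
  destruct (inj_inverse_ccont f a (Rmin d r) ltac:(apply Rmin_pos; auto)
    (holo_subdisk f a a r _ Hf Hle) (inj_on_subdisk f a a r _ Hi Hle)) as (e & g & He & Hg).
  assert (Hmr := Rmin_r d r).
  assert (Gh : holo g (f a) e).
  { apply removable; auto.
    - intros y Hy; apply (Hg y Hy).
    - intros y Hy Hya; destruct (Hg y Hy) as (G1 & G2 & G3).
      exists (/ C_derive f (g y)).
      apply (inverse_cder f g y _ (e - Cmod (y - f a))); auto; [lra| | |].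
      + intros y' Hy'; apply Hg; generalize (Cmod_sub_triangle y' y (f a)); lra.
      + apply (holo_cder f a _ r Hf); lra.
      + apply Hnz; auto; intros E; apply Hya; rewrite <- G2, E; reflexivity. }
  destruct (Gh (f a)) as [l Hl]; [rewrite Cmod_self; auto|].
  destruct (Hg (f a)) as (G1 & G2 & _); [rewrite Cmod_self; auto|].
  assert (Ga : g (f a) = a) by (apply Hi; auto; [lra|rewrite Cmod_self; auto]).
  assert (D1 : cder (fun y => f (g y)) (f a) (C_derive f a * l)).
  { apply (cder_comp f g); auto; rewrite Ga; apply (holo_cder f a a r Hf); rewrite Cmod_self; auto. }
  assert (D2 : cder (fun y => f (g y)) (f a) 1).
  { apply (cder_ext_loc (fun y => y) _ _ _ e He); [|apply cder_id].
    intros y Hy; symmetry; apply Hg; auto. }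
  assert (E := cder_unique _ _ _ _ D1 D2); rewrite Hz, Cmult_0_l in E.
  apply RtoC_inj in E; lra.
Qed.

Lemma inj_inverse (f : C -> C) (a : C) (r : R) : 0 < r -> holo f a r -> inj_on f a r ->
  exists (d : R) (g : C -> C), 0 < d /\ forall y, Cmod (y - f a) < d ->
    Cmod (g y - a) < r /\ f (g y) = y /\ exists l, cder g y l.
Proof.
  intros Hr Hf Hi; destruct (inj_inverse_ccont f a r Hr Hf Hi) as (d & g & Hd & Hg).
  exists d, g; split; auto; intros y Hy; destruct (Hg y Hy) as (G1 & G2 & G3).
  split; auto; split; auto; exists (/ C_derive f (g y)).
  set (s := (r - Cmod (g y - a))%R).
  assert (Hs : Cmod (g y - a) + s <= r) by (unfold s; lra).
  apply (inverse_cder f g y _ (d - Cmod (y - f a))); auto; [lra| | |].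
  - intros y' Hy'; apply Hg; generalize (Cmod_sub_triangle y' y (f a)); lra.
  - apply (holo_cder f a _ r Hf); lra.
  - apply (inj_C_derive_neq0 f (g y) s); [unfold s; lra| |].
    + apply (holo_subdisk f a _ r); auto.
    + apply (inj_on_subdisk f a _ r); auto.
Qed.

(** Restriction to a segment, in preparation for the real mean value theorem, which applies to each
    component but not to [h] itself. *)
Lemma cder_Re_segment (h : C -> C) (y v l : C) (t : R) : cder h (y + t * v) l ->
  is_derive (fun u : R => Re (h (y + u * v))) t (Re (l * v)) /\
  is_derive (fun u : R => Im (h (y + u * v))) t (Im (l * v)).
Proof.
  intros H.
  assert (K : forall eps, 0 < eps -> exists d : posreal, forall k : R, k <> 0%R -> Rabs k < d ->
    Cmod (h (y + (t + k)%R * v) - h (y + t * v) - l * (k * v)) < eps * Rabs k).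
  { intros eps He; set (m := (Cmod v + 1)%R).
    assert (Hm : 0 < m) by (unfold m; generalize (Cmod_ge_0 v); lra).
    destruct (H (eps / (2 * m))%R) as (d & Hd & F); [apply Rdiv_lt_0_compat; lra|].
    assert (Hdm : 0 < d / m) by (apply Rdiv_lt_0_compat; auto).
    exists (mkposreal _ Hdm); simpl; intros k Hk Hkd.
    specialize (F (y + (t + k)%R * v)).
    replace (y + (t + k)%R * v - (y + t * v)) with (k * v) in F by (rewrite RtoC_plus; ring).
    rewrite Cmod_mult, Cmod_R in F.
    assert (Hkp : 0 < Rabs k) by (apply Rabs_pos_lt; auto).
    assert (Hvm : Rabs k * Cmod v <= Rabs k * m) by (apply Rmult_le_compat_l; unfold m; lra).
    assert (Hkm : Rabs k * m < d).
    { apply Rmult_lt_compat_r with (r := m) in Hkd; auto.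
      replace (d / m * m)%R with d in Hkd by (field; lra); exact Hkd. }
    eapply Rle_lt_trans; [apply F; lra|].
    apply Rle_lt_trans with (eps / (2 * m) * (Rabs k * m))%R.
    - apply Rmult_le_compat_l; auto; left; apply Rdiv_lt_0_compat; lra.
    - replace (eps / (2 * m) * (Rabs k * m))%R with (eps * Rabs k / 2)%R by (field; lra).
      assert (0 < eps * Rabs k) by (apply Rmult_lt_0_compat; auto); lra. }
  split; apply is_derive_Reals; intros eps He; destruct (K eps He) as [d Fd]; exists d; intros k Hk Hkd;
    specialize (Fd k Hk Hkd); assert (Hkp : 0 < Rabs k) by (apply Rabs_pos_lt; auto);
    apply Rmult_lt_reg_r with (Rabs k); auto; rewrite <- Rabs_mult;
    (eapply Rle_lt_trans; [|exact Fd]).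
  - revert Fd; generalize (h (y + (t + k)%R * v)) (h (y + t * v)); intros A B _.
    replace (((Re A - Re B) / k - Re (l * v)) * k)%R with (Re (A - B - l * (k * v)));
      [apply re_le_Cmod|].
    destruct A, B, l, v; simpl; field; auto.
  - revert Fd; generalize (h (y + (t + k)%R * v)) (h (y + t * v)); intros A B _.
    replace (((Im A - Im B) / k - Im (l * v)) * k)%R with (Im (A - B - l * (k * v)));
      [apply Rabs_Im_le_Cmod|].
    destruct A, B, l, v; simpl; field; auto.
Qed.

Lemma holo_lipschitz (h : C -> C) (a x y : C) (r e : R) : holo h a r ->
  (forall z, Cmod (z - a) < r -> Cmod (C_derive h z) <= e) ->
  Cmod (x - a) < r -> Cmod (y - a) < r -> Cmod (h x - h y) <= 2 * (e * Cmod (x - y)).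
Proof.
  intros Hh He Hx Hy.
  assert (Hseg : forall t : R, 0 <= t <= 1 -> Cmod (y + t * (x - y) - a) < r).
  { intros t Ht; replace (y + t * (x - y) - a) with (t * (x - a) + (1 - t)%R * (y - a))
      by (rewrite RtoC_minus; ring).
    eapply Rle_lt_trans; [apply Cmod_triangle|]; rewrite !Cmod_mult, !Cmod_R, !Rabs_pos_eq by lra.
    assert (Hc := Cmod_ge_0 (x - a)); assert (Hc' := Cmod_ge_0 (y - a)).
    destruct (Req_dec t 0) as [->|]; nra. }
  assert (Hd : forall t : R, 0 <= t <= 1 -> _)
    by (intros t Ht; exact (cder_Re_segment h y (x - y) _ t (holo_cder h a _ r Hh (Hseg t Ht)))).
  assert (Hb : forall t : R, 0 <= t <= 1 ->
    Cmod (C_derive h (y + t * (x - y)) * (x - y)) <= e * Cmod (x - y)).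
  { intros t Ht; rewrite Cmod_mult; apply Rmult_le_compat_r; [apply Cmod_ge_0|auto]. }
  assert (MV : forall (u du : R -> R), (forall t, 0 <= t <= 1 -> is_derive u t (du t)) ->
    (forall t, 0 <= t <= 1 -> Rabs (du t) <= e * Cmod (x - y)) -> Rabs (u 1 - u 0) <= e * Cmod (x - y)).
  { intros u du Du Bu; destruct (MVT_gen u 0 1 du) as (t & Ht & E).
    - intros t Ht; rewrite Rmin_left, Rmax_right in Ht by lra; apply Du; lra.
    - intros t Ht; rewrite Rmin_left, Rmax_right in Ht by lra.
      apply derivable_continuous_pt; exists (du t); apply is_derive_Reals, Du, Ht.
    - rewrite Rmin_left, Rmax_right in Ht by lra; rewrite E, Rminus_0_r, Rmult_1_r; auto. }
  assert (E1 : y + 1%R * (x - y) = x) by ring; assert (E0 : y + 0%R * (x - y) = y) by ring.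
  assert (M1 := MV _ _ (fun t Ht => proj1 (Hd t Ht))
    (fun t Ht => Rle_trans _ _ _ (re_le_Cmod _) (Hb t Ht))).
  assert (M2 := MV _ _ (fun t Ht => proj2 (Hd t Ht))
    (fun t Ht => Rle_trans _ _ _ (Rabs_Im_le_Cmod _) (Hb t Ht))).
  cbv beta in M1, M2; rewrite E1, E0 in M1, M2.
  eapply Rle_trans; [apply Cmod_le_Re_Im|].
  change (Re (h x - h y)) with (Re (h x) - Re (h y))%R; change (Im (h x - h y)) with (Im (h x) - Im (h y))%R.
  lra.
Qed.

(** With [A = f' a], the function [f z - A z] has derivative below [|A| / 4] near [a], hence
    Lipschitz constant [|A| / 2] by [holo_lipschitz]; [f x = f y] then gives
    [|A| |x - y| <= |A| |x - y| / 2]. *)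
Lemma local_inj (f : C -> C) (a : C) (r : R) : 0 < r -> holo f a r -> C_derive f a <> 0 ->
  exists d, 0 < d <= r /\ inj_on f a d.
Proof.
  intros Hr Hf Ha; set (A := C_derive f a) in *.
  assert (HA : 0 < Cmod A) by (apply Cmod_gt_0; auto).
  destruct (holo_C_derive f a r Hf a ltac:(rewrite Cmod_self; auto)) as [l Hl].
  apply cder_ccont in Hl; destruct (Hl (Cmod A / 4)%R) as (d0 & Hd0 & Hc); [lra|].
  set (d := Rmin d0 r); assert (Hd : d <= r) by apply Rmin_r; assert (Hdd : d <= d0) by apply Rmin_l.
  assert (Hdp : 0 < d) by (apply Rmin_pos; auto).
  exists d; split; auto; intros x y Hx Hy E.
  set (h := fun z => f z - A * z).
  assert (Dh : forall z, Cmod (z - a) < d -> cder h z (C_derive f z - A)).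
  { intros z Hz; apply (cder_minus f (fun z => A * z)); [apply (holo_cder f a z r Hf); lra|].
    apply (cder_eq _ z (A * 1)); [apply cder_scal, cder_id|ring]. }
  assert (L := holo_lipschitz h a x y d (Cmod A / 4) (fun z Hz => ex_intro _ _ (Dh z Hz))
    ltac:(intros z Hz; rewrite (C_derive_cder _ _ _ (Dh z Hz)); left; apply Hc; lra) Hx Hy).
  unfold h in L; rewrite E in L.
  replace (f y - A * x - (f y - A * y)) with (- (A * (x - y))) in L by ring.
  rewrite Cmod_opp, Cmod_mult in L.
  apply NNPP; intros n; apply Cmod_sub_gt_0 in n.
  assert (0 < Cmod A * Cmod (x - y)) by (apply Rmult_lt_0_compat; auto); lra.
Qed.

(** * The lemmas of Schwarz and Jack *)

Lemma Csub_0_r (z : C) : z - 0 = z.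
Proof. ring. Qed.

(** Division by [z] with the singularity filled in. Once, it serves Schwarz's lemma; twice, it gives
    the expansion [m z = 1 + k z + z^2 e z] behind Jack's lemma. *)
Definition slope0 (f : C -> C) (z : C) : C :=
  if Ceq_dec z 0 then C_derive f 0 else (f z - f 0) / z.

Lemma slope0_0 (f : C -> C) : slope0 f 0 = C_derive f 0.
Proof. unfold slope0; destruct (Ceq_dec 0 0); congruence. Qed.

Lemma slope0_eq (f : C -> C) (z : C) : f z = f 0 + z * slope0 f z.
Proof. unfold slope0; destruct (Ceq_dec z 0) as [->|n]; [ring|field; auto]. Qed.

Lemma holo_slope0 (f : C -> C) (r : R) : 0 < r -> holo f 0 r -> holo (slope0 f) 0 r.
Proof.
  intros Hr Hf.
  assert (Hd : forall z, Cmod (z - 0) < r -> z <> 0 -> exists l, cder (slope0 f) z l).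
  { intros z Hz n; destruct (Hf z Hz) as [l Hl]; eexists.
    apply (cder_ext_loc (fun y => (f y - f 0) / y) _ z _ (Cmod z)); [apply Cmod_gt_0; auto| |].
    - intros y Hy; unfold slope0; destruct (Ceq_dec y 0) as [->|m]; auto.
      rewrite Cmod_sub_sym, Csub_0_r in Hy; lra.
    - apply (cder_div (fun y => f y - f 0) (fun y => y)); [|apply cder_id|exact n].
      apply (cder_minus f (fun _ => f 0)); [exact Hl|apply cder_const]. }
  apply removable; auto; intros z Hz; destruct (Ceq_dec z 0) as [->|n].
  - assert (D := holo_cder f 0 0 r Hf Hz); apply cder_slope in D; destruct D as (s & Es & Cs & Fs).
    apply (ccont_ext_loc s _ 0 1); [lra| |exact Cs].
    intros y _; unfold slope0; destruct (Ceq_dec y 0) as [->|m]; [exact Es|].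
    rewrite (Fs y); field; auto.
  - destruct (Hd z Hz n) as [l Hl]; apply cder_ccont in Hl; exact Hl.
Qed.

(** The maximum principle for [w z / z] on the circle of radius [rho] gives [|w z| rho <= |z|], and
    [rho] tends to [r]. *)
Lemma Schwarz (w : C -> C) (r : R) : 0 < r -> holo w 0 r -> w 0 = 0 ->
  (forall z, Cmod z < r -> Cmod (w z) <= 1) ->
  forall z, Cmod z < r -> Cmod (w z) <= Cmod z / r.
Proof.
  intros Hr Hw H0 Hb z Hz.
  assert (Hs := holo_slope0 w r Hr Hw).
  assert (Hrho : forall rho, Cmod z < rho < r -> Cmod (w z) * rho <= Cmod z).
  { intros rho Hrho; assert (Hz0 := Cmod_ge_0 z).
    assert (M : Cmod (slope0 w z) <= / rho).
    { assert (Er : exp (ln rho) = rho) by (apply exp_ln; lra).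
      apply (max_modulus (slope0 w) r (ln rho)); rewrite ?Er; try lra.
      - intros y Hy; eapply holo_ccont; eauto; rewrite Csub_0_r; auto.
      - intros y Hy _; apply Hs; rewrite Csub_0_r; auto.
      - intros t _; set (y := cexp (ln rho, t)).
        assert (Hy : Cmod y = rho) by (unfold y; rewrite Cmod_circle; auto).
        assert (E := slope0_eq w y); rewrite H0, Cplus_0_l in E.
        apply (f_equal Cmod) in E; rewrite Cmod_mult, Hy in E.
        assert (By := Hb y ltac:(lra)); rewrite E in By.
        apply Rmult_le_reg_l with rho; [lra|]; rewrite Rinv_r; lra. }
    rewrite (slope0_eq w z), H0, Cplus_0_l, Cmod_mult.
    apply Rle_trans with (Cmod z * / rho * rho)%R.
    - apply Rmult_le_compat_r; [lra|]; apply Rmult_le_compat_l; auto.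
    - right; field; lra. }
  apply Rle_div_r; [exact Hr|].
  apply Rnot_lt_le; intros Hlt.
  assert (Hz0 := Cmod_ge_0 z); assert (Hw1 := Hb z Hz).
  assert (Hwp : 0 < Cmod (w z)) by (destruct (Cmod_ge_0 (w z)) as [|E]; [auto|rewrite <- E in Hlt; lra]).
  (* The radius halfway between [q] and [r] violates [Hrho]; it exceeds [|z|] because
     [|w z| <= 1]. *)
  set (q := (Cmod z / Cmod (w z))%R).
  assert (Hq : q < r).
  { apply Rmult_lt_reg_r with (Cmod (w z)); auto; unfold q, Rdiv.
    rewrite Rmult_assoc, Rinv_l; lra. }
  assert (Hqz : Cmod z <= q).
  { apply Rmult_le_reg_r with (Cmod (w z)); auto; unfold q, Rdiv.
    rewrite Rmult_assoc, Rinv_l by lra; nra. }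
  specialize (Hrho ((q + r) / 2)%R ltac:(lra)).
  assert (Eq : (Cmod (w z) * q = Cmod z)%R) by (unfold q; field; lra).
  nra.
Qed.

Lemma ccont_limit_le (G : C -> C) (u : C) (r : R) : Cmod u = 1%R -> 0 < r -> ccont G 0 ->
  (forall t : R, 0 < t < r -> Re (G (t * u)) <= 0) -> Re (G 0) <= 0.
Proof.
  intros Hu Hr HG H; apply le_epsilon; intros eps He; rewrite Rplus_0_l.
  destruct (HG eps He) as (d & Hd & F).
  set (t := (Rmin d r / 2)%R).
  assert (Hm : 0 < Rmin d r) by (apply Rmin_pos; auto).
  assert (Hl := Rmin_l d r); assert (Hr' := Rmin_r d r).
  specialize (H t ltac:(unfold t; lra)).
  specialize (F (t * u)); rewrite Csub_0_r, Cmod_mult, Cmod_R, Hu, Rabs_pos_eq in F by (unfold t; lra).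
  specialize (F ltac:(unfold t; lra)).
  assert (B := re_le_Cmod (G (t * u) - G 0)); apply Rabs_le_between in B.
  change (Re (G (t * u) - G 0)) with (Re (G (t * u)%C) - Re (G 0%C))%R in B; lra.
Qed.

Lemma Cmod_sqr (z : C) : (Cmod z * Cmod z = Re z * Re z + Im z * Im z)%R.
Proof. generalize (Cmod2_alt z); simpl; rewrite !Rmult_1_r; auto. Qed.

(** Jack's lemma at the boundary point [1], in the logarithmic coordinate: the modulus
    of [m] is maximal at [0] along the imaginary axis, which gives the sign conditions
    on the first two derivatives, and decays as in Schwarz's lemma along the negative
    real axis, which gives [1 <= Re m'(0)]. *)
Lemma Jack (m : C -> C) (r : R) : 0 < r -> holo m 0 r -> m 0 = 1 ->
  (forall z, Cmod z < r -> Re z < 0 -> Cmod (m z) <= exp (Re z)) ->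
  Im (C_derive m 0) = 0%R /\ 1 <= Re (C_derive m 0) /\
  Re (C_derive m 0) * Re (C_derive m 0) <= Re (C_derive (C_derive m) 0).
Proof.
  intros Hr Hm H1 Hb.
  set (f1 := slope0 m); assert (Hf1 : holo f1 0 r) by (apply holo_slope0; auto).
  set (e := slope0 f1); assert (He : holo e 0 r) by (apply holo_slope0; auto).
  set (k := C_derive m 0).
  assert (Ek : f1 0 = k) by apply slope0_0.
  assert (Em : forall z, m z = 1 + z * f1 z) by (intros z; rewrite <- H1; apply slope0_eq).
  assert (E1 : forall z, f1 z = k + z * e z) by (intros z; rewrite <- Ek; apply slope0_eq).
  assert (H00 : Cmod (0 - 0) < r) by (rewrite Csub_0_r, Cmod_0; auto).
  assert (Ce : ccont e 0) by (eapply holo_ccont; eauto).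
  assert (Cf : ccont f1 0) by (eapply holo_ccont; eauto).
  assert (E2 : C_derive (C_derive m) 0 = 2 * e 0).
  { apply C_derive_cder.
    apply (cder_ext_loc (fun z => f1 z + z * C_derive f1 z) _ 0 _ r Hr).
    - intros z Hz; symmetry; apply C_derive_cder.
      apply (cder_ext (fun z => 1 + z * f1 z)); [intros; symmetry; apply Em|].
      apply (cder_eq _ z (0 + (1 * f1 z + z * C_derive f1 z))); [|ring].
      apply (cder_plus (fun _ => 1)); [apply cder_const|].
      apply (cder_mult (fun y => y)); [apply cder_id|apply (holo_cder f1 0 z r); auto].
    - apply (cder_eq _ 0 (C_derive f1 0 + (1 * C_derive f1 0 + 0 * C_derive (C_derive f1) 0)));
        [|unfold e; rewrite slope0_0; ring].
      apply (cder_plus f1); [apply (holo_cder f1 0 0 r); auto|].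
      apply (cder_mult (fun y => y)); [apply cder_id|].
      apply (holo_cder _ 0 0 r); auto; apply holo_C_derive; auto. }
  (* Points of the imaginary axis are limits of points with negative real part, where [|m|] is below
     [1]. *)
  assert (Hci : forall t : R, Rabs t < r -> Cmod (m (t * Ci)) <= 1).
  { intros t Ht; apply Rnot_lt_le; intros Hgt.
    assert (Hti : Cmod (t * Ci) = Rabs t) by (rewrite Cmod_mult, Cmod_Ci, Cmod_R; ring).
    assert (Cm : ccont m (t * Ci)) by (eapply holo_ccont; eauto; rewrite Csub_0_r; lra).
    destruct (Cm (Cmod (m (t * Ci)%C) - 1)%R) as (d & Hd & F); [lra|].
    set (s := (Rmin d (r - Rabs t) / 2)%R).
    assert (Hs0 : 0 < Rmin d (r - Rabs t)) by (apply Rmin_pos; lra).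
    assert (Hs1 := Rmin_l d (r - Rabs t)); assert (Hs2 := Rmin_r d (r - Rabs t)).
    assert (Hs : Cmod (- RtoC s) = s) by (rewrite Cmod_opp, Cmod_R, Rabs_pos_eq; unfold s; lra).
    specialize (F (t * Ci + - RtoC s)).
    rewrite Cmod_translate, Hs in F; specialize (F ltac:(unfold s; lra)).
    assert (B := Hb (t * Ci + - RtoC s)).
    assert (Er : Re (t * Ci + - RtoC s) = (- s)%R) by (simpl; ring).
    rewrite Er in B.
    assert (Hexp : exp (- s) < 1) by (rewrite <- exp_0; apply exp_increasing; unfold s; lra).
    assert (T := Cmod_triangle (t * Ci) (- RtoC s)); rewrite Hti, Hs in T.
    specialize (B ltac:(unfold s in *; lra) ltac:(unfold s; lra)).
    rewrite Cmod_sub_sym in F.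
    assert (T' := Cmod_rev_triangle (m (t * Ci)) (m (t * Ci + - RtoC s))); lra. }
  (* With [f1 (it) = p + iq], [|m (it)|^2 = (1 - t q)^2 + (t p)^2] *)
  assert (Hax : forall t : R, Rabs t < r ->
    let p := Re (f1 (t * Ci)) in let q := Im (f1 (t * Ci)) in t * (t * (p * p + q * q) - 2 * q) <= 0).
  { intros t Ht p q; assert (B := Hci t Ht); rewrite Em in B.
    assert (B2 : Cmod (1 + t * Ci * f1 (t * Ci)) * Cmod (1 + t * Ci * f1 (t * Ci)) <= 1).
    { assert (B0 := Cmod_ge_0 (1 + t * Ci * f1 (t * Ci))); nra. }
    rewrite Cmod_sqr in B2.
    assert (R1 : Re (1 + t * Ci * f1 (t * Ci)) = (1 - t * q)%R) by (unfold q; simpl; unfold Im; ring).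
    assert (R2 : Im (1 + t * Ci * f1 (t * Ci)) = (t * p)%R) by (unfold p; simpl; unfold Re; ring).
    rewrite R1, R2 in B2; nra. }
  (* Dividing [Hax] by [t] and letting [t] tend to [0] from either side gives the two inequalities;
     multiplying [f1] by [Ci] or [- Ci] turns its imaginary part into a real part. *)
  assert (Hk2 : Im k = 0%R).
  { apply Rle_antisym.
    - assert (L := ccont_limit_le (fun z => - Ci * f1 z) (- Ci) r
        ltac:(rewrite Cmod_opp; apply Cmod_Ci) Hr
        ltac:(apply (ccont_mult (fun _ => - Ci)); [apply ccont_const|exact Cf])).
      cbv beta in L; rewrite Ek in L.
      replace (Re (- Ci * k)) with (Im k) in L by (destruct k; simpl; ring).
      apply L; intros t Ht.
      assert (A := Hax (- t)%R ltac:(rewrite Rabs_Ropp, Rabs_pos_eq; lra)); cbv zeta in A.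
      replace (t * - Ci) with ((- t)%R * Ci) by (rewrite RtoC_opp; ring).
      replace (Re (- Ci * f1 ((- t)%R * Ci))) with (Im (f1 ((- t)%R * Ci)))
        by (generalize (f1 ((- t)%R * Ci)); intros [a b]; simpl; ring).
      assert (0 <= Re (f1 ((- t)%R * Ci)) * Re (f1 ((- t)%R * Ci))
                   + Im (f1 ((- t)%R * Ci)) * Im (f1 ((- t)%R * Ci))) by nra.
      nra.
    - assert (L := ccont_limit_le (fun z => Ci * f1 z) Ci r Cmod_Ci Hr
        ltac:(apply (ccont_mult (fun _ => Ci)); [apply ccont_const|exact Cf])).
      cbv beta in L; rewrite Ek in L.
      replace (Re (Ci * k)) with (- Im k)%R in L by (destruct k; simpl; ring).
      enough (- Im k <= 0) by lra; apply L; intros t Ht.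
      assert (A := Hax t ltac:(rewrite Rabs_pos_eq; lra)); cbv zeta in A.
      replace (Re (Ci * f1 (t * Ci))) with (- Im (f1 (t * Ci)%C))%R
        by (generalize (f1 (t * Ci)); intros [a b]; simpl; ring).
      assert (0 <= Re (f1 (t * Ci)) * Re (f1 (t * Ci)) + Im (f1 (t * Ci)) * Im (f1 (t * Ci))) by nra.
      nra. }
  assert (Hk1 : 1 <= Re k).
  (* With [p = Re (f1 (- t))], the hypothesis reads [1 - t p <= exp (- t) <= 1 / (1 + t)]; clearing
     the denominator and dividing by [t] leaves [1 - p (1 + t) <= 0], the real part of this function
     at [- t]. *)
  { assert (L := ccont_limit_le (fun z => 1 + - (f1 z * (1 + - z))) (- (1)) r
      ltac:(apply Cmod_m1) Hr).
    cbv beta in L; rewrite Ek in L.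
    replace (Re (1 + - (k * (1 + - 0)))) with (1 - Re k)%R in L by (destruct k; simpl; ring).
    enough (1 - Re k <= 0) by lra; apply L.
    - apply (ccont_ext_loc (fun z => 1 + - (1) * (f1 z * (1 + - (1) * z))) _ 0 1); [lra|intros; ring|].
      apply (ccont_plus (fun _ => 1)); [apply ccont_const|].
      apply (ccont_mult (fun _ => - (1))); [apply ccont_const|].
      apply (ccont_mult f1); auto.
      apply (ccont_plus (fun _ => 1)); [apply ccont_const|].
      apply (ccont_mult (fun _ => - (1))); [apply ccont_const|apply ccont_id].
    - intros t Ht; replace (t * - (1)) with (- RtoC t) by ring.
      assert (B := Hb (- RtoC t)); rewrite Cmod_opp, Cmod_R, Rabs_pos_eq in B by lra.
      replace (Re (- RtoC t)) with (- t)%R in B by reflexivity.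
      specialize (B ltac:(lra) ltac:(lra)).
      assert (B' := re_le_Cmod (m (- RtoC t))); apply Rabs_le_between in B'.
      assert (Rm : Re (m (- RtoC t)) = (1 - t * Re (f1 (- RtoC t)%C))%R)
        by (rewrite Em; generalize (f1 (- RtoC t)); intros [a b]; simpl; ring).
      replace (Re (1 + - (f1 (- RtoC t) * (1 + - - RtoC t)))) with (1 - Re (f1 (- RtoC t)%C) * (1 + t))%R
        by (generalize (f1 (- RtoC t)); intros [a b]; simpl; ring).
      set (p := Re (f1 (- RtoC t))) in *.
      assert (X : exp (- t) * (1 + t) <= 1).
      { replace 1%R with (exp (- t) * exp t)%R at 2 by (rewrite <- exp_plus, <- exp_0; f_equal; ring).
        apply Rmult_le_compat_l; [left; apply exp_pos|left; apply exp_ineq1; lra]. }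
      assert (Y : (1 - t * p) * (1 + t) <= exp (- t) * (1 + t)) by (apply Rmult_le_compat_r; lra).
      assert (t * (1 - p * (1 + t)) <= 0) by nra.
      nra. }
  split; auto; split; auto.
  rewrite E2.
  (* As [k] is real, [q = t c] with [c = Re (e (it))], and [Hax] divided by [t^2] gives
     [p^2 + q^2 <= 2 c]. The weaker [p^2 - q^2 <= 2 c] is about the real part of a continuous
     function, whose value at [0] yields the claim. *)
  assert (L := ccont_limit_le (fun z => f1 z * f1 z + - (2) * e z) Ci r Cmod_Ci Hr
    ltac:(apply (ccont_plus (fun z => f1 z * f1 z)); [apply ccont_mult; auto|
          apply (ccont_mult (fun _ => - (2))); [apply ccont_const|exact Ce]])).
  cbv beta in L; rewrite Ek in L.
  replace (Re (k * k + - (2) * e 0)) with (Re k * Re k - Re (2 * e 0)%C)%R in L.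
  2:{ generalize (e 0); revert Hk2; generalize k; intros [a b] Hb0 [c d]; simpl in *; rewrite Hb0; ring. }
  enough (Re k * Re k - Re (2 * e 0) <= 0) by lra; apply L; intros t Ht.
  assert (A := Hax t ltac:(rewrite Rabs_pos_eq; lra)); cbv zeta in A.
  assert (Q : Im (f1 (t * Ci)) = (t * Re (e (t * Ci)%C))%R).
  { rewrite E1; revert Hk2; generalize k (e (t * Ci)); intros [a b] [c d]; simpl; intros ->; ring. }
  replace (Re (f1 (t * Ci) * f1 (t * Ci) + - (2) * e (t * Ci)))
    with (Re (f1 (t * Ci)%C) * Re (f1 (t * Ci)%C) - Im (f1 (t * Ci)%C) * Im (f1 (t * Ci)%C)
          - 2 * Re (e (t * Ci)%C))%R
    by (generalize (f1 (t * Ci)) (e (t * Ci)); intros [a b] [c d]; simpl; ring).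
  revert A Q; generalize (Re (f1 (t * Ci))) (Im (f1 (t * Ci))) (Re (e (t * Ci))); intros p q c A Q.
  assert (A' : t * t * (p * p + q * q - 2 * c) <= 0) by (rewrite Q in A at 2; nra).
  assert (0 < t * t) by nra.
  nra.
Qed.

(** * First contact with the boundary *)

Lemma analytic_in_disk_holo (f : C -> C) : analytic_in_disk f <-> holo f 0 1.
Proof.
  split.
  - intros H z Hz; apply ex_derive_cder, H; rewrite Csub_0_r in Hz; exact Hz.
  - intros H z Hz; apply ex_derive_cder, H; rewrite Csub_0_r; exact Hz.
Qed.

Lemma analytic_at_holo (f : C -> C) (z : C) :
  analytic_at f z -> exists r, 0 < r /\ holo f z r.
Proof.
  intros H; apply locally_Cmod in H; destruct H as (d & Hd & F).
  exists d; split; auto; intros y Hy; apply ex_derive_cder, F, Hy.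
Qed.

(** The preimages are chosen pointwise; injectivity makes the choice agree near each point with
    [g (p y)] for a local inverse [g] of [q]. *)
Lemma holo_lift (p q : C -> C) (r : R) : holo q 0 1 -> inj_on q 0 1 -> holo p 0 r ->
  (forall z, Cmod z < r -> exists x, Cmod x < 1 /\ q x = p z) ->
  exists w, holo w 0 r /\ forall z, Cmod z < r -> Cmod (w z) < 1 /\ q (w z) = p z.
Proof.
  intros Hq Hi Hp Hex.
  assert (Hw : forall z, exists x, Cmod z < r -> Cmod x < 1 /\ q x = p z).
  { intros z; destruct (classic (Cmod z < r)) as [Hz|Hz]; [|exists 0; tauto].
    destruct (Hex z Hz) as [x Hx]; exists x; auto. }
  set (w := fun z => proj1_sig (constructive_indefinite_description _ (Hw z))).
  assert (Wz : forall z, Cmod z < r -> Cmod (w z) < 1 /\ q (w z) = p z)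
    by (intros z; unfold w; apply proj2_sig).
  clearbody w; exists w; split; auto; intros z Hz.
  assert (Hz' := Hz); rewrite Csub_0_r in Hz'.
  destruct (Wz z Hz') as [W1 W2].
  set (s := (1 - Cmod (w z))%R); assert (Hs : 0 < s) by (unfold s; lra).
  assert (Hle : Cmod (w z - 0) + s <= 1) by (rewrite Csub_0_r; unfold s; lra).
  destruct (inj_inverse q (w z) s Hs (holo_subdisk q 0 _ 1 s Hq Hle)
    (inj_on_subdisk q 0 _ 1 s Hi Hle)) as (d & g & Hd & Hg).
  destruct (Hp z Hz) as [l Hl].
  destruct (cder_ccont _ _ _ Hl d Hd) as (e & He & F).
  destruct (Hg (p z)) as (_ & _ & lg & Hlg); [rewrite W2, Cmod_self; auto|].
  exists (lg * l).
  apply (cder_ext_loc (fun y => g (p y)) w z _ (Rmin e (r - Cmod z))).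
  - apply Rmin_pos; lra.
  - intros y Hy.
    assert (Y1 : Cmod (y - z) < e) by (eapply Rlt_le_trans; [exact Hy|apply Rmin_l]).
    assert (Y2 : Cmod (y - z) < r - Cmod z) by (eapply Rlt_le_trans; [exact Hy|apply Rmin_r]).
    assert (Y3 : Cmod y < r) by (generalize (Cmod_rev_triangle y z); lra).
    destruct (Wz y Y3) as [V1 V2].
    destruct (Hg (p y)) as (G1 & G2 & _); [rewrite W2; apply F; auto|].
    apply Hi; rewrite ?Csub_0_r; auto; [|congruence].
    generalize (Cmod_rev_triangle (g (p y)) (w z)); unfold s in G1; lra.
  - apply (cder_comp g p); auto.
Qed.

(** A sequence of points of [S] with modulus tending to the infimum has a cluster point. Closedness
    is asked only for [|z| <= |z1|], since the set of the application is closed relative to the open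
    disk. *)
Lemma closest_point (S : C -> Prop) (z1 : C) : S z1 ->
  (forall z, Cmod z <= Cmod z1 ->
     (forall eps, 0 < eps -> exists y, S y /\ Cmod (y - z) < eps) -> S z) ->
  exists z0, S z0 /\ Cmod z0 <= Cmod z1 /\ forall z, S z -> Cmod z0 <= Cmod z.
Proof.
  intros H1 Hcl.
  (* The infimum of the moduli is [- b], obtained as a supremum of opposites. *)
  destruct (completeness (fun t => exists z, S z /\ t = (- Cmod z)%R)) as [b [Hb1 Hb2]].
  - exists 0%R; intros t (z & _ & ->); generalize (Cmod_ge_0 z); lra.
  - exists (- Cmod z1)%R, z1; auto.
  - assert (Hlow : forall z, S z -> - b <= Cmod z).
    { intros z Hz; specialize (Hb1 (- Cmod z)%R ltac:(exists z; auto)); lra. }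
    assert (Hn : forall n : nat, exists z, S z /\ Cmod z < - b + / (INR n + 1)).
    { intros n; apply NNPP; intros Hno.
      assert (Hp : 0 < / (INR n + 1)) by (apply Rinv_0_lt_compat; generalize (pos_INR n); lra).
      specialize (Hb2 (b - / (INR n + 1))%R); assert (b <= b - / (INR n + 1)); [|lra].
      apply Hb2; intros t (z & Hz & ->).
      apply Rnot_lt_le; intros Hlt; apply Hno; exists z; split; auto; lra. }
    set (u := fun n => proj1_sig (constructive_indefinite_description _ (Hn n))).
    assert (Hu : forall n, S (u n) /\ Cmod (u n) < - b + / (INR n + 1))
      by (intros n; unfold u; apply (proj2_sig (constructive_indefinite_description _ (Hn n)))).
    clearbody u.
    destruct (bounded_seq_cluster u (- b + 1)) as [z0 Hz0].
    { intros n; destruct (Hu n) as [_ U].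
      assert (/ (INR n + 1) <= 1); [|lra].
      rewrite <- Rinv_1 at 2; apply Rinv_le_contravar; [lra|generalize (pos_INR n); lra]. }
    assert (Hz0b : Cmod z0 <= - b).
    { apply le_epsilon; intros eps He.
      destruct (INR_unbounded (2 / eps)) as [N HN].
      destruct (Hz0 (eps / 2)%R N) as (n & Hn1 & Hn2); [lra|].
      destruct (Hu n) as [_ U].
      assert (HNn := le_INR _ _ Hn1).
      assert (/ (INR n + 1) <= eps / 2).
      { replace (eps / 2)%R with (/ (2 / eps))%R by (field; lra).
        apply Rinv_le_contravar; [apply Rdiv_lt_0_compat; lra|lra]. }
      rewrite Cmod_sub_sym in Hn2; generalize (Cmod_rev_triangle z0 (u n)); lra. }
    assert (Hz1 := Hlow z1 H1).
    exists z0; split; [|split; [lra|intros z Hz; generalize (Hlow z Hz); lra]].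
    apply Hcl; [lra|]; intros eps He; destruct (Hz0 eps 0%nat He) as (n & _ & Hn2).
    exists (u n); split; auto; apply Hu.
Qed.

Lemma disk_not_Eset (q : C -> C) (z : C) : Cmod z < 1 -> ~ Eset q z.
Proof. intros Hz [H _]; unfold unit_circle in H; lra. Qed.

Lemma class_Q_inj_on (q : C -> C) : class_Q q -> inj_on q 0 1.
Proof.
  intros (_ & Hi & _) x y Hx Hy; rewrite Csub_0_r in Hx, Hy.
  apply Hi; try (apply disk_not_Eset; auto); unfold closed_unit_disk; lra.
Qed.

(** Here [zeta] is a cluster value of [w] at [z0]. Inside the disk it would give [q zeta = p z0], a
    value that [q] omits there; in [E(q)] it would make [p = q o w] unbounded near [z0]. At the
    remaining points [q] is continuous. *)
Lemma boundary_value (p q w : C -> C) (z0 zeta : C) (r0 : R) :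
  class_Q q -> holo q 0 1 -> ccont p z0 -> (forall x, Cmod x < 1 -> q x <> p z0) ->
  (forall z, Cmod z < r0 -> Cmod (w z) < 1 /\ q (w z) = p z) ->
  (forall eps, 0 < eps -> exists z, Cmod z < r0 /\ Cmod (z - z0) < eps /\ Cmod (w z - zeta) < eps) ->
  unit_circle zeta /\ ~ Eset q zeta /\ q zeta = p z0.
Proof.
  intros (Qa & _ & _) Hq Hp Hno Hw Hcl.
  assert (Hlim : ccont q zeta -> q zeta = p z0).
  { intros Cq; apply Ceq_of_approx; intros eps He.
    destruct (Cq (eps / 2)%R) as (d1 & H1 & F1); [lra|].
    destruct (Hp (eps / 2)%R) as (d2 & H2 & F2); [lra|].
    destruct (Hcl (Rmin d1 d2)) as (z & Z1 & Z2 & Z3); [apply Rmin_pos; auto|].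
    assert (A1 := F1 (w z) ltac:(eapply Rlt_le_trans; [exact Z3|apply Rmin_l])).
    assert (A2 := F2 z ltac:(eapply Rlt_le_trans; [exact Z2|apply Rmin_r])).
    rewrite (proj2 (Hw z Z1)), Cmod_sub_sym in A1.
    generalize (Cmod_sub_triangle (q zeta) (p z) (p z0)); lra. }
  assert (Hle : Cmod zeta <= 1).
  { apply le_epsilon; intros eps He; destruct (Hcl eps He) as (z & Z1 & _ & Z3).
    rewrite Cmod_sub_sym in Z3; generalize (Cmod_rev_triangle zeta (w z)).
    destruct (Hw z Z1); lra. }
  assert (Hone : Cmod zeta = 1%R).
  { destruct Hle as [Hlt|]; auto; exfalso; apply (Hno zeta Hlt), Hlim.
    apply (holo_ccont q 0 zeta 1); auto; rewrite Csub_0_r; auto. }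
  assert (HnE : ~ Eset q zeta).
  { intros [_ HE].
    assert (Hbig : Rbar_locally p_infty (fun t => Cmod (p z0) + 1 < t)) by (exists (Cmod (p z0) + 1)%R; auto).
    apply HE in Hbig; unfold filtermap, within in Hbig.
    apply locally_Cmod in Hbig; destruct Hbig as (d1 & H1 & F1).
    destruct (Hp 1%R Rlt_0_1) as (d2 & H2 & F2).
    destruct (Hcl (Rmin d1 d2)) as (z & Z1 & Z2 & Z3); [apply Rmin_pos; auto|].
    destruct (Hw z Z1) as [W1 W2].
    assert (A1 := F1 (w z) ltac:(eapply Rlt_le_trans; [exact Z3|apply Rmin_l]) W1).
    assert (A2 := F2 z ltac:(eapply Rlt_le_trans; [exact Z2|apply Rmin_r])).
    rewrite W2 in A1; generalize (Cmod_rev_triangle (p z) (p z0)); lra. }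
  split; auto; split; auto; apply Hlim.
  destruct (analytic_at_holo q zeta (Qa zeta Hle HnE)) as (r & Hr & Hh).
  apply (holo_ccont q zeta zeta r); auto; rewrite Cmod_self; auto.
Qed.

Lemma seq_inv_lt (eps : R) : 0 < eps -> exists N, forall n, (N <= n)%nat -> / (INR n + 1) < eps.
Proof.
  intros He; destruct (INR_unbounded (/ eps)) as [N HN]; exists N; intros n Hn.
  assert (HNn := le_INR _ _ Hn); rewrite <- (Rinv_inv eps).
  assert (0 < / eps) by (apply Rinv_0_lt_compat; auto).
  apply Rinv_lt_contravar; [apply Rmult_lt_0_compat|]; lra.
Qed.

(** All cluster values of [w] at [z0] have the same image [p z0], so they coincide by injectivity of
    [q] up to the boundary; a bounded function with a single cluster value converges. *)
Lemma boundary_limit (p q w : C -> C) (z0 : C) (r0 : R) :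
  class_Q q -> holo q 0 1 -> ccont p z0 -> (forall x, Cmod x < 1 -> q x <> p z0) ->
  0 < r0 -> Cmod z0 = r0 -> (forall z, Cmod z < r0 -> Cmod (w z) < 1 /\ q (w z) = p z) ->
  exists zeta, unit_circle zeta /\ ~ Eset q zeta /\ q zeta = p z0 /\
    forall eps, 0 < eps -> exists d, 0 < d /\
      forall z, Cmod z < r0 -> Cmod (z - z0) < d -> Cmod (w z - zeta) < eps.
Proof.
  intros HQ Hq Hp Hno Hr0 Hz0 Hw.
  assert (Hseq : forall u : nat -> C, (forall n, Cmod (u n) < r0) ->
    (forall eps, 0 < eps -> exists N, forall n, (N <= n)%nat -> Cmod (u n - z0) < eps) ->
    exists zeta, (unit_circle zeta /\ ~ Eset q zeta /\ q zeta = p z0) /\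
      forall eps, 0 < eps -> exists n, Cmod (w (u n) - zeta) < eps).
  { intros u Hu Hlim; destruct (bounded_seq_cluster (fun n => w (u n)) 1) as [zeta Hzeta].
    - intros n; left; apply Hw; auto.
    - exists zeta; split.
      + apply (boundary_value p q w z0 zeta r0); auto; intros eps He.
        destruct (Hlim eps He) as [N HN]; destruct (Hzeta eps N He) as (n & N1 & N2).
        exists (u n); auto.
      + intros eps He; destruct (Hzeta eps 0%nat He) as (n & _ & Hn); exists n; auto. }
  (* A radial approach to [z0] supplies the candidate for the limit. *)
  destruct (Hseq (fun n => (1 - / (INR n + 1))%R * z0)) as (zeta & (Z1 & Z2 & Z3) & _).
  - intros n; assert (Hn := pos_INR n).
    assert (Hp1 : 0 < / (INR n + 1)) by (apply Rinv_0_lt_compat; lra).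
    assert (Hp2 : / (INR n + 1) <= 1) by (rewrite <- Rinv_1; apply Rinv_le_contravar; lra).
    rewrite Cmod_mult, Cmod_R, Rabs_pos_eq, Hz0 by lra; nra.
  - intros eps He; destruct (seq_inv_lt (eps / r0)) as [N HN]; [apply Rdiv_lt_0_compat; auto|].
    exists N; intros n Hn; specialize (HN n Hn); assert (Hn0 := pos_INR n).
    assert (Hp1 : 0 < / (INR n + 1)) by (apply Rinv_0_lt_compat; lra).
    replace ((1 - / (INR n + 1))%R * z0 - z0) with (- ((/ (INR n + 1))%R * z0)) by (rewrite RtoC_minus; ring).
    rewrite Cmod_opp, Cmod_mult, Cmod_R, Rabs_pos_eq, Hz0 by lra.
    apply Rmult_lt_compat_r with (r := r0) in HN; auto.
    replace (eps / r0 * r0)%R with eps in HN by (field; lra); exact HN.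
  - exists zeta; split; auto; split; auto; split; auto.
    intros eps He; apply NNPP; intros Hbad.
    assert (Hv : forall n : nat, exists z, Cmod z < r0 /\ Cmod (z - z0) < / (INR n + 1)
      /\ eps <= Cmod (w z - zeta)).
    { intros n; apply NNPP; intros H1; apply Hbad.
      exists (/ (INR n + 1))%R; split; [apply Rinv_0_lt_compat; generalize (pos_INR n); lra|].
      intros z Hz Hzz; apply Rnot_le_lt; intros H2; apply H1; exists z; auto. }
    set (u := fun n => proj1_sig (constructive_indefinite_description _ (Hv n))).
    assert (Hu : forall n, Cmod (u n) < r0 /\ Cmod (u n - z0) < / (INR n + 1)
      /\ eps <= Cmod (w (u n) - zeta))
      by (intros n; unfold u; apply (proj2_sig (constructive_indefinite_description _ (Hv n)))).
    clearbody u.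
    destruct (Hseq u) as (zeta' & (Z1' & Z2' & Z3') & Hn).
    + intros n; apply Hu.
    + intros e He'; destruct (seq_inv_lt e He') as [N HN]; exists N; intros n Hn.
      eapply Rlt_trans; [apply Hu|auto].
    + assert (E : zeta' = zeta).
      { destruct HQ as (_ & Hi & _); apply Hi; auto; try congruence;
          unfold closed_unit_disk; rewrite ?Z1, ?Z1'; lra. }
      subst zeta'; destruct (Hn eps He) as [n Hn']; destruct (Hu n) as (_ & _ & U); lra.
Qed.

Lemma Miller_Mocanu (p q : C -> C) : class_Q q -> holo q 0 1 -> holo p 0 1 -> p 0 = q 0 ->
  subordinate p q \/
  exists (z zeta : C) (k : R), unit_disk z /\ unit_circle zeta /\ ~ Eset q zeta /\ 1 <= k /\
    z <> 0 /\ p z = q zeta /\ C_derive p z <> 0 /\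
    z * C_derive p z = k * zeta * C_derive q zeta /\
    (Re (z * C_derive (C_derive p) z / C_derive p z + 1) >=
     k * Re (zeta * C_derive (C_derive q) zeta / C_derive q zeta + 1))%R.
Proof.
  intros HQ Hq Hp H0.
  assert (Hi := class_Q_inj_on q HQ).
  assert (C0 : Cmod 0 < 1) by (rewrite Cmod_0; lra).
  destruct (classic (forall z, Cmod z < 1 -> exists x, Cmod x < 1 /\ q x = p z)) as [Hall|Hnot].
  { left; destruct (holo_lift p q 1 Hq Hi Hp Hall) as (w & Hwh & Hw).
    exists w; split; [apply analytic_in_disk_holo; auto|].
    split; [|split; intros z Hz; [apply Hw; auto|symmetry; apply Hw; auto]].
    destruct (Hw 0 C0) as [W1 W2]; apply Hi; rewrite ?Csub_0_r; auto; congruence. }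
  right.
  set (S := fun z => Cmod z < 1 /\ ~ exists x, Cmod x < 1 /\ q x = p z).
  assert (H1 : exists z1, S z1).
  { apply NNPP; intros Hno; apply Hnot; intros z Hz; apply NNPP; intros Hz2.
    apply Hno; exists z; split; auto. }
  destruct H1 as [z1 Hz1].
  destruct (closest_point S z1 Hz1) as (z0 & [Hz0 Hz0q] & _ & Hmin).
  (* If [p z] were in [q (D)], so would be all values of [p] near [z], because [q] is open. *)
  { intros z Hz Happ; split; [destruct Hz1; lra|]; intros (x & Hx & Ex).
    assert (Hz' : Cmod z < 1) by (destruct Hz1; lra).
    set (s := (1 - Cmod x)%R); assert (Hs : 0 < s) by (unfold s; lra).
    assert (Hle : Cmod (x - 0) + s <= 1) by (rewrite Csub_0_r; unfold s; lra).
    destruct (inj_open q x s Hs (holo_subdisk q 0 _ 1 s Hq Hle)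
      (inj_on_subdisk q 0 _ 1 s Hi Hle)) as (d & Hd & Ho).
    assert (Cp : ccont p z) by (apply (holo_ccont p 0 z 1); auto; rewrite Csub_0_r; auto).
    destruct (Cp d Hd) as (e & He & F); destruct (Happ e He) as (y & [Y1 Y2] & Hy).
    apply Y2; destruct (Ho (p y)) as (x' & X1 & X2); [rewrite Ex; auto|].
    exists x'; split; auto; generalize (Cmod_rev_triangle x' x); unfold s in X1; lra. }
  clear z1 Hz1; set (r0 := Cmod z0).
  assert (Hno : forall x, Cmod x < 1 -> q x <> p z0) by (intros x Hx E; apply Hz0q; exists x; auto).
  assert (Hzn : z0 <> 0).
  { intros ->; apply (Hno 0 C0); auto. }
  assert (Hr0 : 0 < r0) by (apply Cmod_gt_0; auto).
  destruct (holo_lift p q r0 Hq Hi (holo_subdisk p 0 0 1 r0 Hp ltac:(rewrite Cmod_self; unfold r0; lra)))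
    as (w & Hwh & Hw).
  { intros z Hz; apply NNPP; intros Hn.
    assert (Sz : S z) by (split; auto; unfold r0 in Hz; lra).
    specialize (Hmin z Sz); unfold r0 in Hz; lra. }
  assert (Hw0 : w 0 = 0).
  { destruct (Hw 0) as [W1 W2]; [rewrite Cmod_0; auto|].
    apply Hi; rewrite ?Csub_0_r; auto; congruence. }
  assert (HS := Schwarz w r0 Hr0 Hwh Hw0 (fun z Hz => Rlt_le _ _ (proj1 (Hw z Hz)))).
  assert (Cp : ccont p z0) by (apply (holo_ccont p 0 z0 1); auto; rewrite Csub_0_r; auto).
  destruct (boundary_limit p q w z0 r0 HQ Hq Cp Hno Hr0 eq_refl Hw)
    as (zeta & Z1 & Z2 & Z3 & Hlim).
  assert (Hzc : Cmod zeta = 1%R) by exact Z1.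
  assert (Hzeta : zeta <> 0) by (apply Cmod_gt_0; lra).
  assert (HQ' := HQ); destruct HQ' as (Qa & _ & Qd).
  destruct (analytic_at_holo q zeta) as (rho & Hrho & Hqz);
    [apply Qa; auto; unfold closed_unit_disk; lra|].
  assert (Q1 := Qd zeta Z1 Z2).
  destruct (local_inj q zeta rho Hrho Hqz Q1) as (d & Hd & Hid).
  assert (Hqd : holo q zeta d) by (apply (holo_subdisk q zeta zeta rho); auto; rewrite Cmod_self; lra).
  destruct (inj_inverse q zeta d ltac:(lra) Hqd Hid) as (eta & g & Heta & Hg).
  destruct (Hlim d ltac:(lra)) as (del & Hdel & Hwlim).
  destruct (Cp eta Heta) as (del' & Hdel' & Hpeta).
  (* The half-plane [Re s < 0] corresponds to [|z| < r0], where [w] is defined. *)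
  set (Z := fun s => z0 * cexp s).
  assert (DZ : forall s, cder Z s (Z s)) by (intros s; apply cder_scal, cder_cexp).
  assert (Z0 : Z 0 = z0) by (unfold Z; rewrite cexp_0; ring).
  assert (HZ : exists r, 0 < r /\ forall s, Cmod s < r ->
    Cmod (Z s) < 1 /\ Cmod (Z s - z0) < del /\ Cmod (p (Z s) - q zeta) < eta).
  { destruct (cder_ccont _ _ _ (DZ 0) (Rmin (1 - r0) (Rmin del del'))) as (r & Hr & F).
    - apply Rmin_pos; [unfold r0; lra|apply Rmin_pos; auto].
    - exists r; split; auto; intros s Hs; specialize (F s); rewrite Csub_0_r, Z0 in F.
      specialize (F Hs).
      assert (F1 : Cmod (Z s - z0) < 1 - r0) by (eapply Rlt_le_trans; [exact F|apply Rmin_l]).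
      assert (F2 : Cmod (Z s - z0) < del)
        by (eapply Rlt_le_trans; [exact F|eapply Rle_trans; [apply Rmin_r|apply Rmin_l]]).
      assert (F3 : Cmod (Z s - z0) < del')
        by (eapply Rlt_le_trans; [exact F|eapply Rle_trans; [apply Rmin_r|apply Rmin_r]]).
      split; [generalize (Cmod_rev_triangle (Z s) z0); unfold r0 in *; lra|].
      split; auto; rewrite Z3; auto. }
  destruct HZ as (r & Hr & HZ).
  (* The continuation of [w (Z s) / zeta] to a full neighbourhood of [s = 0], normalized to
     [m 0 = 1]. *)
  set (m := fun s => / zeta * g (p (Z s))).
  assert (Hzm : forall s, zeta * m s = g (p (Z s))) by (intros s; unfold m; field; auto).
  assert (Dp : forall s, Cmod s < r -> cder p (Z s) (C_derive p (Z s))).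
  { intros s Hs; apply (holo_cder p 0 _ 1); auto; rewrite Csub_0_r; apply HZ; auto. }
  assert (Hm : holo m 0 r).
  { intros s Hs; rewrite Csub_0_r in Hs; destruct (HZ s Hs) as (_ & _ & K3).
    destruct (Hg _ K3) as (_ & _ & l & Hl); eexists.
    apply cder_scal, (cder_comp g (fun s => p (Z s))); [|exact Hl].
    apply (cder_comp p Z); [apply DZ|apply Dp; auto]. }
  assert (C0r : Cmod 0 < r) by (rewrite Cmod_0; auto).
  assert (Hgz : g (p z0) = zeta).
  { destruct (Hg (p z0)) as (G1 & G2 & _); [rewrite Z3, Cmod_self; auto|].
    apply Hid; auto; [rewrite Cmod_self; lra|congruence]. }
  assert (Hm0 : m 0 = 1) by (unfold m; rewrite Z0, Hgz; field; auto).
  assert (HJ : forall s, Cmod s < r -> Re s < 0 -> Cmod (m s) <= exp (Re s)).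
  { intros s Hs Hneg; destruct (HZ s Hs) as (_ & K2 & K3).
    assert (Hmod : Cmod (Z s) = (r0 * exp (Re s))%R) by (unfold Z; rewrite Cmod_mult, Cmod_cexp; auto).
    assert (Hexp : exp (Re s) < 1) by (rewrite <- exp_0; apply exp_increasing; auto).
    assert (Hlt : Cmod (Z s) < r0) by (rewrite Hmod; nra).
    destruct (Hg _ K3) as (G1 & G2 & _); destruct (Hw _ Hlt) as [W1 W2].
    (* Both are preimages of [p (Z s)] in the disk around [zeta] where [q] is injective; [w (Z s)]
       lies there because [w] tends to [zeta]. *)
    assert (E : g (p (Z s)) = w (Z s)) by (apply Hid; auto; congruence).
    unfold m; rewrite E, Cmod_mult, Cmod_inv, Hzc, Rinv_1, Rmult_1_l by auto.
    eapply Rle_trans; [apply HS; auto|]; rewrite Hmod; right; field; lra. }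
  destruct (Jack m r Hr Hm Hm0 HJ) as (J1 & J2 & J3).
  set (k := Re (C_derive m 0)) in *.
  assert (Ek : C_derive m 0 = RtoC k).
  { unfold k; revert J1; destruct (C_derive m 0); simpl; intros ->; reflexivity. }
  (* Differentiate [p (z0 exp s) = q (zeta m s)] twice at [s = 0] *)
  assert (Dm : forall s, Cmod s < r -> cder m s (C_derive m s)).
  { intros s Hs; apply (holo_cder m 0 _ r); auto; rewrite Csub_0_r; auto. }
  assert (Eq1 : forall s, Cmod s < r ->
    C_derive p (Z s) * Z s = C_derive q (zeta * m s) * (zeta * C_derive m s)).
  { intros s Hs; apply (cder_unique (fun s => p (Z s)) s).
    - apply (cder_comp p Z); [apply DZ|apply Dp; auto].
    - apply (cder_ext_loc (fun s => q (zeta * m s)) _ s _ (r - Cmod s)); [lra| |].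
      + intros y Hy; assert (Hyr : Cmod y < r) by (generalize (Cmod_rev_triangle y s); lra).
        rewrite Hzm; apply Hg, HZ; auto.
      + apply (cder_comp q (fun s => zeta * m s)); [apply cder_scal, Dm; auto|].
        apply (holo_cder q zeta _ d); auto; rewrite Hzm; apply Hg, HZ; auto. }
  assert (E1 := Eq1 0 C0r); rewrite Z0, Hm0, Cmult_1_r, Ek in E1.
  assert (Dp2 : cder (C_derive p) z0 (C_derive (C_derive p) z0)).
  { apply (holo_cder _ 0 z0 1); [apply holo_C_derive; auto|rewrite Csub_0_r; auto]. }
  assert (Dq2 : cder (C_derive q) zeta (C_derive (C_derive q) zeta)).
  { apply (holo_cder _ zeta zeta d); [apply holo_C_derive; auto|rewrite Cmod_self; lra]. }
  assert (Dm2 : cder (C_derive m) 0 (C_derive (C_derive m) 0)).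
  { apply (holo_cder _ 0 0 r); [apply holo_C_derive; auto|rewrite Csub_0_r; auto]. }
  set (P1 := C_derive p z0) in *; set (P2 := C_derive (C_derive p) z0) in *.
  set (Qq := C_derive q zeta) in *; set (Q2 := C_derive (C_derive q) zeta) in *.
  set (M2 := C_derive (C_derive m) 0) in *.
  assert (E2 : P2 * z0 * z0 + P1 * z0 = Q2 * (zeta * k) * (zeta * k) + Qq * (zeta * M2)).
  { apply (cder_unique (fun s => C_derive p (Z s) * Z s) 0).
    - assert (D0 := DZ 0); rewrite Z0 in D0.
      apply (cder_eq _ 0 (P2 * z0 * Z 0 + C_derive p (Z 0) * z0)); [|rewrite Z0; reflexivity].
      apply (cder_mult (fun s => C_derive p (Z s)) Z); auto.
      apply (cder_comp (C_derive p) Z); auto; rewrite Z0; exact Dp2.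
    - apply (cder_ext_loc (fun s => C_derive q (zeta * m s) * (zeta * C_derive m s)) _ 0 _ r Hr).
      + intros y Hy; rewrite Csub_0_r in Hy; symmetry; apply Eq1; auto.
      + apply (cder_eq _ 0 (Q2 * (zeta * k) * (zeta * C_derive m 0)
          + C_derive q (zeta * m 0) * (zeta * M2))); [|rewrite Hm0, Cmult_1_r, Ek; reflexivity].
        apply (cder_mult (fun s => C_derive q (zeta * m s)) (fun s => zeta * C_derive m s)).
        * apply (cder_comp (C_derive q) (fun s => zeta * m s)).
          -- apply cder_scal; rewrite <- Ek; apply Dm; auto.
          -- rewrite Hm0, Cmult_1_r; exact Dq2.
        * apply cder_scal; exact Dm2. }
  assert (Hk0 : RtoC k <> 0) by (intros E; apply RtoC_inj in E; lra).
  assert (HP1 : P1 <> 0).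
  { intros E; rewrite E, Cmult_0_l in E1; symmetry in E1; revert E1.
    apply Cmult_neq_0; auto; apply Cmult_neq_0; auto. }
  exists z0, zeta, k; fold P1 P2 Qq Q2.
  split; [exact Hz0|]; split; [exact Z1|]; split; [exact Z2|]; split; [exact J2|].
  split; [exact Hzn|]; split; [symmetry; exact Z3|]; split; [exact HP1|].
  split; [rewrite (Cmult_comm z0), E1; ring|].
  (* The quotient of [E2] by [E1]; Jack's bound [k * k <= Re M2] then supplies the summand [k]. *)
  assert (E3 : z0 * P2 / P1 + 1 = k * (zeta * Q2 / Qq) + M2 / k).
  { transitivity ((P2 * z0 * z0 + P1 * z0) / (P1 * z0)); [field; auto|].
    rewrite E2, E1; field; auto. }
  rewrite E3.
  replace (Re (k * (zeta * Q2 / Qq) + M2 / k)) with (k * Re (zeta * Q2 / Qq)%C + Re M2 / k)%R.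
  - change (Re (zeta * Q2 / Qq + 1)) with (Re (zeta * Q2 / Qq) + 1)%R.
    assert (k <= Re M2 / k); [|lra].
    apply Rle_div_r; lra.
  - assert (Ei : M2 / k = (/ k)%R * M2) by (rewrite RtoC_inv by lra; field; auto).
    rewrite Ei; generalize (zeta * Q2 / Qq) M2; intros [a b] [c e]; simpl; field; lra.
Qed.

(** * The operator [B_lambda^c] *)

Definition not_pole (lam : C) : Prop := forall n : nat, lam <> - INR n.

Lemma not_pole_plus (lam : C) (n : nat) : not_pole lam -> lam + INR n <> 0.
Proof. intros H E; apply (H n); replace lam with (lam + INR n - INR n) by ring; rewrite E; ring. Qed.

Lemma not_pole_neq0 (lam : C) : not_pole lam -> lam <> 0.
Proof. intros H E; apply (not_pole_plus lam 0 H); rewrite E; simpl; ring. Qed.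

Lemma not_pole_succ (lam : C) : not_pole lam -> not_pole (lam + 1).
Proof.
  intros H n E; apply (H (S n)); rewrite S_INR, RtoC_plus.
  replace lam with (lam + 1 - 1) by ring; rewrite E; ring.
Qed.

Lemma not_pole_pred (lam : C) : not_pole lam -> lam <> 1 -> not_pole (lam - 1).
Proof.
  intros H H1 n E.
  assert (El : lam = 1 - INR n) by (replace lam with (lam - 1 + 1) by ring; rewrite E; ring).
  destruct n as [|n]; [apply H1; rewrite El; simpl; ring|].
  apply (H n); rewrite El, S_INR, RtoC_plus; ring.
Qed.

Lemma pochhammer_neq0 (lam : C) (n : nat) : not_pole lam -> pochhammer lam n <> 0.
Proof.
  intros H; induction n as [|n IH]; simpl; [apply C1_nz|].
  apply Cmult_neq_0; auto; apply not_pole_plus; auto.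
Qed.

(** Both sides are [(lam)_(n+1)], with the last or the first factor split off. This is the source of
    the recurrence between consecutive operators. *)
Lemma pochhammer_shift (lam : C) (n : nat) :
  pochhammer lam n * (lam + INR n) = lam * pochhammer (lam + 1) n.
Proof.
  induction n as [|n IH]; [simpl; ring|].
  change (pochhammer lam (S n)) with (pochhammer lam n * (lam + INR n)).
  change (pochhammer (lam + 1) (S n)) with (pochhammer (lam + 1) n * (lam + 1 + INR n)).
  rewrite S_INR, RtoC_plus, IH; ring.
Qed.

Lemma INR_fact_C_neq0 (n : nat) : RtoC (INR (fact n)) <> 0.
Proof. intros E; apply RtoC_inj in E; exact (INR_fact_neq_0 n E). Qed.

Lemma Cpow4_neq0 (n : nat) : (4 : C) ^ n <> 0.
Proof.
  apply Cmod_gt_0; rewrite Cmod_pow; apply pow_lt; rewrite Cmod_R, Rabs_pos_eq; lra.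
Qed.

Definition B_mult (c lam : C) (n : nat) : C :=
  (- c) ^ n / (4 ^ n * pochhammer lam n * INR (fact n)).

Lemma B_mult_S (c lam : C) (n : nat) : not_pole lam ->
  B_mult c lam (S n) = - c / (4 * (lam + INR n) * INR (S n)) * B_mult c lam n.
Proof.
  intros H; unfold B_mult.
  rewrite fact_simpl, mult_INR, RtoC_mult.
  change ((- c) ^ S n) with (- c * (- c) ^ n); change ((4 : C) ^ S n) with (4 * 4 ^ n).
  change (pochhammer lam (S n)) with (pochhammer lam n * (lam + INR n)).
  assert (A1 := Cpow4_neq0 n); assert (A2 := pochhammer_neq0 lam n H).
  assert (A3 := not_pole_plus lam n H); assert (A4 := INR_fact_C_neq0 n).
  assert (A5 : RtoC (INR (S n)) <> 0) by (intros E; apply RtoC_inj in E; revert E; apply not_0_INR; lia).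
  assert (A6 : (4 : C) <> 0) by (intros E; apply RtoC_inj in E; lra).
  revert A1 A2 A3 A4 A5; generalize ((4 : C) ^ n) (pochhammer lam n) (lam + INR n)
    (RtoC (INR (fact n))) (RtoC (INR (S n))) ((- c) ^ n); intros x1 x2 x3 x4 x5 x6 A1 A2 A3 A4 A5.
  field; repeat split; auto.
Qed.

(** Once [n >= |lam| + |c|], the denominator of the ratio in [B_mult_S] exceeds [|c|] in modulus, so
    the moduli decrease from there on. *)
Lemma B_mult_bounded (c lam : C) : not_pole lam -> exists T, forall n, Cmod (B_mult c lam n) <= T.
Proof.
  intros H; destruct (INR_unbounded (Cmod lam + Cmod c)) as [N HN].
  apply (eventually_bounded _ N (Cmod (B_mult c lam N))); intros n Hn; induction Hn as [|n Hn IH]; [lra|].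
  eapply Rle_trans; [|exact IH].
  assert (A3 := not_pole_plus lam n H).
  assert (A5 : RtoC (INR (S n)) <> 0) by (intros E; apply RtoC_inj in E; revert E; apply not_0_INR; lia).
  assert (A6 : (4 : C) <> 0) by (intros E; apply RtoC_inj in E; lra).
  rewrite B_mult_S, Cmod_mult by auto.
  rewrite <- (Rmult_1_l (Cmod (B_mult c lam n))) at 2; apply Rmult_le_compat_r; [apply Cmod_ge_0|].
  rewrite Cmod_div, Cmod_opp, !Cmod_mult, !Cmod_R by (repeat apply Cmult_neq_0; auto).
  rewrite (Rabs_pos_eq 4), (Rabs_pos_eq (INR (S n))) by (try apply pos_INR; lra).
  assert (L1 := le_INR _ _ Hn); assert (L2 := Cmod_ge_0 c); assert (L3 := Cmod_ge_0 lam).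
  assert (L4 : INR n - Cmod lam <= Cmod (lam + INR n)).
  { assert (T := Cmod_rev_triangle (INR n) (- lam)).
    rewrite Cmod_R, Cmod_opp, Rabs_pos_eq in T by apply pos_INR.
    replace (INR n - - lam) with (lam + INR n) in T by ring; exact T. }
  assert (L5 : 1 <= INR (S n)) by (rewrite S_INR; generalize (pos_INR n); lra).
  assert (L6 : 0 < Cmod (lam + INR n)) by (apply Cmod_gt_0; auto).
  apply Rle_div_l; [nra|]; nra.
Qed.

(** The coefficient of [z ^ n] in [B f z / z] carries [a_(n+1)], which is [coefA f (m + 2)] for
    [n = S m]; the constant term is the normalization [1] of the class. *)
Definition B_coef (c lam : C) (f : classA) (n : nat) : C :=
  match n with O => 1 | S m => B_mult c lam n * coefA f (m + 2)%nat end.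

(** The series of [f] converges at a radius [r] between [|z|] and [1], so its terms there are
    bounded; with bounded multipliers this gives domination by powers of [|z| / r]. *)
Lemma B_ps (c lam : C) (f : classA) : not_pole lam ->
  ps (B_coef c lam f) (over_z (B_op c lam f)) 1.
Proof.
  intros H; destruct (B_mult_bounded c lam H) as [T HT].
  assert (HT0 : 0 <= T) by (eapply Rle_trans; [apply Cmod_ge_0|apply (HT 0%nat)]).
  intros z Hz.
  assert (Hz0 := Cmod_ge_0 z); set (r := ((1 + Cmod z) / 2)%R).
  assert (Hr : Cmod z < r < 1) by (unfold r; lra).
  assert (Hrm : Cmod r = r) by (rewrite Cmod_R, Rabs_pos_eq; lra).
  destruct (Cis_series_bounded _ _ (seriesA f r ltac:(unfold unit_disk; rewrite Hrm; lra))) as [M HM].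
  assert (HM0 : 0 <= M) by (eapply Rle_trans; [apply Cmod_ge_0|apply (HM 0%nat)]).
  assert (Hq : 0 <= Cmod z / r < 1).
  { split; [apply Rdiv_le_0_compat; lra|].
    apply Rmult_lt_reg_r with r; [lra|]; unfold Rdiv; rewrite Rmult_assoc, Rinv_l; lra. }
  destruct (ex_Cis_series_geom (fun m => B_coef c lam f (S m) * z ^ S m) (T * (M / r)) (Cmod z / r) Hq)
    as [l' Hl'].
  { intros m; unfold B_coef; specialize (HM m); specialize (HT (S m)).
    rewrite Cmod_mult, Cmod_pow, Hrm in HM; rewrite !Cmod_mult, Cmod_pow.
    assert (Hp : 0 < r ^ m) by (apply pow_lt; lra).
    assert (Hc : Cmod (coefA f (m + 2)%nat) * (r * r ^ m) <= M / r).
    { apply Rmult_le_reg_r with r; [lra|].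
      replace (M / r * r)%R with M by (field; lra).
      replace (m + 2)%nat with (S (S m)) in HM by lia; replace (m + 2)%nat with (S (S m)) by lia.
      simpl in HM |- *; lra. }
    assert (Hcc := Cmod_ge_0 (coefA f (m + 2)%nat)).
    assert (Hzm : 0 <= Cmod z ^ m) by (apply pow_le; auto).
    assert (Hcz : Cmod (coefA f (m + 2)%nat) * (Cmod z * r ^ m) <= M / r).
    { eapply Rle_trans; [|exact Hc]; apply Rmult_le_compat_l; auto; apply Rmult_le_compat_r; lra. }
    assert (HTc : Cmod (B_mult c lam (S m)) * (Cmod (coefA f (m + 2)%nat) * (Cmod z * r ^ m)) <= T * (M / r)).
    { apply Rmult_le_compat; auto; [apply Cmod_ge_0|].
      apply Rmult_le_pos; auto; apply Rmult_le_pos; lra. }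
    apply Rmult_le_reg_r with (r ^ m)%R; auto.
    replace (T * (M / r) * (Cmod z / r) ^ m * r ^ m)%R with (T * (M / r) * Cmod z ^ m)%R.
    - simpl; nra.
    - unfold Rdiv at 3; rewrite Rpow_mult_distr, pow_inv; field; split; lra. }
  assert (Hl : Cis_series (fun n => B_coef c lam f n * z ^ n) (l' + 1)).
  { apply Cis_series_shift; cbv beta; simpl (B_coef c lam f 0 * z ^ 0).
    replace (l' + 1 - 1 * 1) with l' by ring; exact Hl'. }
  replace (over_z (B_op c lam f) z) with (l' + 1); [exact Hl|].
  unfold over_z; destruct (Ceq_dec z 0) as [->|n].
  (* The value [1] that [over_z] assigns at [0] is the constant coefficient. *)
  - exact (Cis_series_unique _ _ _ Hl (Cis_series_at_0 (B_coef c lam f))).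
  - unfold B_op; rewrite (is_series_CSeries _ (z * l')); [field; auto|].
    apply (Cis_series_ext (fun m => z * (B_coef c lam f (S m) * z ^ S m))).
    + intros m; unfold B_term, B_coef, B_mult.
      replace (m + 1)%nat with (S m) by lia; replace (S m + 1)%nat with (m + 2)%nat by lia.
      replace (m + 2)%nat with (S (S m)) by lia; change (z ^ S (S m)) with (z * z ^ S m).
      assert (A1 := Cpow4_neq0 (S m)); assert (A2 := pochhammer_neq0 lam (S m) H).
      assert (A4 := INR_fact_C_neq0 (S m)).
      revert A1 A2 A4; generalize ((4 : C) ^ S m) (pochhammer lam (S m)) (RtoC (INR (fact (S m))))
        ((- c) ^ S m) (z ^ S m) (coefA f (S (S m))); intros; field; auto.
    + apply Cis_series_scal; exact Hl'.
Qed.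

(** The Euler operator [z d/dz] multiplies the [n]-th coefficient by [n]; it translates
    [B_coef_shift] into an identity of functions. *)
Lemma ps_Euler (a : nat -> C) (F : C -> C) (r : R) (z : C) : ps a F r -> Cmod z < r ->
  Cis_series (fun n => INR n * (a n * z ^ n)) (z * C_derive F z).
Proof.
  intros H Hz; destruct (ps_derive a F r H) as [H' _].
  apply Cis_series_shift; cbv beta.
  replace (z * C_derive F z - INR 0 * (a 0%nat * z ^ 0)) with (z * C_derive F z) by (simpl; ring).
  apply (Cis_series_ext (fun n => z * (ps_deriv a n * z ^ n))).
  - intros n; unfold ps_deriv; change (z ^ S n) with (z * z ^ n); ring.
  - apply Cis_series_scal, H'; auto.
Qed.

(** By [pochhammer_shift], [1 / (lam)_n = (1 + n / lam) / (lam + 1)_n]. *)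
Lemma B_coef_shift (c lam : C) (f : classA) (n : nat) : not_pole lam ->
  B_coef c lam f n = B_coef c (lam + 1) f n + / lam * (INR n * B_coef c (lam + 1) f n).
Proof.
  intros H; destruct n as [|n]; [simpl; ring|].
  unfold B_coef, B_mult.
  assert (A1 := Cpow4_neq0 (S n)); assert (A2 := pochhammer_neq0 lam (S n) H).
  assert (A3 := pochhammer_neq0 (lam + 1) (S n) (not_pole_succ lam H)).
  assert (A4 := INR_fact_C_neq0 (S n)); assert (A5 := not_pole_neq0 lam H).
  assert (E := pochhammer_shift lam (S n)).
  revert A1 A2 A3 A4 E; generalize ((4 : C) ^ S n) (pochhammer lam (S n)) (pochhammer (lam + 1) (S n))
    (RtoC (INR (fact (S n)))) (RtoC (INR (S n))) ((- c) ^ S n) (coefA f (n + 2)%nat).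
  intros x1 x2 x3 x4 x5 x6 x7 A1 A2 A3 A4 E.
  assert (E' : x3 = x2 * (lam + x5) / lam) by (rewrite E; field; auto).
  assert (A6 : lam + x5 <> 0) by (intros E0; apply A3; rewrite E', E0; field; auto).
  rewrite E'; field; repeat split; auto.
Qed.

Lemma B_recurrence (c lam : C) (f : classA) (z : C) : not_pole lam -> Cmod z < 1 ->
  over_z (B_op c lam f) z = over_z (B_op c (lam + 1) f) z
    + / lam * (z * C_derive (over_z (B_op c (lam + 1) f)) z).
Proof.
  intros H Hz; assert (H' := not_pole_succ lam H).
  apply (Cis_series_unique (fun n => B_coef c lam f n * z ^ n)); [apply B_ps; auto|].
  apply (Cis_series_ext (fun n => B_coef c (lam + 1) f n * z ^ n
    + / lam * (INR n * (B_coef c (lam + 1) f n * z ^ n)))).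
  - intros n; rewrite (B_coef_shift c lam f n H); ring.
  - apply Cis_series_plus; [apply B_ps; auto|].
    apply Cis_series_scal, (ps_Euler _ _ 1); auto; apply B_ps; auto.
Qed.

(** * Subordination from the admissibility condition *)

Theorem theorem2p15 (c kappa : C)
    (kappa_neq1 : kappa <> 1)
    (kappa_nonpole : forall n : nat, kappa <> - INR n)
    (Omega : C -> Prop) (q : C -> C)
    (qQ1 : class_Q1 q) (qH1 : class_H1 q)
    (phi : C -> C -> C -> C -> C)
    (phi_adm : admissible_H2 kappa Omega q phi)
    (f : classA)
    (f_incl : forall z : C, unit_disk z ->
       Omega (phi (over_z (B_op c (kappa + 1) f) z)
                  (over_z (B_op c kappa f) z)
                  (over_z (B_op c (kappa - 1) f) z)
                  z)) :
  subordinate (over_z (B_op c (kappa + 1) f)) q.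
Proof.
  destruct qQ1 as [HQ q0], qH1 as [Hq _]; apply analytic_in_disk_holo in Hq.
  assert (Hk := not_pole_succ kappa kappa_nonpole).
  assert (Hkm := not_pole_pred kappa kappa_nonpole kappa_neq1).
  assert (K0 := not_pole_neq0 kappa kappa_nonpole); assert (K1 := Csub_neq0 _ _ kappa_neq1).
  set (U := over_z (B_op c (kappa + 1) f)) in *.
  set (V := over_z (B_op c kappa f)) in *.
  assert (HU : holo U 0 1).
  { intros z Hz; rewrite Csub_0_r in Hz; exists (C_derive U z).
    apply (ps_derive _ _ 1 (B_ps c (kappa + 1) f Hk)); auto. }
  assert (HV : forall z, Cmod z < 1 -> V z = U z + / kappa * (z * C_derive U z))
    by (intros z Hz; apply (B_recurrence c kappa f z kappa_nonpole Hz)).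
  destruct (Miller_Mocanu U q HQ Hq HU)
    as [|(z & zeta & k & Hz & Hzeta & HE & Hk1 & Hz0 & Ep & HU1 & E1 & HRe)];
    [|assumption|].
  { rewrite q0; unfold U, over_z; destruct (Ceq_dec 0 0); congruence. }
  exfalso.
  assert (HW : over_z (B_op c (kappa - 1) f) z = V z + / (kappa - 1) * (z * C_derive V z)).
  { rewrite (B_recurrence c (kappa - 1) f z Hkm Hz).
    replace (kappa - 1 + 1) with kappa by ring; reflexivity. }
  assert (DV : C_derive V z = C_derive U z + / kappa * (C_derive U z + z * C_derive (C_derive U) z)).
  { assert (Hz' : Cmod (z - 0) < 1) by (rewrite Csub_0_r; exact Hz).
    apply C_derive_cder.
    apply (cder_ext_loc (fun y => U y + / kappa * (y * C_derive U y)) V z _ (1 - Cmod z)).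
    - unfold unit_disk in Hz; lra.
    - intros y Hy; symmetry; apply HV; generalize (Cmod_rev_triangle y z); lra.
    - apply cder_plus; [apply (holo_cder U 0 z 1); auto|].
      apply cder_scal; rewrite <- (Cmult_1_l (C_derive U z)) at 1.
      apply (cder_mult (fun y => y)); [apply cder_id|].
      apply (holo_cder _ 0 z 1); auto; apply holo_C_derive; auto. }
  refine (phi_adm (U z) (V z) (over_z (B_op c (kappa - 1) f) z) z zeta k
    Hz Hzeta HE Hk1 Ep _ _ (f_incl z Hz)).
  (* The contact relation [z U' = k zeta q'] turns [V = U + z U' / kappa] into the prescribed
     [v]. *)
  - rewrite HV, E1, Ep by exact Hz; field; auto.
  - replace ((kappa - 1) * (over_z (B_op c (kappa - 1) f) z - U z) / (V z - U z) + (1 - 2 * kappa))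
      with (z * C_derive (C_derive U) z / C_derive U z + 1); [exact HRe|].
    (* Since [z V' = z U' + (z U' + z^2 U'') / kappa], the quotient equals [2 kappa + z U'' / U'],
       and [1 - 2 kappa] leaves [1 + z U'' / U']. The division is genuine, because [z] and [U' z]
       are nonzero at the contact point. *)
    assert (HVU : V z - U z = / kappa * (z * C_derive U z)) by (rewrite HV by exact Hz; ring).
    rewrite HVU, HW, DV, HV by exact Hz.
    field; auto.
Qed.
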